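(* Let $m$ be a Gibbs measure of a topologically mixing countable Markov shift $(X,T)$ for a locally Hölder continuous potential $\phi$ (with respect to a fixed $\theta\in(0,1)$). Then there is a constant $a>0$, depending only on $(X,T)$, $\phi$ and $\theta$, such that for every exhaustive sequence $(A_n)$ of aperiodic finite submatrices of the transition matrix $A$, with associated equilibrium measures $m_n$, for every $n$ and every $f\in\mathcal{L}$, $$|m(f)-m_n(f)|\leq a\,\|f\|_{\mathcal{L}}\,\bigl(P_{GS}(\phi)-P(\phi|_n)\bigr)^{\frac12}.$$
   Context: Let $S$ be a countable set of states and $A=(t_{ij})_{i,j\in S}$ a matrix with entries in $\{0,1\}$ (the transition matrix). The countable Markov shift is $X=\{x=(x_0,x_1,\dots)\in S^{\mathbb{N}_0}: t_{x_ix_{i+1}}=1 \text{ for all } i\ge 0\}$ with the left shift $T:X\to X$, assumed topologically mixing. Cylinders are $[a_0,\dots,a_{n-1}]=\{x\in X: x_i=a_i,\ 0\le i<n\}$. Fix $\theta\in(0,1)$ and the metric $d(x,y)=\theta^{\min\{i:x_i\ne y_i\}}$ for $x\neq y$, $d(x,x)=0$. For $\phi:X\to\mathbb{R}$ put $\phi_n=\phi+\phi\circ T+\dots+\phi\circ T^{n-1}$ and $\mathrm{var}_n\phi=\sup\{\phi(x)-\phi(y): x,y\in X,\ x_i=y_i \text{ for } i<n\}$. $\phi$ is locally Hölder continuous if there is $A_\phi>0$ with $\mathrm{var}_n\phi\le A_\phi\theta^n$ for all $n\ge1$. A $T$-invariant Borel probability measure $m$ on $X$ is a Gibbs measure for $\phi$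 if there are constants $C,P$ such that for every cylinder $[a_0,\dots,a_{n-1}]$ and every $x\in[a_0,\dots,a_{n-1}]$, $\frac1C\le \frac{m([a_0,\dots,a_{n-1}])}{e^{\phi_n(x)-nP}}\le C$. The Gurevich-Sarig pressure is $P_{GS}(\phi)=\lim_{n\to\infty}\frac1n\log\sum_{x\in X,\,T^nx=x}e^{\phi_n(x)}1_{[s]}(x)$ for any $s\in S$ (the limit exists and is independent of $s$; it is finite when a Gibbs measure exists). Finite subsystems: let $S_n\subset S$ be finite subsets and $A_n=(t_{ij})_{i,j\in S_n}$ the corresponding submatrices of $A$, each assumed irreducible and aperiodic. Let $X_n=\{x\in S_n^{\mathbb{N}_0}: t_{x_ix_{i+1}}=1 \text{ for all } i\}\subset X$, which is $T$-invariant. The sequence $(A_n)$ is exhaustive if $\bigcup_nS_n=S$ and $A_n$ is a submatrix of $A_{n+1}$ (i.e. $S_n\subset S_{n+1}$) for all $n$. Let $\phi|_n$ be the restriction of $\phi$ to $X_n$, and let $m_n$ be the unique equilibrium measure of $\phi|_n$ on $X_n$, i.e. the unique $T$-invariant probability measure on $X_n$ maximizing $h_\mu(T)+\mu(\phi|_n)$ (where $h_\mu(T)$ is Kolmogorov–Sinai entropy and $\mu(g)=\int g\,d\mu$); its pressure is $P(\phi|_n)=h_{m_n}(T)+m_n(\phi|_n)$. The measure $m_n$ is also regarded as a measure on $X$. For continuous $f:X\to\mathbb{R}$ let $\|f\|_\theta=\sup\{|f(x)-f(y)|/d(x,y): x\neq y,\ x_0=y_0\}$ and $\|f\|_{\mathcal{L}}=\|f\|_\theta+\|f\|_\infty$;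 $\mathcal{L}$ is the Banach space of those $f$ with $\|f\|_{\mathcal{L}}<\infty$. *)

(* Defs.v *)
From HB Require Import structures.
From mathcomp Require Import all_boot all_order all_algebra finmap.
From mathcomp Require Import all_classical all_reals all_analysis.

Set Implicit Arguments.
Unset Strict Implicit.
Unset Printing Implicit Defensive.

Import Order.TTheory GRing.Theory Num.Theory.
Import numFieldNormedType.Exports.

Local Open Scope classical_set_scope.
Local Open Scope ring_scope.

Definition admissible (S : Type) (A : rel S) : set (nat -> S) :=
  [set x | forall i, A (x i) (x i.+1)].

(* The library's measurable spaces are pointed, so the shift space has to be
   nonempty; it always is as soon as it carries a probability measure. *)
Record transMatrix (S : Type) := TransMatrix {
  trans :> rel S;
  trans_admissible : admissible trans !=set0
}.

(* The product topology of the discrete topologies; [mshift_openE] below shows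
   that it is the topology of the metric [dist]. *)
Definition mshift (S : countType) (A : transMatrix S) : Type :=
  set_type (admissible A
    : set (prod_topology (fun _ : nat => discrete_topology S))).

HB.instance Definition _ (S : countType) (A : transMatrix S) :=
  Topological.copy (mshift A)
    (set_type (admissible A
       : set (prod_topology (fun _ : nat => discrete_topology S)))).

Definition coords (S : countType) (A : transMatrix S) (x : mshift A) :
  nat -> S := set_val x.
Coercion coords : mshift >-> Funclass.

Lemma mshiftP (S : countType) (A : transMatrix S) (x : mshift A) i :
  A (x i) (x i.+1).
Proof. exact: (set_mem (valP x)). Qed.

Definition mkshift (S : countType) (A : transMatrix S) (x : nat -> S)
  (Ax : admissible A x) : mshift A := SigSub (mem_set Ax).

HB.instance Definition _ (S : countType) (A : transMatrix S) :=
  isPointed.Build (mshift A) (mkshift (projT2 (cid (trans_admissible A)))).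

HB.instance Definition _ (S : countType) (A : transMatrix S) :=
  Measurable.copy (mshift A) (g_sigma_algebraType (@open (mshift A))).

Section Dynamics.
Variables (S : countType) (A : transMatrix S).
Implicit Types x y : mshift A.

Lemma left_shift_admissible x : admissible A (fun i => x i.+1).
Proof. by move=> i; exact: mshiftP. Qed.

Definition left_shift x : mshift A := mkshift (left_shift_admissible x).

Definition cylinder n (a : n.-tuple S) : set (mshift A) :=
  [set x : mshift A | forall i : 'I_n, x i = tnth a i].

Definition subsystem (F : {fset S}) : set (mshift A) :=
  [set x : mshift A | forall i, x i \in F].

End Dynamics.
Arguments cylinder {S} A {n} a.
Arguments subsystem {S} A F.

Definition topologically_mixing (Y : topologicalType) (T : Y -> Y) :=
  forall U V : set Y, open U -> open V -> U !=set0 -> V !=set0 ->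
  exists N, forall n, (N <= n)%N -> (U `&` iter n T @^-1` V) !=set0.

Section Matrices.
Variables (I : eqType) (B : rel I).

Definition walk (k : nat) (i j : I) :=
  exists p : seq I, [/\ size p = k, path B i p & last i p = j].

Definition irreducible := forall i j, exists2 k, (0 < k)%N & walk k i j.

(* The gcd of the lengths of the closed walks at [i] is 1. *)
Definition aperiodic := forall i d,
  (forall k, (0 < k)%N -> walk k i i -> (d %| k)%N) -> d = 1%N.

End Matrices.

Definition submatrix (S : countType) (A : rel S) (F : {fset S}) : rel F :=
  fun i j => A (val i) (val j).
Arguments submatrix {S} A F.

Definition exhaustive (S : countType) (A : rel S) (S_ : nat -> {fset S}) :=
  [/\ forall n, irreducible (submatrix A (S_ n)) /\
                aperiodic (submatrix A (S_ n)),
      forall n, (S_ n `<=` S_ n.+1)%fset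
    & forall s, exists n, s \in S_ n].

Section Metric.
Variables (R : realType) (S : countType) (A : transMatrix S) (theta : R).
Implicit Types (x y : mshift A) (f phi : mshift A -> R).

Definition dist x y : R :=
  match pselect (exists i, x i != y i) with
  | left neq_xy => theta ^+ ex_minn neq_xy
  | right _ => 0
  end.

Section MetricTopology.
Hypothesis theta01 : 0 < theta < 1.

Lemma dist_ltP n x y :
  dist x y < theta ^+ n <-> forall i, (i <= n)%N -> x i = y i.
Proof.
have [t0 t1] := andP theta01.
rewrite /dist; case: pselect => [h|h]; last first.
  rewrite exprn_gt0//; split=> // _ i _.
  by apply/eqP/negP => /negP xy; apply: h; exists i.
rewrite ltr_iXn2l//; case: ex_minnP => k xyk kmin; split=> [nk i le_in|agree].
  apply/eqP/negP => /negP /kmin ki.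
  by have := leq_ltn_trans (leq_trans ki le_in) nk; rewrite ltnn.
by rewrite ltnNge; apply/negP => kn; move/eqP: xyk; apply; exact: agree.
Qed.

Lemma nbhs_mshiftP x (U : set (mshift A)) :
  nbhs x U <-> exists n, forall y, (forall i, (i <= n)%N -> x i = y i) -> U y.
Proof.
pose P := prod_topology (fun _ : nat => discrete_topology S).
pose cyl n := [set z : P | forall i, (i <= n)%N -> coords x i = z i].
split.
  case=> _ [[V oV <-] Vx VU].
  pose F : set_system P := filter_from setT cyl.
  have FF : Filter F.
    apply: filter_from_filter; first by exists 0%N.
    move=> m n _ _; exists (maxn m n) => // z zP; split=> i il; apply: zP.
      by rewrite (leq_trans il) ?leq_maxl.
    by rewrite (leq_trans il) ?leq_maxr.
  have Fx : F --> (coords x : P).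
    apply/cvg_sup => i; apply/cvg_image.
      by rewrite eqEsubset; split=> // s _; exists (fun=> s).
    move=> W /= Wx; exists [set z : P | W (z i)]; last first.
      by rewrite eqEsubset; split=> [_ [z Wz <-]//|s Ws]; exists (fun=> s).
    exists i => // z zP /=; rewrite -(zP i (leqnn i)); exact: nbhs_singleton Wx.
  have [n _ nV] : F V by apply: Fx; exact: open_nbhs_nbhs.
  by exists n => y xy; apply: VU; exact: nV.
case=> n nU.
have nbhs_coord i : nbhs (coords x : P) [set z : P | z i = coords x i].
  exact: (@proj_continuous _ (fun=> discrete_topology S) i (coords x)
            [set coords x i] (discrete_set1 _)).
have nbhs_cyl : nbhs (coords x : P) (cyl n).
  elim: n {nU} => [|n IHn].
    by apply: filterS (nbhs_coord 0%N) => z zx [|].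
  apply: filterS2 IHn (nbhs_coord n.+1) => z zn zn1 i.
  by rewrite leq_eqVlt => /predU1P[->|/zn].
have := @initial_continuous (mshift A) P set_val x _ nbhs_cyl.
rewrite nbhs_filterE /= => nb.
by apply: (filterS _ nb).
Qed.

Lemma mshift_openE (U : set (mshift A)) :
  open U <->
  forall x, U x -> exists2 e, 0 < e & forall y, dist x y < e -> U y.
Proof.
have [t0 t1] := andP theta01.
rewrite openE; split=> UP x Ux.
  have /nbhs_mshiftP[n nU] := UP x Ux.
  by exists (theta ^+ n); [exact: exprn_gt0|move=> y /dist_ltP; exact: nU].
have [e e0 eU] := UP x Ux; apply/nbhs_mshiftP.
have [n _ ne] : \forall n \near \oo, theta ^+ n < e.
  apply: (cvgr_lt 0) => //.
  by apply: cvg_expr; rewrite ger0_norm// ltW.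
exists n => y /dist_ltP xy; apply: eU.
exact: lt_trans xy (ne n (leqnn n)).
Qed.

End MetricTopology.

Local Open Scope ereal_scope.

Definition var_n n phi : \bar R :=
  ereal_sup [set e | exists x y,
    (forall i, (i < n)%N -> x i = y i) /\ e = (phi x - phi y)%:E].

Definition locally_holder phi :=
  exists2 C : R, (0 < C)%R &
    forall n, (1 <= n)%N -> var_n n phi <= (C * theta ^+ n)%:E.

(* The value 0 is the supremum over the empty set of pairs. *)
Definition theta_seminorm f : \bar R :=
  ereal_sup (0 |` [set e | exists x y,
    [/\ x <> y, x 0%N = y 0%N & e = (`|f x - f y| / dist x y)%:E]]).

Definition sup_norm f : \bar R := ereal_sup [set `|f x|%:E | x in setT].

Definition L_norm f := theta_seminorm f + sup_norm f.

Definition L_space : set (mshift A -> R) :=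
  [set f | continuous f /\ L_norm f < +oo].

End Metric.

Section Entropy.
Variables (R : realType) (d : measure_display) (Y : measurableType d).
Variables (T : Y -> Y) (mu : probability Y R).

Definition invariant_measure :=
  forall B, measurable B -> mu (T @^-1` B) = mu B.

Definition finite_partition k (P : 'I_k -> set Y) :=
  [/\ forall i, measurable (P i), trivIset setT P & \bigcup_i P i = setT].

Definition refined_atom k (P : 'I_k -> set Y) n (w : {ffun 'I_n -> 'I_k}) :
  set Y := \bigcap_(i : 'I_n) (iter i T @^-1` P (w i)).

(* [ln 0 = 0], so null atoms contribute 0. *)
Definition partition_entropy k (P : 'I_k -> set Y) n : R :=
  \sum_(w : {ffun 'I_n -> 'I_k})
    let p := fine (mu (refined_atom P w)) in - (p * ln p).

Definition entropy_wrt k (P : 'I_k -> set Y) : R :=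
  limn (fun n => partition_entropy P n / n%:R).

Definition ks_entropy : \bar R :=
  ereal_sup [set e | exists k (P : 'I_k -> set Y),
    finite_partition P /\ e = (entropy_wrt P)%:E].

End Entropy.

Section Thermodynamics.
Variables (R : realType) (S : countType) (A : transMatrix S).
Variable phi : mshift A -> R.
Local Notation T := (@left_shift S A).
Local Open Scope ereal_scope.

Definition birkhoff n (x : mshift A) : R := (\sum_(i < n) phi (iter i T x))%R.

Definition gibbs (m : probability (mshift A) R) :=
  invariant_measure T m /\
  exists C P : R, (0 < C)%R /\
    forall n (a : n.+1.-tuple S) x, cylinder A a x ->
      (C^-1 <= fine (m (cylinder A a)) / expR (birkhoff n.+1 x - n.+1%:R * P)
            <= C)%R.

Definition gurevich_sarig_pressure (s : S) : \bar R :=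
  limn (fun n => (n%:R^-1)%:E *
    lne (\esum_(x in [set x : mshift A | iter n T x = x /\ x 0%N = s])
           (expR (birkhoff n x))%:E)).

(* An invariant probability measure on an invariant Borel set [Y] is
   represented by the invariant probability measure on the whole shift space
   that gives [Y] mass 1; its entropy is unaffected. *)
Definition invariant_on (Y : set (mshift A)) (mu : probability (mshift A) R) :=
  invariant_measure T mu /\ mu Y = 1.

Definition free_energy (Y : set (mshift A)) (mu : probability (mshift A) R) :
  \bar R := ks_entropy T mu + \int[mu]_(x in Y) (phi x)%:E.

Definition equilibrium_on (Y : set (mshift A))
    (mu : probability (mshift A) R) :=
  invariant_on Y mu /\
  forall nu, invariant_on Y nu -> free_energy Y nu <= free_energy Y mu.

End Thermodynamics.

(* Main.v *)
(* Write [delta] for the pressure minus the free energy of an invariant measure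
   [mu] carried by a finite subsystem. Everything follows from
     [delta >= t (mu f - m f) - 4 t^2 G^2]  for all real [t],
   with [G] a multiple of the norm of [f]: optimize over [t].
   By the variational inequality for [phi + t f], it suffices to bound the
   exponential growth rate of the sums of [exp ((phi + t f)_n)] over separated
   families by [P + t m(f) + 4 t^2 G^2]. The Gibbs property and mixing yield
   big images and preimages, hence a Doeblin condition for the transfer operator
   truncated to finite alphabets, with constants that do not depend on the
   alphabet. The normalized operators are then contracting Markov operators, so
   the conditional expectations of [f_n] given the symbols read so far (from
   right to left) form a martingale with differences bounded by [G], and
   Hoeffding's lemma bounds the exponential moments of [f_n]. Jensen's inequality
   for the Gibbs measure identifies the mean drift with [m(f)]. *)
Require Import Defs.
From HB Require Import structures.
From mathcomp Require Import all_boot all_order all_algebra finmap.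
From mathcomp Require Import all_classical all_reals all_analysis.
From mathcomp Require Import measurable_realfun ring lra.

Set Implicit Arguments.
Unset Strict Implicit.
Unset Printing Implicit Defensive.

Import Order.TTheory GRing.Theory Num.Theory.
Import numFieldNormedType.Exports.

Local Open Scope classical_set_scope.
Local Open Scope ring_scope.

(** * Sequences in a Markov shift *)

Section Shift.
Variables (S : countType) (A : transMatrix S).
Implicit Types x y z : mshift A.
Local Notation T := (@left_shift S A).

(** The alphabet of the truncated operator cannot be fixed in advance: for words of length [n] it
    must contain every letter of the given family and carry all but a fraction [1/n] of the mass of
    the Gibbs measure. It changes with [n], so no eigenfunction or eigenmeasure of a single operator
    is available. They are replaced by the weights [L^n 1] and by an oscillation bound uniform over
    all large enough alphabets. Jensen's inequality alone locates the drift only up to an error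
    quadratic in the parameter. It is therefore applied at [- t s] with [s] small and divided by
    [s]: the error becomes an arbitrarily small multiple of [n], while the terms independent of [n],
    though multiplied by [1/s], vanish after division by [n]. The final constant may not depend on
    the Gibbs measure. Hence the oscillation constant comes from one Gibbs measure fixed beforehand,
    and the Gibbs constant of any other one enters only additive terms. Both measures have the same
    [P], because periodic orbits compute it from the potential alone. *)

Definition agree n x y := forall i, (i < n)%N -> x i = y i.

Lemma agree_refl n x : agree n x x. Proof. by []. Qed.

Lemma agree_sym n x y : agree n x y -> agree n y x.
Proof. by move=> xy i /xy ->. Qed.

Lemma agree_trans n x y z : agree n x y -> agree n y z -> agree n x z.
Proof. by move=> xy yz i ni; rewrite xy// yz. Qed.

Lemma agree_le m n x y : (m <= n)%N -> agree n x y -> agree m x y.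
Proof. by move=> mn xy i im; apply: xy; exact: leq_trans mn. Qed.

Lemma mshift_inj x y : (forall i, x i = y i) -> x = y.
Proof. by move=> xy; apply: val_inj; apply/funext. Qed.

Lemma mkshiftE (z : nat -> S) (Az : admissible A z) i : mkshift Az i = z i.
Proof. by []. Qed.

Lemma left_shiftE x i : T x i = x i.+1.
Proof. by []. Qed.

Lemma iter_left_shiftE n x i : iter n T x i = x (n + i)%N.
Proof. by elim: n i => // n IHn i; rewrite iterS left_shiftE IHn addnS. Qed.

Lemma agree_iter_left_shift m n x y :
  agree (m + n) x y -> agree n (iter m T x) (iter m T y).
Proof. by move=> xy i ni; rewrite !iter_left_shiftE xy// ltn_add2l. Qed.

Lemma splice_ex n y x : A (y n) (x 0%N) ->
  exists z, agree n.+1 z y /\ iter n.+1 T z = x.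
Proof.
move=> yx; pose z i := if (i <= n)%N then y i else x (i - n.+1)%N.
have Az : admissible A z.
  move=> i; rewrite /z; case: (ltngtP i n) => [lt_in|gt_in|->].
  - exact: mshiftP.
  - by rewrite subSS -(subnSK gt_in); exact: mshiftP.
  - by rewrite subnn.
exists (mkshift Az); split => [i|]; first by rewrite ltnS mkshiftE /z => ->.
apply: mshift_inj => i; rewrite iter_left_shiftE mkshiftE /z.
by rewrite leqNgt ltnS leq_addr/= addKn.
Qed.

Lemma periodic_ex n y : A (y n) (y 0%N) ->
  exists z, agree n.+1 z y /\ iter n.+1 T z = z.
Proof.
move=> yy; pose z i := y (i %% n.+1)%N.
have Az : admissible A z.
  move=> i; rewrite /z -[i.+1]addn1 -modnDml addn1.
  have := ltn_pmod i (ltn0Sn n); rewrite ltnS leq_eqVlt => /predU1P[->|lt_in].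
    by rewrite modnn.
  by rewrite (@modn_small (i %% n.+1).+1) ?ltnS//; exact: mshiftP.
exists (mkshift Az); split => [i lt_in|].
  by rewrite mkshiftE /z modn_small.
apply: mshift_inj => i; rewrite iter_left_shiftE !mkshiftE /z.
by rewrite addnC modnDr.
Qed.

Definition scons_fun s x i := if i is j.+1 then x j else s.

Lemma scons_admissible s x : A s (x 0%N) -> admissible A (scons_fun s x).
Proof. by move=> sx [|i] //=; exact: mshiftP. Qed.

(* Total on purpose: the junk value [x] is used when [s] cannot precede [x]. *)
Definition scons s x : mshift A :=
  if @idP (A s (x 0%N)) is ReflectT sx then mkshift (scons_admissible sx)
  else x.

Lemma scons0 s x : A s (x 0%N) -> scons s x 0%N = s.
Proof. by rewrite /scons; case: {-}_ / idP. Qed.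

Lemma sconsS s x i : A s (x 0%N) -> scons s x i.+1 = x i.
Proof. by rewrite /scons; case: {-}_ / idP. Qed.

Lemma left_shift_scons s x : A s (x 0%N) -> T (scons s x) = x.
Proof. by move=> sx; apply: mshift_inj => i; rewrite left_shiftE sconsS. Qed.

Lemma scons_left_shift x : scons (x 0%N) (T x) = x.
Proof.
have xx : A (x 0%N) (T x 0%N) by exact: mshiftP.
by apply: mshift_inj => -[|i]; rewrite ?scons0 ?sconsS.
Qed.

Lemma agree_scons n s x y : A s (x 0%N) -> A s (y 0%N) -> agree n x y ->
  agree n.+1 (scons s x) (scons s y).
Proof.
move=> sx sy xy [|i]; first by rewrite !scons0.
by rewrite ltnS => ni; rewrite !sconsS// xy.
Qed.

End Shift.

(** * Birkhoff sums and truncated transfer operators *)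

Section Holder.
Variables (R : realType) (S : countType) (A : transMatrix S) (theta : R).
Hypothesis theta01 : 0 < theta < 1.
Implicit Types (x y z : mshift A) (f g phi : mshift A -> R).
Local Notation T := (@left_shift S A).

(** Two-sided by the symmetry of [agree]. With [0 < r], nothing is asked of points with different
    first letters, since a locally Hölder potential may be unbounded. *)
Definition holder c f :=
  forall r x y, (0 < r)%N -> agree r x y -> f x - f y <= c * theta ^+ r.

(** An enclosing interval instead of a supremum: averaging operators keep the same interval. *)
Definition osc o f := exists lo, forall x, lo <= f x <= lo + o.

Let theta_gt0 : 0 < theta. Proof. by case/andP: theta01. Qed.
Let theta_lt1 : theta < 1. Proof. by case/andP: theta01. Qed.

Lemma holderD c c' f g : holder c f -> holder c' g ->
  holder (c + c') (fun x => f x + g x).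
Proof.
move=> fc gc r x y r0 xy; have := fc r x y r0 xy; have := gc r x y r0 xy.
by rewrite mulrDl; lra.
Qed.

Lemma holderM c t f : 0 <= c -> holder c f ->
  holder (`|t| * c) (fun x => t * f x).
Proof.
move=> c0 fc r x y r0 xy.
have fxy : `|f x - f y| <= c * theta ^+ r.
  by rewrite ler_norml fc// andbT lerNl opprB fc//; exact: agree_sym.
rewrite -mulrBr (le_trans (ler_norm _))// normrM -mulrA.
exact: ler_wpM2l.
Qed.

Lemma holder_le c c' f : c <= c' -> holder c f -> holder c' f.
Proof.
move=> cc' fc r x y r0 xy; apply: (le_trans (fc r x y r0 xy)).
by rewrite ler_wpM2r// exprn_ge0// ltW.
Qed.

Lemma oscD o o' f g : osc o f -> osc o' g -> osc (o + o') (fun x => f x + g x).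
Proof.
move=> [a fa] [b gb]; exists (a + b) => x.
by have := fa x; have := gb x; lra.
Qed.

Lemma osc_le o o' f : o <= o' -> osc o f -> osc o' f.
Proof. by move=> oo' [a fa]; exists a => x; have := fa x; lra. Qed.

Lemma osc_ge0 o f : osc o f -> 0 <= o.
Proof. by move=> [a fa]; have := fa point; lra. Qed.

Lemma birkhoff0 phi x : birkhoff phi 0 x = 0.
Proof. by rewrite /birkhoff big_ord0. Qed.

Lemma birkhoffSr phi n x :
  birkhoff phi n.+1 x = birkhoff phi n x + phi (iter n T x).
Proof. by rewrite /birkhoff big_ord_recr. Qed.

Lemma birkhoffSl phi n x :
  birkhoff phi n.+1 x = phi x + birkhoff phi n (T x).
Proof.
rewrite /birkhoff big_ord_recl/=; congr (_ + _).
by apply: eq_bigr => i _; rewrite -iterSr.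
Qed.

Lemma birkhoff_add phi m n x :
  birkhoff phi (m + n) x = birkhoff phi m x + birkhoff phi n (iter m T x).
Proof.
elim: n => [|n IHn]; first by rewrite addn0 birkhoff0 addr0.
by rewrite addnS !birkhoffSr IHn -addrA -iterD addnC.
Qed.

Lemma birkhoffD f g n x :
  birkhoff (fun x => f x + g x) n x = birkhoff f n x + birkhoff g n x.
Proof. by rewrite /birkhoff big_split. Qed.

Lemma birkhoffM t f n x :
  birkhoff (fun x => t * f x) n x = t * birkhoff f n x.
Proof. by rewrite /birkhoff mulr_sumr. Qed.

(* The fixed point of [b = (c + b) theta]: the sum of a geometric series. *)
Definition distortion c := c * theta / (1 - theta).

Lemma distortionE c : (c + distortion c) * theta = distortion c.
Proof. by rewrite /distortion; field; rewrite subr_eq0 gt_eqF. Qed.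

Lemma distortion_step c r :
  c * theta ^+ r.+1 + distortion c * theta ^+ r.+1 = distortion c * theta ^+ r.
Proof. by rewrite -mulrDl exprS mulrA distortionE. Qed.

Lemma distortion_ge0 c : 0 <= c -> 0 <= distortion c.
Proof.
by move=> c0; rewrite /distortion divr_ge0// ?mulr_ge0// ?subr_ge0 ltW.
Qed.

(** The discrepancies along the orbit form a geometric series. Removing the last term raises [r] by
    one, and [distortion] is the constant for which this induction closes. *)
Lemma birkhoff_distortion_pow c phi : 0 <= c -> holder c phi ->
  forall n r x y, agree (n + r) x y ->
  birkhoff phi n x - birkhoff phi n y <= distortion c * theta ^+ r.
Proof.
move=> c0 phic; elim=> [|n IHn] r x y.
  rewrite !birkhoff0 subrr => _.
  by rewrite mulr_ge0 ?distortion_ge0// exprn_ge0// ltW.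
move=> xy; rewrite !birkhoffSr.
have := IHn r.+1 x y; rewrite addnS => /(_ xy).
have := distortion_step c r.
have : phi (iter n T x) - phi (iter n T y) <= c * theta ^+ r.+1.
  by apply: phic => //; apply: agree_iter_left_shift; rewrite addnS.
lra.
Qed.

Lemma birkhoff_distortion c phi : 0 <= c -> holder c phi ->
  forall n x y, agree n x y ->
  birkhoff phi n x - birkhoff phi n y <= distortion c.
Proof.
move=> c0 phic n x y xy.
have := @birkhoff_distortion_pow c phi c0 phic n 0 x y.
by rewrite addn0 mulr1; exact.
Qed.

End Holder.

(** * Truncated transfer operators *)

Section Transfer.
Variables (R : realType) (S : countType) (A : transMatrix S).
Implicit Types (x y z : mshift A) (f g h phi psi : mshift A -> R).
Local Notation T := (@left_shift S A).
Variable E : {fset S}.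

(** Only the prepended letter is confined to [E]; the point [x] ranges over the whole shift, so
    operators with different alphabets act on the same functions. *)
Definition transfer psi g x :=
  \sum_(s <- E | A s (x 0%N)) expR (psi (scons s x)) * g (scons s x).

Lemma transfer_le psi f g : (forall x, f x <= g x) ->
  forall x, transfer psi f x <= transfer psi g x.
Proof. by move=> fg x; apply: ler_sum => s _; rewrite ler_wpM2l ?expR_ge0. Qed.

Lemma transferD psi f g x :
  transfer psi (fun x => f x + g x) x = transfer psi f x + transfer psi g x.
Proof. by rewrite -big_split; apply: eq_bigr => s _; rewrite mulrDr. Qed.

Lemma transferM psi c g x :
  transfer psi (fun x => c * g x) x = c * transfer psi g x.
Proof. by rewrite mulr_sumr; apply: eq_bigr => s _; rewrite mulrCA. Qed.

Lemma transfer_ge0 psi g : (forall x, 0 <= g x) ->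
  forall x, 0 <= transfer psi g x.
Proof. by move=> g0 x; apply: sumr_ge0 => s _; rewrite mulr_ge0 ?expR_ge0. Qed.

Lemma transfer_ge psi g x : (forall x, 0 <= g x) -> x 0%N \in E ->
  expR (psi x) * g x <= transfer psi g (T x).
Proof.
move=> g0 xE; rewrite /transfer big_mkcond (big_fsetD1 (x 0%N))//= mshiftP.
rewrite scons_left_shift lerDl sumr_ge0// => s _.
by case: ifP => // _; rewrite mulr_ge0 ?expR_ge0.
Qed.

Lemma iter_transfer_le psi n f g : (forall x, f x <= g x) ->
  forall x, iter n (transfer psi) f x <= iter n (transfer psi) g x.
Proof. by elim: n => // n IHn fg; apply: transfer_le; exact: IHn. Qed.

Lemma iter_transferD psi n f g x :
  iter n (transfer psi) (fun x => f x + g x) x =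
  iter n (transfer psi) f x + iter n (transfer psi) g x.
Proof.
elim: n x => // n IHn x.
by rewrite !iterS -transferD; congr transfer; apply/funext.
Qed.

Lemma iter_transferM psi n c g x :
  iter n (transfer psi) (fun x => c * g x) x = c * iter n (transfer psi) g x.
Proof.
elim: n x => // n IHn x.
by rewrite !iterS -transferM; congr transfer; apply/funext.
Qed.

Lemma iter_transfer_ge0 psi n g : (forall x, 0 <= g x) ->
  forall x, 0 <= iter n (transfer psi) g x.
Proof. by elim: n => // n IHn g0; apply: transfer_ge0; exact: IHn. Qed.

Lemma iter_transfer_ge psi n g x : (forall x, 0 <= g x) ->
  (forall i, (i < n)%N -> x i \in E) ->
  expR (birkhoff psi n x) * g x <= iter n (transfer psi) g (iter n T x).
Proof.
move=> g0; elim: n => [|n IHn] xE; first by rewrite birkhoff0 expR0 mul1r.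
rewrite birkhoffSr expRD [X in _ <= X]/= mulrAC [_ * expR (psi _)]mulrC.
have := transfer_ge psi (iter_transfer_ge0 psi n g0) (x := iter n T x).
rewrite iter_left_shiftE addn0 => /(_ (xE n (ltnSn n))); apply: le_trans.
by rewrite ler_wpM2l ?expR_ge0// IHn// => i ni; exact/xE/ltnW.
Qed.

(** The iterate sums over all [n]-step branches over [x] with letters in [E], and distinct [z i] are
    distinct branches. The induction groups them by the letter just before [x], which is the
    outermost application of [transfer]. *)
Lemma sum_le_iter_transfer psi n (I : finType) (P : pred I)
    (z : I -> mshift A) x :
  (forall i j, P i -> P j -> z i = z j -> i = j) ->
  (forall i, P i -> iter n T (z i) = x) ->
  (forall i k, P i -> (k < n)%N -> z i k \in E) ->
  \sum_(i | P i) expR (birkhoff psi n (z i)) <=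
  iter n (transfer psi) (fun=> 1) x.
Proof.
elim: n x P => [|n IHn] x P zinj zx zE.
  have [i Pi|P0] := pickP P; last by rewrite big_pred0//= ler01.
  rewrite (bigD1 i)//= birkhoff0 expR0 big_pred0 ?addr0// => j.
  apply/andP => -[Pj /eqP]; apply.
  by apply: zinj => //; rewrite [z j]zx// [z i]zx.
have zxn i : P i -> A (z i n) (x 0%N).
  by move=> Pi; rewrite -(zx i Pi) iter_left_shiftE addn0; exact: mshiftP.
have zn i : P i -> iter n T (z i) = scons (z i n) x.
  move=> Pi; have -> : z i n = iter n T (z i) 0%N.
    by rewrite iter_left_shiftE addn0.
  by rewrite -(zx i Pi) iterS scons_left_shift.
rewrite iterS {1}/transfer.
have -> : \sum_(i | P i) expR (birkhoff psi n.+1 (z i)) =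
    \sum_(s <- E | A s (x 0%N)) \sum_(i | P i && (z i n == s))
      expR (birkhoff psi n.+1 (z i)).
  rewrite (exchange_big_dep P)/=; last by move=> s i _ /andP[].
  apply: eq_bigr => i Pi; rewrite big_mkcond (big_fsetD1 (z i n)) ?zE//=.
  rewrite zxn// Pi eqxx/= big_seq big1 ?addr0// => s.
  by rewrite !inE => /andP[/negPf sz _]; rewrite eq_sym sz andbF.
apply: ler_sum => s sx.
have IH : \sum_(i | P i && (z i n == s)) expR (birkhoff psi n (z i)) <=
    iter n (transfer psi) (fun=> 1) (scons s x).
  apply: IHn.
  - by move=> i j /andP[Pi _] /andP[Pj _]; exact: zinj.
  - by move=> i /andP[Pi /eqP <-]; exact: zn.
  - by move=> i k /andP[Pi _] kn; rewrite zE// ltnW.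
apply: le_trans (ler_wpM2l (expR_ge0 _) IH); rewrite mulr_sumr.
apply: ler_sum => i /andP[Pi /eqP zs].
by rewrite birkhoffSr expRD mulrC zn// zs.
Qed.

End Transfer.

(** * Normalized transfer operators *)

(* [E] is the finite alphabet of the truncated transfer operator. The point is
   that none of the other parameters depends on [E]. *)
Record uniformly_mixing (R : realType) (S : countType) (A : transMatrix S)
    (phi : mshift A -> R) (F : seq S) (xr : S -> mshift A) (N : nat)
    (kap Q : R) (E : {fset S}) : Prop := UniformlyMixing {
  um_ref : forall b, b \in F -> xr b 0%N = b ;
  um_succ : forall x : mshift A, exists2 b, b \in F & A (x 0%N) b ;
  um_link : forall b x, b \in F -> exists z : mshift A,
    [/\ z 0%N = b, iter N (@left_shift S A) z = x,
        forall i, (i < N)%N -> z i \in E & kap <= expR (birkhoff phi N z)] ;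
  um_transfer1 : forall x, transfer E phi (fun=> 1) x <= Q
}.

Section Markov.
Variables (R : realType) (S : countType) (A : transMatrix S) (theta : R).
Hypothesis theta01 : 0 < theta < 1.
Variables (c : R) (phi : mshift A -> R).
Hypotheses (c_ge0 : 0 <= c) (phic : holder theta c phi).
Implicit Types (x y z : mshift A) (f g h u v : mshift A -> R).
Local Notation T := (@left_shift S A).
Local Notation B := (distortion theta c).

Let theta_gt0 : 0 < theta. Proof. by case/andP: theta01. Qed.
Let theta_lt1 : theta < 1. Proof. by case/andP: theta01. Qed.
Let B_ge0 : 0 <= B. Proof. exact: distortion_ge0. Qed.

Section Weights.
Variable E : {fset S}.
Local Notation L := (transfer E phi).

(** As [0 < r], both points have the same first letter, hence the same admissible predecessors, and
    the sums compare term by term. A step costs [c * theta ^+ r.+1] from the potential and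
    [B * theta ^+ r.+1] from the induction, together exactly [B * theta ^+ r]. *)
Lemma iter_transfer_dominated M r u v : (forall y, 0 <= u y) -> (0 < r)%N ->
  (forall y z, agree (r + M) y z -> v z <= expR (B * theta ^+ (r + M)) * u y) ->
  forall y z, agree r y z -> iter M L v z <= expR (B * theta ^+ r) * iter M L u y.
Proof.
move=> u0; elim: M r => [|M IHM] r r0 vu y z yz.
  by have := vu y z; rewrite addn0; exact.
rewrite !iterS /transfer -(yz 0%N r0) mulr_sumr; apply: ler_sum => s sy.
have sz : A s (z 0%N) by rewrite -(yz 0%N r0).
have syz := agree_scons sy sz yz.
have := IHM r.+1 isT _ _ _ syz; rewrite addSnnS => /(_ vu) le1.
rewrite (le_trans (ler_wpM2l (expR_ge0 _) le1))// !mulrA -!expRD.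
rewrite ler_wpM2r ?iter_transfer_ge0// ler_expR.
have := phic (ltn0Sn r) (agree_sym syz).
by have := distortion_step theta01 c r; lra.
Qed.

(** A partition function over [n]-step branches; it takes the place of an eigenfunction in the
    normalization. *)
Definition weight n := iter n L (fun=> 1).

Lemma weight_distortion n r y z : (0 < r)%N -> agree r y z ->
  weight n z <= expR (B * theta ^+ r) * weight n y.
Proof.
move=> r0; apply: iter_transfer_dominated => // *.
by rewrite mulr1 -expR0 ler_expR mulr_ge0// exprn_ge0// ltW.
Qed.

(** The weights vary with [n], so these operators form a time-inhomogeneous Markov chain:
    [markov_op n] chooses the letter to prepend when [n] more are still to come. *)
Definition markov_op n g x := L (fun y => g y * weight n y) x / weight n.+1 x.

Hypothesis pred_ex : forall x, exists2 s, s \in E & A s (x 0%N).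

Lemma weight_gt0 n x : 0 < weight n x.
Proof.
elim: n x => [x|n IHn x]; first exact: ltr01.
have [s sE sx] := pred_ex x.
have h0 y : 0 <= weight n y by exact: ltW.
have := @transfer_ge _ _ _ E phi _ (scons s x) h0; rewrite scons0// => /(_ sE).
by rewrite left_shift_scons//; apply: lt_le_trans; rewrite mulr_gt0 ?expR_gt0.
Qed.

Lemma markov_le n f g : (forall x, f x <= g x) ->
  forall x, markov_op n f x <= markov_op n g x.
Proof.
move=> fg x; rewrite ler_pM2r ?invr_gt0 ?weight_gt0//.
by apply: transfer_le => y; rewrite ler_pM2r ?weight_gt0.
Qed.

Lemma markov_cst n a x : markov_op n (fun=> a) x = a.
Proof.
rewrite /markov_op transferM -[X in _ * X / _]/(weight n.+1 x) mulfK//.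
by rewrite gt_eqF// weight_gt0. Qed.

Lemma markovD n f g x :
  markov_op n (fun y => f y + g y) x = markov_op n f x + markov_op n g x.
Proof.
rewrite /markov_op -mulrDl -transferD; congr (transfer _ _ _ _ / _).
by apply/funext => y; rewrite mulrDl.
Qed.

Lemma markovM n a g x : markov_op n (fun y => a * g y) x = a * markov_op n g x.
Proof.
rewrite /markov_op mulrA -transferM; congr (transfer _ _ _ _ / _).
by apply/funext => y; rewrite mulrA.
Qed.

Lemma markov_bound n g lo hi : (forall x, lo <= g x <= hi) ->
  forall x, lo <= markov_op n g x <= hi.
Proof.
move=> gb x; apply/andP; split.
  by rewrite -(markov_cst n lo x); apply: markov_le => y; case/andP: (gb y).
by rewrite -(markov_cst n hi x); apply: markov_le => y; case/andP: (gb y).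
Qed.

Lemma osc_markov n o g : osc o g -> osc o (markov_op n g).
Proof. by move=> [lo gb]; exists lo; exact: markov_bound. Qed.

(** Arises from [expR a - 1 <= a * expR a] at [a = 2 * B * theta ^+ r], after bounding [theta ^+ r]
    by 1 in the exponent. *)
Definition lasota_yorke_cst := 2 * B * expR (2 * B).
Local Notation K' := lasota_yorke_cst.

Lemma lasota_yorke_cst_ge0 : 0 <= K'.
Proof. by rewrite /lasota_yorke_cst mulr_ge0 ?expR_ge0 // mulr_ge0. Qed.

Lemma expRB1_le (a : R) : 0 <= a -> expR a - 1 <= a * expR a.
Proof.
move=> a0; rewrite -(ler_pM2r (expR_gt0 (- a))) mulrBl -mulrA mul1r.
by rewrite -expRD subrr expR0 mulr1; have := expR_ge1Dx (- a); lra.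
Qed.

(** The transition probabilities are those of [y], but [g] is read on the branches over [z]. The
    factor is two distortions, one for the numerators and one for the normalizing weights. *)
Lemma markov_distortion n g r y z : (0 < r)%N -> agree r y z ->
  (forall x, 0 <= g x) ->
  \sum_(s <- E | A s (y 0%N)) expR (phi (scons s y)) * weight n (scons s y) *
     g (scons s z) / weight n.+1 y <= expR (2 * B * theta ^+ r) * markov_op n g z.
Proof.
move=> r0 yz g0; rewrite -mulr_suml ler_pdivrMr ?weight_gt0//.
rewrite /markov_op /transfer -(yz 0%N r0).
set X := \sum_(s <- E | _) _; set Y := \sum_(s <- E | _) _.
have XY : X <= expR (B * theta ^+ r) * Y.
  rewrite mulr_sumr; apply: ler_sum => s sy.
  have sz : A s (z 0%N) by rewrite -(yz 0%N r0).
  have syz := agree_scons sy sz yz.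
  have := @weight_distortion n r.+1 _ _ isT (agree_sym syz).
  move/(ler_wpM2l (expR_ge0 (phi (scons s y)))) => le1.
  rewrite (le_trans (ler_wpM2r (g0 _) le1))//.
  rewrite [g _ * _]mulrC !mulrA ler_wpM2r// ler_wpM2r ?(ltW (weight_gt0 _ _))//.
  rewrite -!expRD ler_expR; have := phic (ltn0Sn r) syz.
  by have := distortion_step theta01 c r; lra.
have Y0 : 0 <= Y.
  apply: sumr_ge0 => s _.
  by rewrite !mulr_ge0 ?expR_ge0// ltW// weight_gt0.
have wzy := @weight_distortion n.+1 r y z r0 yz.
have q0 : 0 <= expR (B * theta ^+ r) * (Y / weight n.+1 z).
  by rewrite mulr_ge0 ?expR_ge0// divr_ge0// ltW// weight_gt0.
have -> : expR (2 * B * theta ^+ r) =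
    expR (B * theta ^+ r) * expR (B * theta ^+ r) by rewrite -expRD; congr expR; ring.
apply: le_trans XY _.
have -> : expR (B * theta ^+ r) * Y =
    expR (B * theta ^+ r) * (Y / weight n.+1 z) * weight n.+1 z.
  by rewrite -mulrA divfK// gt_eqF// weight_gt0.
by apply: le_trans (ler_wpM2l q0 wzy) _; rewrite le_eqVlt; apply/orP; left; apply/eqP; ring.
Qed.

(** A Lasota-Yorke inequality: the prepended letter contracts the Hölder constant by [theta], and
    the change of transition probabilities costs a multiple of the oscillation. *)
Lemma holder_markov n o l g : 0 <= l -> osc o g -> holder theta l g ->
  holder theta (theta * l + K' * o) (markov_op n g).
Proof.
move=> l0 [lo gb] gl r y z r0 yz.
(* Constants are fixed by the operator, so [g] may be shifted into [[0, o]]; the multiplicative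
   error of [markov_distortion] then costs a multiple of [o] instead of the size of [g]. *)
pose g' x := g x - lo.
have g'0 x : 0 <= g' x by rewrite /g'; have := gb x; lra.
have -> : markov_op n g y - markov_op n g z = markov_op n g' y - markov_op n g' z.
  by rewrite /g' !markovD !markov_cst; lra.
have [mz0 mzo] : 0 <= markov_op n g' z /\ markov_op n g' z <= o.
  apply/andP/(@markov_bound n g' 0 o) => x; rewrite g'0/= /g'.
  by have := gb x; lra.
have tr0 : 0 <= theta ^+ r by rewrite exprn_ge0 ?ltW.
have my : markov_op n g' y <= theta * l * theta ^+ r +
    expR (2 * B * theta ^+ r) * markov_op n g' z.
  rewrite (le_trans _ (lerD (lexx _) (markov_distortion n r0 yz g'0)))//.
  rewrite -(markov_cst n (theta * l * theta ^+ r) y) /markov_op /transfer.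
  rewrite -mulr_suml -mulrDl ler_pM2r ?invr_gt0 ?weight_gt0//.
  rewrite -big_split/=; apply: ler_sum => s sy.
  have sz : A s (z 0%N) by rewrite -(yz 0%N r0).
  have syz := agree_scons sy sz yz.
  rewrite -[X in _ + X]mulrA -mulrDr ler_wpM2l ?expR_ge0//.
  rewrite [X in _ + X]mulrC -mulrDl ler_wpM2r ?(ltW (weight_gt0 _ _))//.
  have := gl r.+1 _ _ isT syz; rewrite exprS [theta * l]mulrC -mulrA /g'.
  lra.
have e0 : 0 <= 2 * B * theta ^+ r by rewrite mulr_ge0 // mulr_ge0.
have := expRB1_le e0.
have : 2 * B * theta ^+ r * expR (2 * B * theta ^+ r) <= K' * theta ^+ r.
  rewrite /lasota_yorke_cst [leRHS]mulrAC ler_wpM2l//.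
  by rewrite ler_expR ler_piMr 1?mulr_ge0// exprn_ile1// ?ltW.
move=> e1 e2.
have : (expR (2 * B * theta ^+ r) - 1) * markov_op n g' z <= K' * theta ^+ r * o.
  apply: (le_trans (ler_wpM2r mz0 (le_trans e2 e1))).
  by rewrite ler_wpM2l// mulr_ge0// lasota_yorke_cst_ge0.
by move: my; rewrite !mulrDl mulrAC !mulN1r; lra.
Qed.

End Weights.
End Markov.

(** * Contraction *)

Section Contraction.
Variables (R : realType) (S : countType) (A : transMatrix S) (theta : R).
Hypothesis theta01 : 0 < theta < 1.
Variables (c : R) (phi : mshift A -> R).
Hypotheses (c_ge0 : 0 <= c) (phic : holder theta c phi).
Variables (F : seq S) (xr : S -> mshift A) (N : nat) (kap Q : R).
Hypotheses (N_gt0 : (0 < N)%N) (kap_gt0 : 0 < kap) (kap_le1 : kap <= 1).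
Hypotheses (Q_ge1 : 1 <= Q) (F_gt0 : (0 < size F)%N).
Implicit Types (x y z : mshift A) (f g h u v : mshift A -> R).
Local Notation T := (@left_shift S A).
Local Notation B := (distortion theta c).

Let theta_gt0 : 0 < theta. Proof. by case/andP: theta01. Qed.
Let theta_lt1 : theta < 1. Proof. by case/andP: theta01. Qed.
Let B_ge0 : 0 <= B. Proof. exact: distortion_ge0. Qed.

(** The factor [kap] is the weight of a linking word. One [expR (- B)] compares branches over the
    linking point and the reference point, the other comes from [weight_le_ref]. The denominator
    counts the reference points and bounds [N] applications of the operator. *)
Definition doeblin_cst := kap * expR (- B) * expR (- B) / ((size F)%:R * Q ^+ N).
Local Notation eta := doeblin_cst.

Lemma doeblin_cst_gt0 : 0 < eta.
Proof.
rewrite divr_gt0 ?mulr_gt0 ?expR_gt0// ?ltr0n ?F_gt0// exprn_gt0//.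
exact: lt_le_trans Q_ge1.
Qed.

Lemma doeblin_cst_le1 : eta <= 1.
Proof.
have F1 : 1 <= (size F)%:R :> R by rewrite ler1n F_gt0.
have QN1 : 1 <= Q ^+ N by rewrite exprn_ege1.
have e1 : expR (- B) <= 1 by rewrite -expR0 ler_expR oppr_le0.
have FQ := mulr_ege1 F1 QN1.
rewrite ler_pdivrMr ?mul1r; last exact: lt_le_trans FQ.
apply: le_trans FQ; rewrite mulr_ile1 ?mulr_ge0 ?expR_ge0 ?(ltW kap_gt0)//.
by rewrite mulr_ile1 ?expR_ge0 ?(ltW kap_gt0).
Qed.

Section Alphabet.
Variable E : {fset S}.
Hypothesis um : uniformly_mixing phi F xr N kap Q E.
Local Notation L := (transfer E phi).
Local Notation w := (weight phi E).
Local Notation K := (markov_op phi E).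

Lemma um_pred x : exists2 s, s \in E & A s (x 0%N).
Proof.
have [b bF _] := um_succ um x.
have [z [_ zx zE _]] := um_link um x bF.
exists (z N.-1); first by rewrite zE// ltn_predL.
by rewrite -zx iter_left_shiftE addn0 -{2}(prednK N_gt0) mshiftP.
Qed.

Let w_gt0 n x : 0 < w n x. Proof. exact/weight_gt0/um_pred. Qed.

Lemma weightD j n x : w (j + n) x = iter n L (w j) x.
Proof. by rewrite /weight addnC iterD. Qed.

Lemma iter_transfer_bound n C g : (forall x, g x <= C) -> 0 <= C ->
  forall x, iter n L g x <= C * Q ^+ n.
Proof.
move=> gC C0; elim: n => [|n IHn] x; first by rewrite expr0 mulr1.
rewrite iterS (le_trans (transfer_le _ _ IHn _))//.
rewrite -(mulr1 (C * Q ^+ n)) transferM exprSr mulrA ler_wpM2l ?(um_transfer1 um)//.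
by rewrite mulr_ge0// exprn_ge0// (le_trans _ Q_ge1).
Qed.

(** A letter that can precede [y] can also precede some reference point, by [um_succ], and the two
    terms agree up to distortion. One step is needed to choose that letter, hence [n.+1]. *)
Lemma weight_le_ref n y : w n.+1 y <= expR B * \sum_(b <- F) w n.+1 (xr b).
Proof.
have wxr : \sum_(b <- F) w n.+1 (xr b) = \sum_(s <- E) \sum_(b <- F | A s b)
    expR (phi (scons s (xr b))) * w n (scons s (xr b)).
  rewrite /weight /= -/(weight phi E n) /transfer.
  rewrite (exchange_big_dep predT)//=; apply: eq_bigr => s _.
  rewrite big_seq_cond [RHS]big_seq_cond; apply: eq_bigl => b.
  by case: (boolP (b \in F)) => //= bF; rewrite (um_ref um bF).
rewrite wxr mulr_sumr {1}/weight /= -/(weight phi E n) {1}/transfer.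
rewrite big_mkcond; apply: ler_sum => s _; rewrite fun_if.
have sum0 r (P : pred S) : 0 <= \sum_(b <- r | P b)
    expR (phi (scons s (xr b))) * w n (scons s (xr b)).
  by apply: sumr_ge0 => b _; rewrite mulr_ge0 ?expR_ge0// ltW.
case: ifPn => [sy|_]; last by rewrite mulr_ge0 ?expR_ge0.
have [b bF] := um_succ um (scons s y); rewrite scons0// => sb.
rewrite (big_rem _ bF)/= sb mulrDr -[leLHS]addr0.
apply: lerD; last by rewrite mulr_ge0 ?expR_ge0.
have sxb : A s (xr b 0%N) by rewrite (um_ref um bF).
have sy1 : agree 1 (scons s (xr b)) (scons s y) by case=> // _; rewrite !scons0.
have := weight_distortion theta01 c_ge0 phic E n (ltn0Sn 0) sy1.
move/(ler_wpM2l (expR_ge0 (phi (scons s y)))) => /le_trans; apply.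
rewrite !mulrA -!expRD ler_wpM2r ?(ltW (w_gt0 _ _))// ler_expR.
have := phic (ltn0Sn 0) (agree_sym sy1).
by have := distortion_step theta01 c 0; rewrite expr0 mulr1; lra.
Qed.

(** For [j = 0] and [g = 0], the expectation of the Birkhoff sum of [f] along a random [n]-step
    branch over [x], each branch [z] having probability proportional to [expR (birkhoff phi n z)].
    The index [j] says at which weight the chain starts, so that long drifts can be cut into
    blocks. *)
Fixpoint drift j f g n :=
  if n is n'.+1 then K (j + n') (fun x => f x + drift j f g n' x) else g.

Local Notation Kn j n g := (drift j (fun=> 0) g n).

(** In a product of normalized operators the intermediate weights cancel. *)
Lemma drift0E j n g x :
  Kn j n g x * w (j + n) x = iter n L (fun y => g y * w j y) x.
Proof.
elim: n x => [|n IHn] x; first by rewrite addn0.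
rewrite addnS /= /markov_op divfK ?gt_eqF ?w_gt0//.
by congr (transfer _ _ _ _); apply/funext => y; rewrite add0r IHn.
Qed.

Lemma drift_split j f g n x : drift j f g n x = Kn j n g x + drift j f (fun=> 0) n x.
Proof.
elim: n x => [|n IHn] x /=; first by rewrite addr0.
rewrite -markovD; congr markov_op; apply/funext => y.
by rewrite IHn; ring.
Qed.

Lemma drift_add j f g m n x :
  drift j f g (m + n) x = drift (j + m) f (drift j f g m) n x.
Proof.
elim: n x => [|n IHn] x /=; first by rewrite addn0.
rewrite addnS /= addnA; congr markov_op; apply/funext => y.
by rewrite IHn.
Qed.

(** * The Doeblin condition *)

Section Doeblin.
Variables (M j : nat).
Hypothesis M_gt0 : (0 < M)%N.
Let Z := \sum_(b <- F) w (j + M) (xr b).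
(** A probability average that does not see the point [x]: this is the common part of all the
    transition probabilities. *)
Let mean f := (\sum_(b <- F) iter M L (fun y => f y * w j y) (xr b)) / Z.

Let Z_gt0 : 0 < Z.
Proof.
have [b bF _] := um_succ um point.
rewrite /Z (big_rem _ bF)/= ltr_pwDl// sumr_ge0// => *; exact: ltW.
Qed.

(** Among the branches over [x], some pass through a linking word starting with [b]. Beyond that
    word they match the branches over [xr b], with comparable weights and with values of [f] at
    distance at most [l * theta ^+ M]. Summing over [b] and bounding the normalizing weight gives
    [eta]. *)
Lemma doeblin f l x : 0 <= l -> (forall y, 0 <= f y) -> holder theta l f ->
  eta * (mean f - l * theta ^+ M) <= Kn j (M + N) f x.
Proof.
move=> l0 f0 fl.
have K0 : 0 <= Kn j (M + N) f x.
  rewrite -(pmulr_lge0 _ (w_gt0 (j + (M + N)) x)) drift0E.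
  by apply: iter_transfer_ge0 => y; rewrite mulr_ge0// ltW.
have [neg|pos] := leP (mean f - l * theta ^+ M) 0.
  by rewrite (le_trans _ K0)// mulr_ge0_le0// ltW// doeblin_cst_gt0.
rewrite -(ler_pM2r (w_gt0 (j + (M + N)) x)) drift0E.
have -> : iter (M + N) L (fun y => f y * w j y) x =
    iter N L (iter M L (fun y => f y * w j y)) x by rewrite addnC iterD.
set num := iter N _ _ _.
pose v y := (f y - l * theta ^+ M) * w j y.
have num_ge b : b \in F -> kap * expR (- B) * iter M L v (xr b) <= num.
  move=> bF; have [z [z0 zx zE kz]] := um_link um x bF.
  have h0 y : 0 <= f y * w j y by rewrite mulr_ge0// ltW.
  have := iter_transfer_ge phi (iter_transfer_ge0 E phi M h0) zE.
  rewrite zx -/num; apply: le_trans.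
  have zb : agree 1 z (xr b) by case=> //= _; rewrite z0 (um_ref um bF).
  have := iter_transfer_dominated theta01 phic E (M := M) (v := v) h0 (ltn0Sn 0).
  move=> /(_ _ z (xr b) zb).
  rewrite expr1 => /(_ _)/wrap[y y' yy'|le1].
    apply: (@le_trans _ _ (f y * w j y')).
      rewrite ler_wpM2r ?(ltW (w_gt0 _ _))//.
      have M1 : (0 < 1 + M)%N by [].
      have := fl _ _ _ M1 (agree_sym yy').
      have : l * theta ^+ (1 + M) <= l * theta ^+ M.
        by rewrite ler_wpM2l// ler_wiXn2l ?ltW.
      lra.
    rewrite mulrCA ler_wpM2l//.
    exact: (weight_distortion theta01 c_ge0 phic E j _ yy').
  have B1 : expR (B * theta) <= expR B by rewrite ler_expR ler_piMr// ltW.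
  have M0 := iter_transfer_ge0 E phi M h0 z.
  apply: le_trans (ler_wpM2r M0 kz); rewrite -mulrA ler_pM2l// expRN.
  by rewrite ler_pdivrMl ?expR_gt0// (le_trans le1)// ler_wpM2r.
have sumv : \sum_(b <- F) iter M L v (xr b) = (mean f - l * theta ^+ M) * Z.
  rewrite mulrBl /mean divfK ?gt_eqF// /Z mulr_sumr -sumrB; apply: eq_bigr => b _.
  rewrite weightD -iter_transferM -mulN1r -iter_transferM.
  rewrite -iter_transferD; congr (iter _ _ _ _); apply/funext => y.
  by rewrite /v /weight; ring.
have num_ge_sum : kap * expR (- B) * ((mean f - l * theta ^+ M) * Z) <=
    (size F)%:R * num.
  rewrite -sumv mulr_sumr (_ : _ * num = \sum_(b <- F) num).
    by rewrite big_seq [leRHS]big_seq; exact: ler_sum.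
  by rewrite big_const_seq count_predT iter_addr_0 mulr_natl.
(* Positivity of [M] enters here: [weight_le_ref] requires at least one step. *)
have wZ : w (j + (M + N)) x <= expR B * Z * Q ^+ N.
  rewrite addnA weightD; apply: iter_transfer_bound.
    move=> y; rewrite /Z; case: (M) M_gt0 => // M' _; rewrite addnS.
    exact: weight_le_ref.
  by rewrite mulr_ge0 ?expR_ge0// ltW.
rewrite -(ler_pM2l (x := (size F)%:R)) ?ltr0n ?F_gt0//.
apply: le_trans num_ge_sum.
have pos' : 0 <= eta * (mean f - l * theta ^+ M).
  by rewrite mulr_ge0 ?(ltW doeblin_cst_gt0)// ltW.
have F0 : 0 <= (size F)%:R :> R by [].
apply: le_trans (ler_wpM2l F0 (ler_wpM2l pos' wZ)) _.
rewrite le_eqVlt; apply/orP; left; apply/eqP; rewrite /doeblin_cst expRN.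
field; rewrite !gt_eqF ?expR_gt0 ?ltr0n ?F_gt0 ?exprn_gt0//.
exact: lt_le_trans Q_ge1.
Qed.

Lemma meanC f a : mean (fun y => a - f y) = a - mean f.
Proof.
apply: (mulIf (lt0r_neq0 Z_gt0)); rewrite mulrBl /mean !divfK ?gt_eqF//.
rewrite /Z mulr_sumr -sumrB; apply: eq_bigr => b _.
rewrite weightD -iter_transferM -mulN1r -iter_transferM.
rewrite -iter_transferD; congr (iter _ _ _ _); apply/funext => y.
by rewrite /weight; ring.
Qed.

Lemma driftC f a n x : Kn j n (fun y => a - f y) x = a - Kn j n f x.
Proof.
apply: (mulIf (lt0r_neq0 (w_gt0 (j + n) x))); rewrite mulrBl !drift0E.
rewrite weightD -iter_transferM -mulN1r -iter_transferM.
rewrite -iter_transferD; congr (iter _ _ _ _); apply/funext => y.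
by rewrite /weight; ring.
Qed.

(** [doeblin] for [g - lo] gives a lower bound, and for its complement [o - (g - lo)] an upper
    bound. Since both involve the same [mean], the interval shrinks by [eta * o], up to two Hölder
    errors. *)
Lemma osc_contract o l g : 0 <= l -> osc o g -> holder theta l g ->
  osc ((1 - eta) * o + 2 * theta ^+ M * l) (Kn j (M + N) g).
Proof.
move=> l0 [lo gb] gl.
pose f y := g y - lo.
have fE y : g y = lo + f y by rewrite /f; ring.
have fo y : 0 <= f y <= o by have := gb y; rewrite /f; lra.
have fl : holder theta l f.
  by move=> r x y r0 xy; have := gl r x y r0 xy; rewrite /f; lra.
have fCl : holder theta l (fun y => o - f y).
  by move=> r x y r0 xy; have := gl r y x r0 (agree_sym xy); rewrite /f; lra.
have KgE x : Kn j (M + N) g x = lo + Kn j (M + N) f x.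
  apply: (mulIf (lt0r_neq0 (w_gt0 (j + (M + N)) x))); rewrite mulrDl !drift0E.
  rewrite weightD -iter_transferM.
  rewrite -iter_transferD; congr (iter _ _ _ _); apply/funext => y.
  by rewrite fE /weight mulrDl.
exists (lo + eta * (mean f - l * theta ^+ M)) => x.
rewrite KgE -addrA !lerD2l.
have := @doeblin f l x l0 (fun y => proj1 (andP (fo y))) fl.
have := @doeblin (fun y => o - f y) l x l0 _ fCl.
rewrite driftC meanC => /(_ _)/wrap[y|]; first by have := fo y; lra.
have : 0 <= (1 - eta) * (l * theta ^+ M).
  rewrite mulr_ge0 ?mulr_ge0 ?exprn_ge0 ?(ltW theta_gt0)// subr_ge0.
  exact: doeblin_cst_le1.
have := doeblin_cst_gt0.
nra.
Qed.

End Doeblin.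
Local Notation K' := (lasota_yorke_cst theta c).
Local Notation C2 := (K' / (1 - theta)).

Let K'_ge0 : 0 <= K'. Proof. exact: lasota_yorke_cst_ge0. Qed.
Let C2_ge0 : 0 <= C2.
Proof. by rewrite divr_ge0 ?lasota_yorke_cst_ge0// subr_ge0 ltW. Qed.

Lemma osc_drift0 j n o g : osc o g -> osc o (Kn j n g).
Proof.
move=> go; elim: n => //= n IHn; apply: (osc_markov phi um_pred).
by have [lo lob] := IHn; exists lo => x; rewrite add0r.
Qed.

(** [C2] is the fixed point of [C2 = theta * C2 + K'], and the oscillation does not grow along the
    iteration. *)
Lemma holder_drift0 j n o l g : 0 <= l -> osc o g -> holder theta l g ->
  holder theta (theta ^+ n * l + C2 * o) (Kn j n g).
Proof.
move=> l0 go gl; have o0 := osc_ge0 go; elim: n => [|n IHn] /=.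
  by apply: holder_le gl; rewrite // mul1r lerDl mulr_ge0.
have ln0 : 0 <= theta ^+ n * l + C2 * o.
  by apply: addr_ge0; rewrite mulr_ge0 ?exprn_ge0 ?(ltW theta_gt0).
have e : (fun x => 0 + Kn j n g x) = Kn j n g.
  by apply/funext => x; rewrite add0r.
have := holder_markov theta01 c_ge0 phic um_pred (j + n) ln0 (osc_drift0 j n go) IHn.
rewrite e; apply: holder_le => //; rewrite le_eqVlt; apply/orP; left; apply/eqP.
by rewrite exprS; field; rewrite subr_eq0 gt_eqF.
Qed.

(** A crude recursion from [holder_markov]; it serves only up to the length of one block, where any
    finite bound will do. *)
Fixpoint drift_holder_cst n :=
  if n is n'.+1 then theta * (1 + drift_holder_cst n') + K' * n%:R else 0.

Lemma drift_holder_cst_ge0 n : 0 <= drift_holder_cst n.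
Proof.
elim: n => //= n IHn.
by apply: addr_ge0; rewrite mulr_ge0 ?addr_ge0 ?(ltW theta_gt0).
Qed.

Lemma drift_growth j f nu n : 0 <= nu -> osc nu f -> holder theta nu f ->
  osc (n%:R * nu) (drift j f (fun=> 0) n) /\
  holder theta (drift_holder_cst n * nu) (drift j f (fun=> 0) n).
Proof.
move=> nu0 fnu fh; elim: n => [|n [IHo IHh]] /=.
  split; first by exists 0 => x; rewrite mul0r addr0 lexx.
  by move=> r x y r0 xy; rewrite !mul0r subrr.
have oD := oscD fnu IHo; have hD := holderD fh IHh.
have l0 : 0 <= nu + drift_holder_cst n * nu.
  by rewrite addr_ge0// mulr_ge0// drift_holder_cst_ge0.
split.
  apply: (osc_markov phi um_pred); apply: osc_le oD.
  by rewrite -[n.+1]add1n natrD mulrDl mul1r.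
have := holder_markov theta01 c_ge0 phic um_pred (j + n) l0 oD hD.
apply: holder_le => //; rewrite le_eqVlt; apply/orP; left; apply/eqP.
by rewrite -[n.+1]add1n natrD; ring.
Qed.

(** A Lyapunov functional. Neither component contracts by itself, as each bound involves the other;
    the weighted sum with [eps] small does. *)
Definition potential (eps v : R) g :=
  exists o l, [/\ 0 <= l, osc o g, holder theta l g & o + eps * l <= v].

Lemma potentialD (eps v v' : R) g g' : potential eps v g -> potential eps v' g' ->
  potential eps (v + v') (fun x => g x + g' x).
Proof.
move=> [ o [l [l0 go gl ol]]] [ o1 [l1 [l10 go1 gl1 ol1]]].
exists (o + o1), (l + l1); split; [exact: addr_ge0|exact: oscD|exact: holderD|].
by rewrite mulrDr; lra.
Qed.

(** The first smallness condition lets the gain [eta * o] pay for the oscillation term in the new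
    Hölder constant; the second, on [M], makes both contributions of the old Hölder constant at most
    half of [eps * l]. *)
Lemma potential_contract (eps v : R) M j g : (0 < M)%N -> 0 < eps ->
  eps * C2 <= eta / 2 -> (2 + eps) * theta ^+ M <= eps / 2 ->
  potential eps v g -> potential eps ((1 - eta / 2) * v) (Kn j (M + N) g).
Proof.
move=> M0 eps0 epsC epsM [ o [l [l0 go gl ol]]].
have o0 := osc_ge0 go; have e0 := doeblin_cst_gt0; have e1 := doeblin_cst_le1.
exists ((1 - eta) * o + 2 * theta ^+ M * l), (theta ^+ (M + N) * l + C2 * o).
split; [|exact: osc_contract|exact: holder_drift0|].
  by apply: addr_ge0; rewrite mulr_ge0 ?exprn_ge0 ?(ltW theta_gt0).
have tMN : theta ^+ (M + N) <= theta ^+ M.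
  by rewrite ler_wiXn2l ?ltW// leq_addr.
have h1 : eps * (theta ^+ (M + N) * l) <= eps * (theta ^+ M * l).
  by rewrite ler_wpM2l ?(ltW eps0)// ler_wpM2r.
have h2 : eps * C2 * o <= eta / 2 * o by rewrite ler_wpM2r.
have h3 : (2 + eps) * theta ^+ M * l <= eps / 2 * l by rewrite ler_wpM2r.
have h4 : (1 - eta / 2) * (o + eps * l) <= (1 - eta / 2) * v.
  by rewrite ler_wpM2l//; lra.
have h5 : 0 <= eps * l by rewrite mulr_ge0// ltW.
have h6 : eta * (eps * l) <= eps * l by rewrite ler_piMl.
by apply: le_trans h4; move: h1 h2 h3 h6; lra.
Qed.

End Alphabet.

(* The contraction of a block of [M + N] steps absorbs the bounded growth of
   the drift within one block, uniformly in the alphabet. *)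
Lemma drift_osc : exists2 G, 0 <= G & forall E,
  uniformly_mixing phi F xr N kap Q E -> forall f nu, 0 <= nu ->
  osc nu f -> holder theta nu f ->
  forall n, osc (G * nu) (drift E 0 f (fun=> 0) n).
Proof.
set eta := doeblin_cst; have e0 : 0 < eta by exact: doeblin_cst_gt0.
have e1 : eta <= 1 by exact: doeblin_cst_le1.
pose C2 := lasota_yorke_cst theta c / (1 - theta).
have C20 : 0 <= C2.
  by rewrite divr_ge0 ?lasota_yorke_cst_ge0// subr_ge0 ltW.
(* [eps] is fixed first and [M] afterwards; both depend only on [eta], [C2] and [theta], never on
   the alphabet. The summand 1 keeps the denominator positive. *)
pose eps := eta / (2 * (C2 + 1)).
have C21 : 0 < 2 * (C2 + 1) by lra.
have eps0 : 0 < eps by rewrite divr_gt0.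
have epsC : eps * C2 <= eta / 2.
  rewrite /eps -mulrA ler_wpM2l ?(ltW e0)// mulrC ler_pdivrMr//.
  by rewrite mulrA mulVf ?pnatr_eq0// mul1r lerDl ler01.
have [M M0 epsM] : exists2 M, (0 < M)%N & (2 + eps) * theta ^+ M <= eps / 2.
  have e2 : 0 < eps / 2 / (2 + eps) by apply: divr_gt0; [exact: divr_gt0|exact: addr_gt0].
  have [n _ ne] : \forall n \near \oo, theta ^+ n < eps / 2 / (2 + eps).
    apply: (cvgr_lt 0) => //.
    by apply: cvg_expr; rewrite ger0_norm// ltW.
  exists n.+1 => //; rewrite mulrC -ler_pdivlMr; last exact: addr_gt0.
  exact/ltW/ne/leqnSn.
pose Rn := (M + N)%N.
pose c0 := \sum_(i < Rn.+1) (i%:R + eps * drift_holder_cst i).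
have c0_ge i : (i <= Rn)%N -> i%:R + eps * drift_holder_cst i <= c0.
  move=> iR; have iR' : (i < Rn.+1)%N by [].
  rewrite /c0 (bigD1 (Ordinal iR'))//= lerDl sumr_ge0// => k _.
  by rewrite addr_ge0// mulr_ge0 ?drift_holder_cst_ge0// ltW.
have c00 : 0 <= c0 by have := c0_ge 0 isT; rewrite /= mulr0 addr0.
(* The fixed point of [v = (1 - eta / 2) * v + c0], where [c0] bounds the growth within one
   block. *)
exists (2 * c0 / eta); first by apply: divr_ge0; [rewrite mulr_ge0|exact: ltW].
move=> E um f nu nu0 fnu fh.
have pot0 j i : (i <= Rn)%N -> potential eps (c0 * nu) (drift E j f (fun=> 0) i).
  move=> iR; have [h1 h2] := drift_growth um j i nu0 fnu fh.
  exists (i%:R * nu), (drift_holder_cst i * nu); split => //.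
    by rewrite mulr_ge0// drift_holder_cst_ge0.
  by rewrite mulrA -mulrDl ler_wpM2r// c0_ge.
have pot n : potential eps (2 * c0 / eta * nu) (drift E 0 f (fun=> 0) n).
  elim/ltn_ind: n => n IHn.
  have [nR|Rn_n] := leqP n Rn.
    have [ o [l [l0 go gl ol]]] := pot0 0 n nR.
    exists o, l; split => //; apply: le_trans ol _; rewrite ler_wpM2r//.
    rewrite ler_pdivlMr//; apply: (@le_trans _ _ c0); first by rewrite ler_piMr.
    by rewrite mulr_natl mulr2n lerDl.
  have nE : n = (n - Rn + Rn)%N by rewrite subnK// ltnW.
  have R0 : (0 < Rn)%N by rewrite /Rn addn_gt0 M0.
  have /(potential_contract um (n - Rn) M0 eps0 epsC epsM) p1 :
      potential eps (2 * c0 / eta * nu) (drift E 0 f (fun=> 0) (n - Rn)).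
    by apply: IHn; rewrite -subn_gt0 subKn// ltnW.
  have := potentialD p1 (pot0 (n - Rn)%N Rn (leqnn _)).
  have -> : (1 - doeblin_cst / 2) * (2 * c0 / eta * nu) + c0 * nu =
      2 * c0 / eta * nu by rewrite /eta; field; rewrite gt_eqF.
  congr (potential _ _ _); apply/funext => x.
  by rewrite [in RHS]nE [RHS]drift_add [RHS]drift_split.
move=> n; have [ o [l [l0 go _ ol]]] := pot n; apply: osc_le go.
by apply: le_trans ol; rewrite lerDl mulr_ge0// ltW.
Qed.

End Contraction.

(** * Exponential moments *)

Section Moments.
Variables (R : realType) (S : countType) (A : transMatrix S).
Implicit Types (x y z : mshift A) (f g : mshift A -> R).

(** The linear term has coefficient 1, so it averages out for a centred variable. For [u] below 1/4
    the bound follows from [expR u <= 1 + u + u ^+ 2], itself a consequence of [1 - v <= expR (- v)]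
    at [v = u] or [v = u / 2]; from 1/4 on, [u <= 4 * u ^+ 2] suffices. *)
Lemma expR_le_quadratic (u : R) : expR u <= u + expR (4 * u ^+ 2).
Proof.
have e1 : 1 + 4 * u ^+ 2 <= expR (4 * u ^+ 2) by exact: expR_ge1Dx.
have u2 : 0 <= u ^+ 2 by exact: sqr_ge0.
have [u0|u0] := leP u 0.
  have e2 : expR u * (1 - u) <= 1.
    rewrite -[leRHS](mulVf (lt0r_neq0 (expR_gt0 (- u)))) expRN invrK.
    by rewrite ler_wpM2l ?expR_ge0// -expRN expR_ge1Dx.
  suff : expR u <= 1 + u + u ^+ 2 by lra.
  have u1 : 0 < 1 - u by lra.
  rewrite -(ler_pM2r u1); apply: le_trans e2 _.
  have : 0 <= - u * u ^+ 2 by rewrite mulr_ge0// oppr_ge0.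
  rewrite (_ : (1 + u + u ^+ 2) * (1 - u) = 1 + - u * u ^+ 2); last by ring.
  lra.
have [u4|u4] := leP (1 / 4) u.
  apply: (@le_trans _ _ (expR (4 * u ^+ 2))); last by rewrite lerDr ltW.
  by rewrite ler_expR; nra.
have e2 : expR (u / 2) * (1 - u / 2) <= 1.
  rewrite -[leRHS](mulVf (lt0r_neq0 (expR_gt0 (- (u / 2))))) expRN invrK.
  by rewrite ler_wpM2l ?expR_ge0// -expRN expR_ge1Dx.
have e3 : expR u = expR (u / 2) ^+ 2 by rewrite expr2 -expRD; congr expR; field.
suff : expR u <= 1 + u + u ^+ 2 by lra.
have u1 : 0 < (1 - u / 2) ^+ 2 by rewrite exprn_gt0//; lra.
rewrite -(ler_pM2r u1) e3 -exprMn.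
apply: (@le_trans _ _ 1).
  by rewrite exprn_ile1// mulr_ge0 ?expR_ge0//; lra.
have -> : (1 + u + u ^+ 2) * (1 - u / 2) ^+ 2 =
    1 + u ^+ 2 / 4 * (1 - 3 * u + u ^+ 2) by field.
by rewrite lerDl mulr_ge0//; lra.
Qed.

Variables (phi : mshift A -> R) (E : {fset S}).
Hypothesis pred_ex : forall x, exists2 s, s \in E & A s (x 0%N).
Local Notation w := (weight phi E).
Local Notation K := (markov_op phi E).

(** Both [g] and its mean lie in an interval of length [G]. The pointwise bound is applied to
    [t * (g y - mu)], whose average under the operator is zero. *)
Lemma hoeffding_markov n G g t x : osc G g ->
  K n (fun y => expR (t * g y)) x <= expR (t * K n g x + 4 * (t * G) ^+ 2).
Proof.
move=> [lo gb]; set mu := K n g x.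
have mub : lo <= mu <= lo + G by exact: markov_bound.
have gmu y : expR (t * g y) <=
    expR (t * mu) * (t * g y + (- (t * mu) + expR (4 * (t * G) ^+ 2))).
  have -> : t * g y = t * mu + t * (g y - mu) by ring.
  rewrite expRD ler_wpM2l ?expR_ge0//.
  have := expR_le_quadratic (t * (g y - mu)).
  suff : expR (4 * (t * (g y - mu)) ^+ 2) <= expR (4 * (t * G) ^+ 2) by lra.
  rewrite ler_expR ler_pM2l// !exprMn ler_wpM2l ?sqr_ge0//.
  by rewrite -subr_ge0 subr_sqr mulr_ge0//; have := gb y; move: mub; lra.
pose h y := expR (t * mu) * (t * g y + (- (t * mu) + expR (4 * (t * G) ^+ 2))).
apply: (@le_trans _ _ (K n h x)); first exact: markov_le.
rewrite /h.
rewrite markovM markovD markovM (markov_cst phi pred_ex) -/mu addrA subrr add0r.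
by rewrite -expRD.
Qed.

(** The increment revealed by one step is [f] plus the drift of the remaining steps, with
    conditional mean the next drift. Each step therefore costs one Hoeffding term. *)
Lemma iter_transfer_moment f G t : 
  (forall n, osc G (fun x => f x + drift phi E 0 f (fun=> 0) n x)) ->
  forall n x, iter n (transfer E (fun x => phi x + t * f x)) (fun=> 1) x <=
    w n x * expR (t * drift phi E 0 f (fun=> 0) n x + n%:R * (4 * (t * G) ^+ 2)).
Proof.
move=> fG; elim=> [|n IHn] x.
  by rewrite /= mulr0 mul0r addr0 expR0 mulr1.
set a := 4 * (t * G) ^+ 2 in IHn *.
rewrite iterS (le_trans (transfer_le _ _ IHn x))//.
pose U := drift phi E 0 f (fun=> 0) n.
have -> : transfer E (fun y => phi y + t * f y)
    (fun y => w n y * expR (t * drift phi E 0 f (fun=> 0) n y + n%:R * a)) x =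
    expR (n%:R * a) * (w n.+1 x * K n (fun y => expR (t * (f y + U y))) x).
  rewrite /markov_op [w n.+1 x * _]mulrC divfK; last by rewrite gt_eqF// weight_gt0.
  rewrite mulr_sumr; apply: eq_bigr => s _; rewrite !expRD mulrDr expRD.
  by rewrite /U; ring.
have := hoeffding_markov n t x (fG n); rewrite -/U -/a => le1.
rewrite [leLHS]mulrCA; apply: ler_wpM2l; first by rewrite ltW// weight_gt0.
apply: le_trans (ler_wpM2l (expR_ge0 _) le1) _.
rewrite -expRD ler_expR /= add0n -[n.+1]add1n natrD mulrDl.
by rewrite -/U; lra.
Qed.

End Moments.

(** * Probabilities of sets *)

Section RealProbability.
Variables (R : realType) (d : measure_display) (Y : measurableType d).
Variable mu : probability Y R.
Implicit Types U V : set Y.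

Definition pr U : R := fine (mu U).

Lemma prE U : measurable U -> mu U = (pr U)%:E.
Proof. by move=> mU; rewrite /pr fineK// fin_num_measure. Qed.

Lemma pr_ge0 U : 0 <= pr U.
Proof. by rewrite /pr fine_ge0. Qed.

Lemma pr_set0 : pr set0 = 0.
Proof. by rewrite /pr measure0. Qed.

Lemma pr_setT : pr setT = 1.
Proof. by rewrite /pr probability_setT. Qed.

Lemma pr_le U V : measurable U -> measurable V -> U `<=` V -> pr U <= pr V.
Proof.
move=> mU mV UV; rewrite -lee_fin -!prE//.
by apply: le_measure => //; rewrite inE.
Qed.

Lemma prU U V : measurable U -> measurable V -> U `&` V = set0 ->
  pr (U `|` V) = pr U + pr V.
Proof.
move=> mU mV UV; apply: EFin_inj; rewrite EFinD -!prE//; last exact: measurableU.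
exact: measureU.
Qed.

Lemma prC U : measurable U -> pr (~` U) = 1 - pr U.
Proof.
move=> mU; rewrite -pr_setT -(setvU U) prU ?setICl ?addrK//.
exact: measurableC.
Qed.

Lemma prU_le U V : measurable U -> measurable V ->
  pr (U `|` V) <= pr U + pr V.
Proof.
move=> mU mV; have mVU : measurable (V `\` U) by exact: measurableD.
have -> : U `|` V = U `|` (V `\` U).
  apply/seteqP; split=> x [Ux|]; [by left| |by left|by case; right].
  by have [Ux|nUx] := pselect (U x) => Vx; [left|right].
rewrite prU//; last by rewrite setDE setIC -setIA setICl setI0.
by rewrite lerD2l pr_le// => x [].
Qed.

Section FiniteSums.
Variables (I : eqType) (P : pred I) (B : I -> set Y).
Hypothesis mB : forall i, P i -> measurable (B i).
Hypothesis disjB : forall i j x, P i -> P j -> B i x -> B j x -> i = j.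

Lemma bigU_measurable (r : seq I) : measurable (\big[setU/set0]_(i <- r | P i) B i).
Proof.
elim: r => [|i r IHr]; first by rewrite big_nil; exact: measurable0.
by rewrite big_cons; case: ifP => // Pi; apply: measurableU => //; exact: mB.
Qed.

Lemma bigUP (r : seq I) x : (\big[setU/set0]_(i <- r | P i) B i) x <->
  exists i, [/\ i \in r, P i & B i x].
Proof.
elim: r => [|i r IHr].
  by rewrite big_nil; split=> // -[i []].
rewrite big_cons; split.
  case: ifPn => [Pi [Bx|/IHr[j [jr Pj Bj]]]|Pi /IHr[j [jr Pj Bj]]].
  - by exists i; rewrite mem_head.
  - by exists j; rewrite inE jr orbT.
  - by exists j; rewrite inE jr orbT.
case=> j [+ Pj Bj]; rewrite inE => /predU1P[<-|jr]; first by rewrite Pj; left.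
by case: ifP => _; [right|]; apply/IHr; exists j.
Qed.

Lemma sum_pr (r : seq I) : uniq r ->
  \sum_(i <- r | P i) pr (B i) = pr (\big[setU/set0]_(i <- r | P i) B i).
Proof.
elim: r => [|i r IHr] /=; first by rewrite !big_nil pr_set0.
move=> /andP[ir ur]; rewrite !big_cons; case: ifP => Pi; last exact: IHr.
rewrite prU ?IHr//; [exact: mB|exact: bigU_measurable|].
apply/seteqP; split=> // x [Bx /bigUP[j [jr Pj Bj]]].
by move: ir; rewrite (disjB Pi Pj Bx Bj) jr.
Qed.

Lemma sum_pr_le (r : seq I) U : uniq r -> measurable U ->
  (forall i, i \in r -> P i -> B i `<=` U) ->
  \sum_(i <- r | P i) pr (B i) <= pr U.
Proof.
move=> ur mU BU; rewrite sum_pr//; apply: pr_le => //.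
  exact: bigU_measurable.
by move=> x /bigUP[i [ir Pi Bi]]; exact: (BU i).
Qed.

Lemma sum_pr_ge (r : seq I) U : uniq r -> measurable U ->
  (forall x, U x -> exists i, [/\ i \in r, P i & B i x]) ->
  pr U <= \sum_(i <- r | P i) pr (B i).
Proof.
move=> ur mU UB; rewrite sum_pr//; apply: pr_le => //.
  exact: bigU_measurable.
by move=> x /UB ?; exact/bigUP.
Qed.

End FiniteSums.

Lemma cvg_pr_nonincreasing (U : (set Y)^nat) : (forall i, measurable (U i)) ->
  (forall i, U i.+1 `<=` U i) -> (forall x, exists i, ~ U i x) ->
  forall e, 0 < e -> exists n, pr (U n) < e.
Proof.
move=> mU dU capU e e0.
have U0 : \bigcap_n U n = set0.
  by apply/seteqP; split=> // x Ux; have [i] := capU x; apply; exact: Ux.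
have := @nonincreasing_cvg_mu _ _ _ mu U.
rewrite U0 measure0.
have U0fin : (mu (U 0%N) < +oo)%E by rewrite prE// ltry.
have ndU : nonincreasing_seq U.
  by apply/nonincreasing_seqP => n; exact/subsetPset.
move=> /(_ U0fin mU measurable0 ndU) cvgU.
have /fine_cvgP[_ /cvgr_lt/(_ e e0)[n _ ne]] := cvgU.
by exists n; exact: (ne n (leqnn n)).
Qed.

Lemma pr_le_nondecreasing (U : (set Y)^nat) V a : (forall i, measurable (U i)) ->
  measurable V -> (forall i, U i `<=` U i.+1) ->
  (forall x, V x -> exists i, U i x) -> (forall i, pr (V `&` U i) <= a) ->
  pr V <= a.
Proof.
move=> mU mV ndU VU Ua; rewrite leNgt; apply/negP => aV.
have mVU i : measurable (V `\` U i) by exact: measurableD.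
have ndVU i : V `\` U i.+1 `<=` V `\` U i.
  by move=> x [Vx nUx]; split=> // /ndU.
have capVU x : exists i, ~ (V `\` U i) x.
  have [Vx|nVx] := pselect (V x); last by exists 0%N => -[].
  by have [i Ui] := VU x Vx; exists i => -[].
have aV' : 0 < pr V - a by rewrite subr_gt0.
have [n] := cvg_pr_nonincreasing mVU ndVU capVU aV'.
have : pr V <= pr ((V `&` U n) `|` (V `\` U n)).
  apply: pr_le => //; first by apply: measurableU; [exact: measurableI|exact: measurableD].
  by move=> x Vx; have [Ux|nUx] := pselect (U n x); [left|right].
have /prU_le/(_ (measurableD mV (mU n))) : measurable (V `&` U n).
  exact: measurableI.
by have := Ua n; lra.
Qed.

End RealProbability.

(** * Gibbs measures *)

Section ShiftMeasure.
Variables (R : realType) (S : countType) (A : transMatrix S).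
Implicit Types (x y z : mshift A) (U V : set (mshift A)).
Local Notation T := (@left_shift S A).

Definition determined n U := forall x y, agree n x y -> U x -> U y.

Lemma determinedC n U : determined n U -> determined n (~` U).
Proof. by move=> dU x y xy nUx /(dU _ _ (agree_sym xy)). Qed.

Lemma determinedI n U V : determined n U -> determined n V ->
  determined n (U `&` V).
Proof. by move=> dU dV x y xy [Ux Vx]; split; [exact: dU Ux|exact: dV Vx]. Qed.

Lemma determinedU n U V : determined n U -> determined n V ->
  determined n (U `|` V).
Proof.
by move=> dU dV x y xy [Ux|Vx]; [left; exact: dU Ux|right; exact: dV Vx].
Qed.

Lemma determined_le n k U : (n <= k)%N -> determined n U -> determined k U.
Proof. by move=> nk dU x y /(agree_le nk); exact: dU. Qed.

Lemma open_mshift U :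
  (forall x, U x -> exists n, forall y, agree n x y -> U y) <-> open U.
Proof.
rewrite openE; split=> [UP x Ux|oU x Ux].
  have [n nU] := UP x Ux; apply/nbhs_mshiftP; exists n => y xy.
  by apply: nU => i /ltnW; exact: xy.
have /nbhs_mshiftP[n nU] := oU x Ux.
by exists n.+1 => y xy; apply: nU => i; rewrite -ltnS; exact: xy.
Qed.

Lemma measurable_open U : open U -> measurable U.
Proof. by move=> oU; exact: (@sub_sigma_algebra (mshift A) setT (@open (mshift A)) U oU). Qed.

Lemma measurable_determined n U : determined n U -> measurable U.
Proof.
move=> dU; apply: measurable_open; apply/open_mshift => x Ux.
by exists n => y xy; exact: dU Ux.
Qed.

Lemma measurable_left_shift : measurable_fun [set: mshift A] T.
Proof.
apply: (@measurability _ _ _ _ _ _ (@open (mshift A))) => //.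
move=> _ [U oU <-]; rewrite setTI; apply: measurable_open; apply/open_mshift => x Ux.
have [n nU] := iffRL (open_mshift U) oU _ Ux.
by exists n.+1 => y xy; apply: nU; exact: (@agree_iter_left_shift _ _ 1).
Qed.

Lemma measurable_iter_left_shift n : measurable_fun [set: mshift A] (iter n T).
Proof.
elim: n => [|n IHn]; first exact: measurable_id.
exact: measurableT_comp measurable_left_shift IHn.
Qed.

Lemma measurable_preimage_iter n U : measurable U -> measurable (iter n T @^-1` U).
Proof.
by move=> mU; rewrite -[X in measurable X]setTI; exact: measurable_iter_left_shift.
Qed.

Definition cyl n x : set (mshift A) := [set y | agree n x y].

Lemma cyl_determined n x : determined n (cyl n x).
Proof. by move=> y z yz xy; exact: agree_trans xy yz. Qed.

Lemma measurable_cyl n x : measurable (cyl n x).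
Proof. exact: measurable_determined (@cyl_determined n x). Qed.

Lemma cylinderE n x : cylinder A [tuple x i | i < n] = cyl n x.
Proof.
apply/seteqP; split=> y xy i => [ni|].
  by have := xy (Ordinal ni); rewrite tnth_mktuple.
by rewrite tnth_mktuple xy.
Qed.

Lemma continuous_measurable (f : mshift A -> R) :
  continuous f -> measurable_fun [set: mshift A] f.
Proof.
move=> /continuousP cf.
apply: (measurability _ (measurable_realfun.RGenOpens.measurableE R)).
move=> _ [_ [a [b ->] <-]]; rewrite setTI; apply: measurable_open.
exact/cf/interval_open.
Qed.

Lemma holder_continuous theta c (f : mshift A -> R) : 0 < theta < 1 ->
  0 <= c -> holder theta c f -> continuous f.
Proof.
move=> /andP[t0 t1] c0 fc x.
have FF : Filter (nbhs x) by exact: nbhs_filter.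
apply/(cvgrPdist_le (F := nbhs x)) => e e0.
have [n _ ne] : \forall n \near \oo, theta ^+ n < e / (c + 1).
  apply: (cvgr_lt 0); last by rewrite divr_gt0// ltr_wpDl.
  by apply: cvg_expr; rewrite ger0_norm// ltW.
apply/nbhs_mshiftP; exists n => y xy.
have xyn : agree n.+1 x y by move=> i; rewrite ltnS; exact: xy.
have te : c * theta ^+ n.+1 <= e.
  have := ltW (ne n.+1 (leqnSn n)); rewrite ler_pdivlMr ?ltr_wpDl// => le1.
  apply: le_trans le1; rewrite mulrC ler_wpM2l ?exprn_ge0 ?(ltW t0)//.
  by rewrite lerDl.
rewrite ler_norml; apply/andP; split.
  by rewrite lerNl opprB; apply: le_trans te; exact: (fc _ _ _ _ (agree_sym xyn)).
by apply: le_trans te; exact: fc.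
Qed.

Variable m : probability (mshift A) R.

Definition mass n x := pr m (cyl n x).

Lemma mass0 x : mass 0 x = 1.
Proof. by rewrite /mass -(pr_setT m); congr pr; apply/seteqP; split. Qed.

Lemma mass_ge0 n x : 0 <= mass n x.
Proof. exact: pr_ge0. Qed.

Section Invariance.
Hypothesis inv : invariant_measure T m.

Lemma pr_preimage_iter n U : measurable U -> pr m (iter n T @^-1` U) = pr m U.
Proof.
move=> mU; elim: n => // n IHn.
have -> : iter n.+1 T @^-1` U = T @^-1` (iter n T @^-1` U).
  by apply/seteqP; split=> x /=; rewrite -iterS iterSr.
rewrite -IHn /pr; congr fine; apply: inv.
exact: measurable_preimage_iter.
Qed.

(** The cylinders obtained by prepending a letter are disjoint and contained in the preimage of the
    cylinder of [y], which has the same mass. *)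
Lemma sum_mass_scons_le (E : {fset S}) n y :
  \sum_(s <- E | A s (y 0%N)) mass n.+1 (scons s y) <= mass n y.
Proof.
have mT := measurable_preimage_iter 1 (measurable_cyl n y).
rewrite -[leRHS]/(pr m (cyl n y)) -(pr_preimage_iter 1 (measurable_cyl n y)).
apply: sum_pr_le => //.
- by move=> i _; exact: measurable_cyl.
- move=> i j x iy jy /(_ 0%N isT) + /(_ 0%N isT).
  by rewrite !scons0// => -> ->.
- move=> s _ sy x xs i ni; rewrite /= left_shiftE -xs// sconsS//.
Qed.

End Invariance.

Definition gibbs_cst (phi : mshift A -> R) C P :=
  [/\ invariant_measure T m, 0 < C &
  forall n x, C^-1 <= mass n.+1 x / expR (birkhoff phi n.+1 x - n.+1%:R * P) <= C].

Lemma gibbsP phi : gibbs phi m <-> exists C P, gibbs_cst phi C P.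
Proof.
split=> [[inv [C [P [C0 mC]]]]|[C [P [inv C0 mC]]]].
  exists C, P; split=> // n x; rewrite /mass /pr -cylinderE; apply: mC.
  by rewrite cylinderE.
split=> //; exists C, P; split=> // n a x ax.
have -> : cylinder A a = cyl n.+1 x.
  rewrite -cylinderE; congr cylinder; apply: eq_from_tnth => i.
  by rewrite tnth_mktuple ax.
exact: mC.
Qed.

Section GibbsBounds.
Variables (phi : mshift A -> R) (C P : R).
Hypothesis mG : gibbs_cst phi C P.

Lemma gibbs_inv : invariant_measure T m. Proof. by case: mG. Qed.

Lemma gibbs_C_gt0 : 0 < C. Proof. by case: mG. Qed.

Lemma gibbs_C_ge1 : 1 <= C.
Proof.
have [_ C0 /(_ 0%N point) /andP[h1 h2]] := mG.
rewrite -(ler_pM2l C0) mulr1 -[C * C]/(C * C).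
rewrite leNgt; apply/negP => CC.
have : C^-1 <= C by exact: le_trans h1 h2.
by rewrite -(ler_pM2l C0) divff ?gt_eqF//; nra.
Qed.

(** Length zero, which the Gibbs property leaves out, is covered because [1 <= C]. *)
Lemma mass_le n x : mass n x <= C * expR (birkhoff phi n x - n%:R * P).
Proof.
have C0 := gibbs_C_gt0; have C1 := gibbs_C_ge1.
case: n => [|n]; first by rewrite mass0 birkhoff0 mul0r subr0 expR0 mulr1.
have [_ _ /(_ n x) /andP[_]] := mG.
by rewrite ler_pdivrMr ?expR_gt0.
Qed.

Lemma mass_ge n x : expR (birkhoff phi n x - n%:R * P) <= C * mass n x.
Proof.
have C0 := gibbs_C_gt0; have C1 := gibbs_C_ge1.
case: n => [|n]; first by rewrite mass0 birkhoff0 mul0r subr0 expR0 mulr1.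
have [_ _ /(_ n x) /andP[+ _]] := mG.
by rewrite ler_pdivlMr ?expR_gt0// ler_pdivrMl.
Qed.

Lemma mass_gt0 n x : 0 < mass n x.
Proof.
rewrite -(pmulr_rgt0 _ gibbs_C_gt0); apply: lt_le_trans (mass_ge n x).
exact: expR_gt0.
Qed.

Lemma mass_submul k n x : mass (k + n) x <= C ^+ 3 * (mass k x * mass n (iter k T x)).
Proof.
apply: le_trans (mass_le _ _) _.
rewrite birkhoff_add natrD mulrDl opprD addrACA expRD.
rewrite (_ : C ^+ 3 * _ = C * ((C * mass k x) * (C * mass n (iter k T x)))); last by ring.
rewrite ler_wpM2l ?(ltW gibbs_C_gt0)//.
by rewrite ler_pM ?expR_ge0 ?mass_ge.
Qed.

(** The function 1 is dominated by [C * expR (n%:R * P)] times the ratio of cylinder mass to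
    [expR (birkhoff phi n z)]. Applying the operator to that ratio cancels one factor of the
    potential and, by [sum_mass_scons_le], gives at most the ratio for one letter fewer, down to
    1. *)
Lemma weight_le_gibbs (E : {fset S}) n x :
  weight phi E n x <= C * expR (n%:R * P).
Proof.
have C0 := gibbs_C_gt0.
have sum_le1 k y :
    iter k (transfer E phi) (fun z => expR (- birkhoff phi k z) * mass k z) y <= 1.
  elim: k y => [|k IHk] y; first by rewrite /= mass0 birkhoff0 oppr0 expR0 mulr1.
  rewrite iterSr; apply: le_trans (IHk y); apply: iter_transfer_le => z.
  rewrite /transfer; apply: le_trans (ler_wpM2l (expR_ge0 _) (sum_mass_scons_le gibbs_inv E k z)).
  rewrite mulr_sumr; apply: ler_sum => s sz.
  rewrite mulrA -expRD birkhoffSl left_shift_scons// opprD addrA subrr add0r.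
  by rewrite lexx.
apply: (@le_trans _ _ (iter n (transfer E phi) (fun z => C * expR (n%:R * P) *
    (expR (- birkhoff phi n z) * mass n z)) x)).
  apply: iter_transfer_le => z.
  have := mass_ge n z; rewrite expRD expRN => /(ler_wpM2l (expR_ge0 (n%:R * P))).
  move/(ler_wpM2r (expR_ge0 (- birkhoff phi n z))).
  rewrite expRN; have := expR_gt0 (n%:R * P); have := expR_gt0 (birkhoff phi n z).
  move=> p1 p2; rewrite (_ : _ * _ / _ = 1); last by field; rewrite !gt_eqF.
  by move/le_trans; apply; rewrite le_eqVlt; apply/orP; left; apply/eqP; ring.
rewrite iter_transferM -[leRHS]mulr1 ler_wpM2l// mulr_ge0 ?expR_ge0// ltW//.
Qed.

End GibbsBounds.
End ShiftMeasure.

(** * Big images and preimages *)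

Section BigImages.
Variables (R : realType) (S : countType) (A : transMatrix S).
Variables (theta : R) (phi : mshift A -> R) (m : probability (mshift A) R).
Variables (C P : R).
Hypothesis mG : gibbs_cst m phi C P.
Implicit Types (x y z : mshift A) (U V W : set (mshift A)).
Local Notation T := (@left_shift S A).

Let first_below k : set (mshift A) := [set x : mshift A | (choice.pickle (x 0%N) < k)%N].

Let first_below_determined k : determined 1 (first_below k).
Proof. by move=> x y xy; rewrite /first_below /= -xy. Qed.

(* Applied to sets of the form [Phi U = W `&` tau @^-1` U]. *)
Lemma pr_first_letter (Phi : set (mshift A) -> set (mshift A)) c D :
  0 <= c -> determined 1 D ->
  (forall U, determined 1 U -> measurable (Phi U)) ->
  (forall U V, Phi (U `|` V) = Phi U `|` Phi V) ->
  (forall U V, Phi (U `&` V) = Phi U `&` Phi V) ->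
  Phi set0 = set0 -> (forall x, exists k, forall U, Phi U x -> Phi (first_below k) x) ->
  (forall z, pr m (Phi (cyl 1 z)) <= c * pr m (cyl 1 z)) ->
  pr m (Phi D) <= c * pr m D.
Proof.
move=> c0 dD mPhi PhiU PhiI Phi0 Phik Phic.
have dDk k : determined 1 (D `&` first_below k) by exact: determinedI.
have finite_case k : pr m (Phi (D `&` first_below k)) <=
    c * pr m (D `&` first_below k).
  elim: k => [|k IHk].
    have -> : D `&` first_below 0 = set0 by apply/seteqP; split=> // x [].
    by rewrite Phi0 !pr_set0 mulr0.
  have [[z [Dz zk]]|noz] := pselect (exists z, D z /\ choice.pickle (z 0%N) = k).
    have eqU : D `&` first_below k.+1 = (D `&` first_below k) `|` cyl 1 z.
      apply/seteqP; split=> x.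
        move=> [Dx]; rewrite /first_below /= ltnS leq_eqVlt => /orP[/eqP xk|xk].
          right=> -[|//] _; apply: (pcan_inj choice.pickleK).
          by rewrite xk zk.
        by left.
      move=> [[Dx]|zx]; first by split=> //; exact: ltnW.
      split; first exact: dD Dz.
      by rewrite /first_below /= -zx// zk.
    have disj : (D `&` first_below k) `&` cyl 1 z = set0.
      apply/seteqP; split=> // x [[Dx xk] zx].
      by move: xk; rewrite /first_below /= -zx// zk ltnn.
    have mD := measurable_determined (dDk k).
    have := prU m mD (measurable_cyl 1 z) disj; rewrite -eqU => ->.
    rewrite eqU PhiU.
    have mPz := mPhi _ (@cyl_determined _ _ 1 z).
    have mPD := mPhi _ (dDk k).
    apply: le_trans (prU_le _ mPD mPz) _.
    by rewrite mulrDr lerD.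
  have <- // : D `&` first_below k = D `&` first_below k.+1.
  apply/seteqP; split=> x [Dx xk]; split=> //; first exact: ltnW.
  move: xk; rewrite /first_below /= ltnS leq_eqVlt => /orP[/eqP xk|//].
  by exfalso; apply: noz; exists x.
apply: (@pr_le_nondecreasing _ _ _ m (fun k => Phi (first_below k))) => //.
- by move=> k; exact: mPhi.
- exact: mPhi.
- move=> k; have -> : first_below k.+1 = first_below k.+1 `|` first_below k.
    by apply/seteqP; split=> x; [left|case=> //; exact: ltnW].
  by rewrite PhiU => x; right.
- by move=> x PhiDx; have [k /(_ _ PhiDx)] := Phik x; exists k.
- move=> k; rewrite -PhiI; apply: le_trans (finite_case k) _.
  rewrite ler_wpM2l//; apply: pr_le; last exact: subIsetl.
    exact: measurable_determined (dDk k).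
  exact: measurable_determined dD.
Qed.

(** Let [D] be the points whose first letter is not among the first [k], with [k] so large that [D]
    has mass less than the inverse of [C ^+ 3]. A letter with no successor outside [D] has its whole
    cylinder inside the preimage of [D]; quasi-multiplicativity, summed over the letters of [D],
    then makes that cylinder lighter than itself. For predecessors the same is done with the
    preimage of the cylinder, whose mass is known by invariance. *)
Lemma big_images : exists k,
  (forall x, exists2 y : mshift A, A (x 0%N) (y 0%N) & (choice.pickle (y 0%N) < k)%N) /\
  (forall x, exists2 y : mshift A, A (y 0%N) (x 0%N) & (choice.pickle (y 0%N) < k)%N).
Proof.
have C0 := gibbs_C_gt0 mG; have C30 : 0 < C ^+ 3 by rewrite exprn_gt0.
have mfb k : measurable (~` first_below k).
  by apply: measurableC; exact: measurable_determined (first_below_determined (k := k)).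
have ndfb k : ~` first_below k.+1 `<=` ~` first_below k.
  by move=> x nxk xk; apply: nxk; exact: ltnW.
have capfb x : exists k, ~ (~` first_below k) x.
  by exists (choice.pickle (x 0%N)).+1; apply; rewrite /first_below /=.
have C3V : 0 < (C ^+ 3)^-1 by rewrite invr_gt0.
have [k] := cvg_pr_nonincreasing m mfb ndfb capfb C3V.
rewrite -(ltr_pM2l C30) divff ?gt_eqF// => Dk.
set D := ~` first_below k in Dk *.
have dD : determined 1 D by exact: determinedC.
have m1T := measurable_preimage_iter 1.
exists k; split=> x; apply: contrapT => nox.
- pose Phi U := cyl 1 x `&` (T @^-1` U).
  have mx0 := mass_gt0 mG 1 x.
  have : pr m (Phi D) <= C ^+ 3 * mass m 1 x * pr m D.
    apply: (pr_first_letter (Phi := Phi)) => //.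
    + by rewrite mulr_ge0 ?ltW.
    + move=> U dU; apply: measurableI; first exact: measurable_cyl.
      by apply: m1T; exact: measurable_determined dU.
    + by move=> U V; rewrite /Phi preimage_setU setIUr.
    + by move=> U V; rewrite /Phi preimage_setI setIIr.
    + by rewrite /Phi preimage_set0 setI0.
    + move=> y; exists (choice.pickle (y 1%N)).+1 => U [xy _]; split=> //.
      by rewrite /first_below /=.
    + move=> z; have [xz|nxz] := pselect (A (x 0%N) (z 0%N)).
        have -> : Phi (cyl 1 z) = cyl 2 (scons (x 0%N) z).
          apply/seteqP; split=> y.
            by move=> [xy zy] [|[|//]] _; rewrite ?scons0 ?sconsS// ?xy// zy.
          move=> xzy; split=> -[|//] _; first by rewrite -xzy// scons0.
          by rewrite left_shiftE -xzy// sconsS.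
        have := mass_submul mG 1 1 (scons (x 0%N) z).
        have -> : iter 1 T (scons (x 0%N) z) = z by exact: left_shift_scons.
        have -> : mass m 1 (scons (x 0%N) z) = mass m 1 x; last by rewrite mulrA.
        rewrite /mass; congr (pr m _); apply/seteqP; split=> y xy -[|//] _.
          by rewrite -xy// scons0.
        by rewrite -xy// scons0.
      have -> : Phi (cyl 1 z) = set0.
        apply/seteqP; split=> // y [xy zy]; apply: nxz.
        by rewrite xy// zy// left_shiftE; exact: mshiftP.
      by rewrite pr_set0 !mulr_ge0 ?pr_ge0 ?mass_ge0 ?ltW.
  have -> : Phi D = cyl 1 x.
    apply/seteqP; split=> y; [by case|move=> xy; split=> // ky].
    apply: nox; exists (T y) => //.
    by rewrite xy// left_shiftE; exact: mshiftP.
  rewrite -/(mass m 1 x) leNgt mulrAC => /negP; apply.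
  by rewrite gtr_pMl.
- pose Phi U := U `&` (T @^-1` (cyl 1 x)).
  have mx0 := mass_gt0 mG 1 x.
  have : pr m (Phi D) <= C ^+ 3 * mass m 1 x * pr m D.
    apply: (pr_first_letter (Phi := Phi)) => //.
    + by rewrite mulr_ge0 ?ltW.
    + move=> U dU; apply: measurableI; first exact: measurable_determined dU.
      by apply: m1T; exact: measurable_cyl.
    + by move=> U V; rewrite /Phi setIUl.
    + by move=> U V; rewrite /Phi setIIl.
    + by rewrite /Phi set0I.
    + move=> y; exists (choice.pickle (y 0%N)).+1 => U [Uy xy]; split=> //.
      by rewrite /first_below /=.
    + move=> z; have [zx|nzx] := pselect (A (z 0%N) (x 0%N)).
        have -> : Phi (cyl 1 z) = cyl 2 (scons (z 0%N) x).
          apply/seteqP; split=> y.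
            by move=> [zy xy] [|[|//]] _; rewrite ?scons0 ?sconsS// ?zy// xy.
          move=> zxy; split=> -[|//] _; first by rewrite -zxy// scons0.
          by rewrite left_shiftE -zxy// sconsS.
        have := mass_submul mG 1 1 (scons (z 0%N) x).
        have -> : iter 1 T (scons (z 0%N) x) = x by exact: left_shift_scons.
        have -> : mass m 1 (scons (z 0%N) x) = mass m 1 z; last by rewrite mulrA mulrAC.
        rewrite /mass; congr (pr m _); apply/seteqP; split=> y xy -[|//] _.
          by rewrite -xy// scons0.
        by rewrite -xy// scons0.
      have -> : Phi (cyl 1 z) = set0.
        apply/seteqP; split=> // y [zy xy]; apply: nzx.
        by rewrite zy// xy// left_shiftE; exact: mshiftP.
      by rewrite pr_set0 !mulr_ge0 ?pr_ge0 ?mass_ge0 ?ltW.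
  have -> : Phi D = T @^-1` (cyl 1 x).
    apply/seteqP; split=> y; [by case|move=> xy; split=> // ky].
    apply: nox; exists y => //.
    by rewrite xy// left_shiftE; exact: mshiftP.
  rewrite (pr_preimage_iter (gibbs_inv mG) 1 (measurable_cyl 1 x)).
  rewrite -/(mass m 1 x) leNgt mulrAC => /negP; apply.
  by rewrite gtr_pMl.
Qed.

End BigImages.

Lemma positive_lower_bound (R : realType) (I : eqType) (r : seq I) (f : I -> R) :
  (forall i, 0 < f i) ->
  exists k, [/\ 0 < k, k <= 1 & forall i, i \in r -> k <= f i].
Proof.
move=> f0; elim: r => [|i r [k [k0 k1 kr]]]; first by exists 1.
exists (Num.min k (f i)); split.
- by rewrite lt_min k0 f0.
- by rewrite ge_min k1.
- move=> j; rewrite inE => /predU1P[->|jr]; first by rewrite ge_min lexx orbT.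
  by rewrite ge_min kr.
Qed.

(** * Uniform mixing from the Gibbs property *)

Section GibbsMixing.
Variables (R : realType) (S : countType) (A : transMatrix S) (theta : R).
Hypothesis theta01 : 0 < theta < 1.
Variables (c : R) (phi : mshift A -> R).
Hypotheses (c_ge0 : 0 <= c) (phic : holder theta c phi).
Variables (m : probability (mshift A) R) (C P : R).
Hypothesis mG : gibbs_cst m phi C P.
Hypothesis mixT : topologically_mixing (@left_shift S A).
Local Notation T := (@left_shift S A).
Implicit Types (x y z : mshift A).

Lemma mixing_cyl x y : exists N, forall n, (N <= n)%N ->
  exists z, z 0%N = x 0%N /\ z n = y 0%N.
Proof.
have ocyl z : open (cyl 1 z).
  by apply/open_mshift => u zu; exists 1%N => v uv; exact: cyl_determined uv zu.
have [N HN] := mixT (ocyl x) (ocyl y) (ex_intro _ x (@agree_refl _ _ _ _))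
  (ex_intro _ y (@agree_refl _ _ _ _)).
exists N => n /HN[z [xz yz]]; exists z; rewrite xz// yz//.
by rewrite iter_left_shiftE addn0.
Qed.

(** By big images, finitely many letters serve as predecessors and successors of all others. Mixing
    links any two of them in one common time, and the letters of these finitely many links form the
    minimal alphabet [E0]. *)
Lemma gibbs_uniformly_mixing : exists F xr N kap Q (E0 : {fset S}),
  [/\ (0 < N)%N, 0 < kap <= 1, 1 <= Q, (0 < size F)%N &
      forall E : {fset S}, (E0 `<=` E)%fset ->
        uniformly_mixing phi F xr N kap Q E].
Proof.
have [k [succ pred]] := big_images mG.
(* Letters that occur in no point of the shift are removed, since each element of [F] needs a
   reference point. *)
pose F := [seq b <- pmap choice.unpickle (iota 0 k) |
             `[< exists x : mshift A, x 0%N = b >]].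
have memF y : (choice.pickle (y 0%N) < k)%N -> y 0%N \in F.
  move=> yk; rewrite mem_filter; apply/andP; split.
    by apply/asboolP; exists y.
  rewrite mem_pmap; apply/mapP; exists (choice.pickle (y 0%N)).
    by rewrite mem_iota.
  by rewrite choice.pickleK.
have /choice[xr xrP] (b : S) : exists x : mshift A, b \in F -> x 0%N = b.
  have [[x xb]|nob] := pselect (exists x : mshift A, x 0%N = b).
    by exists x.
  exists point; rewrite mem_filter => /andP[/asboolP xb _].
  by exfalso; exact: nob.
have /choice[Nf NfP] (bc : S * S) : exists N, forall n, (N <= n)%N ->
    exists z : mshift A, z 0%N = xr bc.1 0%N /\ z n = xr bc.2 0%N.
  exact: mixing_cyl.
pose FF := [seq (b, d) | b <- F, d <- F].
pose N := \max_(bc <- FF) Nf bc.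
have /choice[yy yyP] (bc : S * S) : exists z : mshift A, bc \in FF ->
    z 0%N = bc.1 /\ z N = bc.2.
  have [bcF|nF] := boolP (bc \in FF); last by exists point.
  have [z [zb zd]] := NfP bc N (leq_bigmax_seq _ bcF isT).
  exists z => _; rewrite zb zd; move: bcF => /allpairsP[[b d] /= [bF dF ->]] /=.
  by rewrite !xrP.
(* The linking point continues with an arbitrary [x], so it shares only its first [N.+1] letters
   with the chosen [yy]; the subtracted distortion pays for this. *)
have [kap [kap0 kap1 kapP]] := @positive_lower_bound R _ FF
  (fun bc => expR (birkhoff phi N.+1 (yy bc) - distortion theta c))
  (fun=> expR_gt0 _).
pose E0 := [fset yy bc i | bc in FF, i in iota 0 N.+1]%fset.
exists F, xr, N.+1, kap, (Num.max 1 (C * expR P)), E0; split => //.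
- by rewrite kap0.
- by rewrite le_max lexx.
- have [y _ yk] := succ point; have yF := memF y yk.
  by rewrite lt0n size_eq0; apply: contraTneq yF => ->.
move=> E E0E; split.
- exact: xrP.
- by move=> x; have [y xy /memF yF] := succ x; exists (y 0%N).
- move=> b x bF; have [y yx /memF yF] := pred x.
  have bcF : (b, y 0%N) \in FF by apply/allpairsP; exists (b, y 0%N).
  have [y0 yN] := yyP _ bcF.
  have [z [zy zx]] := @splice_ex _ _ N (yy (b, y 0%N)) x (eq_ind_r (fun s => A s _) yx yN).
  exists z; split => //; first by rewrite zy.
    move=> i iN; rewrite zy//; apply: (fsubsetP E0E).
    apply/imfset2P; exists (b, y 0%N) => //; exists i => //.
    by rewrite -[in_mem _ _]/(i \in iota 0 N.+1) mem_iota.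
  apply: le_trans (kapP _ bcF) _; rewrite ler_expR.
  have := birkhoff_distortion theta01 c_ge0 phic (agree_sym zy); lra.
- move=> x; rewrite le_max; apply/orP; right.
  (* The bound [C * expR P] is uniform in [E]: the one-letter cylinders are disjoint, so their
     masses sum to at most 1. *)
  apply: (@le_trans _ _ (\sum_(s <- E | A s (x 0%N)) C * expR P * mass m 1 (scons s x))).
    apply: ler_sum => s sx; rewrite mulr1.
    have := mass_ge mG 1 (scons s x).
    rewrite birkhoffSr birkhoff0 add0r mul1r expRD expRN.
    by rewrite ler_pdivrMr ?expR_gt0// mulrAC.
  rewrite -mulr_sumr -[leRHS]mulr1 ler_wpM2l//.
    by rewrite mulr_ge0 ?expR_ge0// (ltW (gibbs_C_gt0 mG)).
  by rewrite -(mass0 m x) (sum_mass_scons_le (gibbs_inv mG)).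
Qed.

End GibbsMixing.

(** * Averages *)

Section Average.
Variables (R : realType) (d : measure_display) (Y : measurableType d).
Variable mu : probability Y R.
Implicit Types f g h : Y -> R.

Definition bounded_measurable h :=
  measurable_fun [set: Y] h /\ exists H, forall x, `|h x| <= H.

Local Notation avg h := (\int[mu]_x (h x)).

Lemma bm_integrable h : bounded_measurable h -> mu.-integrable setT (EFin \o h).
Proof.
move=> [mh [H hH]]; apply: measurable_bounded_integrable => //.
  exact: le_lt_trans (probability_le1 mu measurableT) (ltry 1).
by exists H; split; [exact: num_real|move=> M HM x _; exact: le_trans (hH x) (ltW HM)].
Qed.

Lemma bmD f g : bounded_measurable f -> bounded_measurable g ->
  bounded_measurable (fun x => f x + g x).
Proof.
move=> [mf [a fa]] [mg [b gb]]; split; first exact: measurable_funD.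
by exists (a + b) => x; apply: le_trans (ler_normD _ _) _; exact: lerD.
Qed.

Lemma bm_cst a : bounded_measurable (fun=> a).
Proof. by split; [exact: measurable_cst|exists `|a|]. Qed.

Lemma bmZ a f : bounded_measurable f -> bounded_measurable (fun x => a * f x).
Proof.
move=> [mf [b fb]]; split; first by apply: measurable_funM => //; exact: measurable_cst.
by exists (`|a| * b) => x; rewrite normrM ler_wpM2l.
Qed.

Lemma bm_indic U : measurable U -> bounded_measurable (\1_U : Y -> R).
Proof.
move=> mU; split; first exact: measurable_indic.
by exists 1 => x; rewrite indicE; case: (x \in U) => /=; rewrite ?normr1 ?normr0.
Qed.

Lemma bm_sum (I : Type) (r : seq I) (P : pred I) (f : I -> Y -> R) :
  (forall i, P i -> bounded_measurable (f i)) ->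
  bounded_measurable (fun x => \sum_(i <- r | P i) f i x).
Proof.
move=> bf; elim: r => [|i r IHr].
  by under eq_fun do [rewrite big_nil]; exact: bm_cst.
under eq_fun do [rewrite big_cons]; case Pi: (P i) => //.
by apply: bmD => //; exact: bf.
Qed.

Lemma avgD f g : bounded_measurable f -> bounded_measurable g ->
  avg (fun x => f x + g x) = avg f + avg g.
Proof. by move=> /bm_integrable bf /bm_integrable bg; exact: RintegralD. Qed.

Lemma avgZ a f : bounded_measurable f -> avg (fun x => a * f x) = a * avg f.
Proof. by move=> /bm_integrable bf; exact: RintegralZl. Qed.

Lemma avg_cst a : avg (fun=> a) = a.
Proof. by rewrite Rintegral_cst// -/(pr mu setT) pr_setT mulr1. Qed.

Lemma avg_le f g : bounded_measurable f -> bounded_measurable g ->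
  (forall x, f x <= g x) -> avg f <= avg g.
Proof. by move=> /bm_integrable bf /bm_integrable bg fg; exact: le_Rintegral. Qed.

Lemma avg_indic U : measurable U -> avg (\1_U) = pr mu U.
Proof. by move=> mU; rewrite /Rintegral integral_indic// setIT. Qed.

Lemma avg_sum (I : Type) (r : seq I) (P : pred I) (f : I -> Y -> R) :
  (forall i, P i -> bounded_measurable (f i)) ->
  avg (fun x => \sum_(i <- r | P i) f i x) = \sum_(i <- r | P i) avg (f i).
Proof.
move=> bf; elim: r => [|i r IHr].
  by rewrite big_nil; under eq_Rintegral do [rewrite big_nil]; exact: avg_cst.
rewrite big_cons; under eq_Rintegral do [rewrite big_cons].
case Pi: (P i) => //; rewrite avgD ?IHr//; first exact: bf.
exact: bm_sum.
Qed.

Lemma avgE h : bounded_measurable h -> (\int[mu]_x (h x)%:E)%E = (avg h)%:E.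
Proof.
by move=> bh; rewrite /Rintegral fineK//; apply: integrable_fin_num => //; exact: bm_integrable.
Qed.

(* [H] controls the part of the space that the sets [B i] leave uncovered. *)
Lemma avg_partition_le (I : finType) (P : pred I) (B : I -> set Y) (a : I -> R) h H :
  (forall i, P i -> measurable (B i)) ->
  (forall i j x, P i -> P j -> B i x -> B j x -> i = j) ->
  bounded_measurable h -> (forall x, h x <= H) ->
  (forall i x, P i -> B i x -> h x <= a i) ->
  avg h <= \sum_(i | P i) pr mu (B i) * a i + (1 - \sum_(i | P i) pr mu (B i)) * H.
Proof.
move=> mB disjB bh hH ha.
pose g x := \sum_(i | P i) a i * \1_(B i) x + (H + \sum_(i | P i) - H * \1_(B i) x).
have bB i b : P i -> bounded_measurable (fun x => b * \1_(B i) x).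
  by move=> Pi; apply: bmZ; apply: bm_indic; exact: mB.
have bg1 : bounded_measurable (fun x => \sum_(i | P i) a i * \1_(B i) x).
  by apply: bm_sum => i Pi; exact: bB.
have bg2 : bounded_measurable (fun x => \sum_(i | P i) - H * \1_(B i) x).
  by apply: bm_sum => i Pi; exact: bB.
have bg3 : bounded_measurable (fun x => H + \sum_(i | P i) - H * \1_(B i) x).
  by apply: bmD => //; exact: bm_cst.
have <- : avg g = \sum_(i | P i) pr mu (B i) * a i +
    (1 - \sum_(i | P i) pr mu (B i)) * H.
  rewrite /g avgD// avgD//; last exact: bm_cst.
  rewrite avg_cst !avg_sum//; try by move=> i Pi; exact: bB.
  rewrite mulrBl mul1r mulr_suml -sumrN; congr (_ + (_ + _)).
    apply: eq_bigr => i Pi; rewrite avgZ ?avg_indic 1?mulrC//; first exact: mB.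
    by apply: bm_indic; exact: mB.
  apply: eq_bigr => i Pi; rewrite avgZ ?avg_indic//; last by apply: bm_indic; exact: mB.
    by rewrite mulNr mulrC.
  exact: mB.
apply: avg_le => //; first exact: bmD.
move=> x; have [[i [Pi Bi]]|noi] := pselect (exists i, P i /\ B i x).
  have B0 j : P j && (j != i) -> \1_(B j) x = 0 :> R.
    move=> /andP[Pj ji]; rewrite indicE memNset// => Bj.
    by rewrite (disjB _ _ _ Pi Pj Bi Bj) eqxx in ji.
  rewrite /g (bigD1 i)//= (bigD1 (P := P) i)//= indicE mem_set// !mulr1.
  rewrite !big1 ?addr0 ?subrr ?addr0; first exact: ha.
    by move=> j /B0 ->; rewrite mulr0.
  by move=> j /B0 ->; rewrite mulr0.
rewrite /g !big1 ?addr0 ?add0r// => i Pi; rewrite indicE memNset ?mulr0// => Bi;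
by apply: noi; exists i.
Qed.

Lemma avg_invariant (T : Y -> Y) h : measurable_fun [set: Y] T ->
  invariant_measure T mu -> bounded_measurable h ->
  bounded_measurable (h \o T) /\ avg (h \o T) = avg h.
Proof.
move=> mT inv [mh [H hH]].
have bhT : bounded_measurable (h \o T).
  by split; [exact: measurableT_comp mh mT|exists H => x; exact: hH].
split => //; rewrite /Rintegral; congr fine.
have := @integral_pushforward _ _ _ _ R T mT mu setT (EFin \o h).
rewrite preimage_setT => /(_ _ (bm_integrable bhT) measurableT) <-.
  by apply: eq_measure_integral => U mU _; exact: inv.
exact/measurable_EFinP.
Qed.

End Average.

(** * Sums over separated families *)

Section Families.
Variables (R : realType) (S : countType) (A : transMatrix S).
Local Notation T := (@left_shift S A).
Implicit Types (x y : mshift A) (E : {fset S}).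

Definition separated n (I : finType) (D : pred I) (z : I -> mshift A) :=
  forall i j, D i -> D j -> agree n (z i) (z j) -> i = j.

Definition letters_in n E : set (mshift A) :=
  [set x : mshift A | forall k, (k < n)%N -> x k \in E].

Lemma letters_in_determined n E : determined n (letters_in n E).
Proof. by move=> x y xy xE k kn; rewrite -xy// xE. Qed.

Lemma measurable_letters_in n E : measurable (letters_in n E).
Proof. exact: measurable_determined (@letters_in_determined n E). Qed.

Lemma words_ex n E : exists (I : finType) (D : pred I) (z : I -> mshift A),
  [/\ separated n D z, forall i, D i -> letters_in n E (z i) &
      forall x, letters_in n E x -> exists2 i, D i & agree n (z i) x].
Proof.
pose W (a : {ffun 'I_n -> E}) x := forall k : 'I_n, x k = val (a k).
have /choice[z zP] a : exists z, (exists x, W a x) -> W a z.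
  have [[x Wx]|nox] := pselect (exists x, W a x); first by exists x.
  by exists point => /nox.
exists {ffun 'I_n -> E}, (fun a => `[< exists x, W a x >]), z; split.
- move=> a b /asboolP/zP za /asboolP/zP zb zab; apply/ffunP => k.
  by apply: val_inj; rewrite -za -zb zab.
- move=> a /asboolP/zP za k kn.
  by have := za (Ordinal kn); rewrite /= => ->; exact: valP.
- move=> x xE; pose a := [ffun k : 'I_n => [` xE k (ltn_ord k)]%fset].
  have Wx : W a x by move=> k; rewrite ffunE.
  exists a; first by apply/asboolP; exists x.
  have za : W a (z a) by apply: zP; exists x.
  by move=> k kn; have := za (Ordinal kn); have := Wx (Ordinal kn) => /= -> ->.
Qed.

Lemma finite_alphabet (m : probability (mshift A) R) n e : 0 < e ->
  exists E, forall E', (E `<=` E')%fset -> 1 - e <= pr m (letters_in n E').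
Proof.
move=> e0; pose E k := [fset s in pmap (@choice.unpickle S) (iota 0 k)]%fset.
have EP k s : (choice.pickle s < k)%N -> s \in E k.
  move=> sk; rewrite in_fset /= mem_pmap; apply/mapP; exists (choice.pickle s).
    by rewrite mem_iota.
  by rewrite choice.pickleK.
pose V k := [set x : mshift A | forall i, (i < n)%N -> (choice.pickle (x i) < k)%N].
have dV k : determined n (V k) by move=> x y xy Vx i ni; rewrite -xy// Vx.
have mV k : measurable (~` V k).
  by apply: measurableC; exact: measurable_determined (dV k).
have ndV k : ~` V k.+1 `<=` ~` V k.
  by move=> x nVx Vx; apply: nVx => i ni; apply: ltnW; exact: Vx.
have capV x : exists k, ~ (~` V k) x.
  exists (\max_(i < n) choice.pickle (x i)).+1; apply => i ni.
  by rewrite ltnS (leq_bigmax (Ordinal ni)).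
have [k] := cvg_pr_nonincreasing m mV ndV capV e0.
have mVk := measurable_determined (dV k).
rewrite prC// => Vk; exists (E k) => E' EE'.
have VE : V k `<=` letters_in n E'.
  by move=> x Vx i ni; apply: (fsubsetP EE'); apply: EP; exact: Vx.
by have := pr_le m mVk (measurable_letters_in n E') VE; lra.
Qed.

End Families.

Section FamilyBound.
Variables (R : realType) (S : countType) (A : transMatrix S) (theta : R).
Hypothesis theta01 : 0 < theta < 1.
Variables (c : R) (phi : mshift A -> R).
Hypotheses (c_ge0 : 0 <= c) (phic : holder theta c phi).
Variables (F : seq S) (xr : S -> mshift A) (N : nat) (kap Q : R) (E : {fset S}).
Hypothesis um : uniformly_mixing phi F xr N kap Q E.
Hypothesis N_gt0 : (0 < N)%N.
Local Notation T := (@left_shift S A).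
Implicit Types (x y : mshift A).

(** Keep the first [n.+1] letters of each [z i] and continue with a reference point that may follow.
    This costs one distortion, and the modified points are distinct branches over finitely many
    points. *)
Lemma sum_family_le_transfer cpsi psi n (I : finType) (D : pred I) (z : I -> mshift A) :
  0 <= cpsi -> holder theta cpsi psi ->
  separated n.+1 D z -> (forall i, D i -> letters_in n.+1 E (z i)) ->
  \sum_(i | D i) expR (birkhoff psi n.+1 (z i)) <=
  expR (distortion theta cpsi) *
    \sum_(b <- F) iter n.+1 (transfer E psi) (fun=> 1) (xr b).
Proof.
move=> cpsi0 psic sepz zE.
have /choice[b bP] (i : I) : exists b, b \in F /\ A (z i n) b.
  have [b bF] := um_succ um (iter n T (z i)).
  by rewrite iter_left_shiftE addn0; exists b.
have /choice[y yP] (i : I) : exists y,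
    agree n.+1 y (z i) /\ iter n.+1 T y = xr (b i).
  by apply: splice_ex; have [bF zb] := bP i; rewrite (um_ref um bF).
have le1 i : D i -> expR (birkhoff psi n.+1 (z i)) <=
    expR (distortion theta cpsi) *
    \sum_(s <- F | b i == s) expR (birkhoff psi n.+1 (y i)).
  move=> Di; have [bF _] := bP i; have [yz _] := yP i.
  rewrite (big_rem _ bF)/= eqxx mulrDr -[leLHS]addr0 lerD//.
    rewrite -expRD ler_expR.
    by have := birkhoff_distortion theta01 cpsi0 psic (agree_sym yz); lra.
  by rewrite mulr_ge0 ?expR_ge0// sumr_ge0// => *; exact: expR_ge0.
apply: le_trans (ler_sum _ le1) _; rewrite -mulr_sumr ler_wpM2l ?expR_ge0//.
rewrite (exchange_big_dep predT)//=; apply: ler_sum => s _.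
apply: sum_le_iter_transfer.
- move=> i j /andP[Di _] /andP[Dj _] yij; apply: sepz => //.
  have [yzi _] := yP i; have [yzj _] := yP j.
  by apply: agree_trans (agree_sym yzi) _; rewrite yij.
- by move=> i /andP[_ /eqP <-]; have [] := yP i.
- by move=> i k /andP[Di _] kn; rewrite (proj1 (yP i) k kn); exact: (zE i Di k kn).
Qed.

Lemma drift_bound f nu n x : (forall x, `|f x| <= nu) ->
  `|drift phi E 0 f (fun=> 0) n x| <= n%:R * nu.
Proof.
move=> fnu; elim: n x => [|n IHn] x /=; first by rewrite normr0 mul0r.
rewrite ler_norml; apply: (markov_bound phi (um_pred N_gt0 um)) => y.
rewrite -ler_norml (le_trans (ler_normD _ _))//.
by rewrite -[n.+1]add1n natrD mulrDl mul1r lerD.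
Qed.

Lemma family_bound (m : probability (mshift A) R) C P f nu G t n
    (I : finType) (D : pred I) (z : I -> mshift A) x0 :
  gibbs_cst m phi C P -> 0 <= nu -> holder theta nu f ->
  (forall n, osc G (drift phi E 0 f (fun=> 0) n)) ->
  (forall n, osc G (fun x => f x + drift phi E 0 f (fun=> 0) n x)) ->
  separated n.+1 D z -> (forall i, D i -> letters_in n.+1 E (z i)) ->
  \sum_(i | D i) expR (birkhoff (fun x => phi x + t * f x) n.+1 (z i)) <=
  expR (distortion theta (c + `|t| * nu)) * (size F)%:R * C *
  expR (n.+1%:R * P + t * drift phi E 0 f (fun=> 0) n.+1 x0 + `|t| * G +
        n.+1%:R * (4 * (t * G) ^+ 2)).
Proof.
move=> mG nu0 fnu oscU oscfU sepz zE.
have psic := holderD phic (holderM t nu0 fnu).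
have cpsi0 : 0 <= c + `|t| * nu by rewrite addr_ge0// mulr_ge0.
apply: le_trans (sum_family_le_transfer cpsi0 psic sepz zE) _.
rewrite -!mulrA ler_wpM2l ?expR_ge0//.
set rhs := C * _.
have : forall b, b \in F -> iter n.+1 (transfer E (fun x => phi x + t * f x))
    (fun=> 1) (xr b) <= rhs.
  move=> b _.
  apply: le_trans (iter_transfer_moment (um_pred N_gt0 um) t oscfU _ _) _.
  apply: le_trans (ler_wpM2r (expR_ge0 _) (weight_le_gibbs mG _ _ _)) _.
  rewrite /rhs -mulrA ler_wpM2l ?(ltW (gibbs_C_gt0 mG))// -expRD ler_expR.
  have : t * (drift phi E 0 f (fun=> 0) n.+1 (xr b) -
      drift phi E 0 f (fun=> 0) n.+1 x0) <= `|t| * G.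
    apply: le_trans (ler_norm _) _; rewrite normrM ler_wpM2l// ler_norml.
    have [lo lob] := oscU n.+1; have := lob (xr b); have := lob x0.
    by move=> h1 h2; apply/andP; split; lra.
  by rewrite mulrBr; lra.
move=> le1; rewrite (_ : (size F)%:R * rhs = \sum_(b <- F) rhs).
  by rewrite big_seq [leRHS]big_seq; exact: ler_sum.
by rewrite big_const_seq count_predT iter_addr_0 mulr_natl.
Qed.

End FamilyBound.

(** Jensen's inequality for weights of total mass at most 1, from the tangent of the exponential at
    [X i = y]. The extra 1 is harmless, being independent of the word length. *)
Lemma sum_expR_jensen (R : realType) (I : finType) (D : pred I) (p X : I -> R) y :
  (forall i, D i -> 0 <= p i) -> \sum_(i | D i) p i <= 1 -> 0 <= y ->
  \sum_(i | D i) p i * expR (X i) <= expR y ->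
  \sum_(i | D i) p i * X i <= y + 1.
Proof.
move=> p0 p1 y0 eXy.
have le1 i : D i -> p i * X i <= p i * y + (p i * expR (X i)) * expR (- y).
  move=> Di; rewrite -mulrA -expRD -mulrDr ler_wpM2l ?p0//.
  by have := expR_ge1Dx (X i - y); lra.
apply: le_trans (ler_sum _ le1) _.
rewrite big_split/= -!mulr_suml lerD//; first by rewrite ler_piMl.
by rewrite expRN ler_pdivrMr ?expR_gt0// mul1r.
Qed.

Section BirkhoffAverage.
Variables (R : realType) (S : countType) (A : transMatrix S).
Local Notation T := (@left_shift S A).
Implicit Types (x y : mshift A) (f h : mshift A -> R).
Variable m : probability (mshift A) R.

Lemma avg_birkhoff f n : invariant_measure T m -> bounded_measurable f ->
  bounded_measurable (birkhoff f n) /\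
  \int[m]_x (birkhoff f n x) = n%:R * \int[m]_x (f x).
Proof.
move=> inv bf.
have bfi i : bounded_measurable (f \o iter i T) /\
    \int[m]_x ((f \o iter i T) x) = \int[m]_x (f x).
  elim: i => [|i [bi ei]]; first by [].
  have [bTi eTi] := avg_invariant (@measurable_left_shift S A) inv bi.
  have -> : f \o iter i.+1 T = (f \o iter i T) \o T.
    by apply/funext => x; rewrite /= -iterS iterSr.
  by rewrite eTi.
rewrite /birkhoff; split; first by apply: bm_sum => i _; have [] := bfi i.
rewrite (avg_sum m _ (fun (i : 'I_n) _ => (bfi i).1)).
under eq_bigr do [rewrite (bfi _).2].
by rewrite sumr_const card_ord mulr_natl.
Qed.

Lemma birkhoff_bound f nu n x : (forall x, `|f x| <= nu) ->
  `|birkhoff f n x| <= n%:R * nu.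
Proof.
move=> fnu; rewrite /birkhoff (le_trans (ler_norm_sum _ _ _))//.
rewrite (le_trans (ler_sum _ (fun i _ => fnu _)))//.
by rewrite sumr_const card_ord mulr_natl.
Qed.

End BirkhoffAverage.

(** * The mean drift under a Gibbs measure *)

Section PressureBound.
Variables (R : realType) (S : countType) (A : transMatrix S) (theta : R).
Hypothesis theta01 : 0 < theta < 1.
Variables (c : R) (phi : mshift A -> R).
Hypotheses (c_ge0 : 0 <= c) (phic : holder theta c phi).
Local Notation T := (@left_shift S A).
Implicit Types (x y : mshift A) (f : mshift A -> R).

(** Cylinder masses of [m1] are at most [C1] times the normalized weights, so [family_bound]
    controls the exponential moment of the deviation from the drift under [m1], and Jensen turns it
    into a bound on the mean. Only the weight bound uses [m0]. *)
Lemma drift_le_avg (F : seq S) xr N kap Q E (m0 m1 : probability (mshift A) R)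
    C0 C1 P f nu G t n x0 :
  uniformly_mixing phi F xr N kap Q E -> (0 < N)%N -> (0 < size F)%N ->
  gibbs_cst m0 phi C0 P -> gibbs_cst m1 phi C1 P ->
  0 <= nu -> holder theta nu f -> (forall x, `|f x| <= nu) ->
  (forall n, osc G (drift phi E 0 f (fun=> 0) n)) ->
  (forall n, osc G (fun x => f x + drift phi E 0 f (fun=> 0) n x)) ->
  1 - n.+1%:R^-1 <= pr m1 (letters_in n.+1 E) ->
  t * (n.+1%:R * (\int[m1]_x (f x)) - drift phi E 0 f (fun=> 0) n.+1 x0) <=
  1 + (distortion theta (c + `|t| * nu) + ln (size F)%:R + ln C0 + ln C1 +
    `|t| * G + n.+1%:R * (4 * (t * G) ^+ 2)) + 2 * `|t| * nu +
    distortion theta (`|t| * nu).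
Proof.
move=> um N0 F0 m0G m1G nu0 fnu fb oscU oscfU mE.
set U := drift _ _ _ _ _ _ _.
set y := distortion _ _ + _ + _ + _ + _ + _.
have [I [D [z [sepz zE Ez]]]] := words_ex A n.+1 E.
pose p i := mass m1 n.+1 (z i).
have disj i j x : D i -> D j -> cyl n.+1 (z i) x -> cyl n.+1 (z j) x -> i = j.
  by move=> Di Dj zi zj; apply: sepz => //; exact: agree_trans zi (agree_sym zj).
have p_le1 : \sum_(i | D i) p i <= 1.
  rewrite -(pr_setT m1); apply: sum_pr_le => //; first by move=> *; exact: measurable_cyl.
  exact: index_enum_uniq.
have p_ge : 1 - n.+1%:R^-1 <= \sum_(i | D i) p i.
  apply: le_trans mE _; apply: sum_pr_ge => //.
  - by move=> *; exact: measurable_cyl.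
  - exact: index_enum_uniq.
  - exact: measurable_letters_in.
  - by move=> x /Ez[i Di zx]; exists i; rewrite mem_index_enum.
have C00 := gibbs_C_gt0 m0G; have C10 := gibbs_C_gt0 m1G.
have F00 : 0 < (size F)%:R :> R by rewrite ltr0n.
have y0 : 0 <= y.
  have G0 := osc_ge0 (oscU 0%N).
  have d0 : 0 <= distortion theta (c + `|t| * nu).
    by apply: distortion_ge0 => //; rewrite addr_ge0// mulr_ge0.
  have lF : 0 <= ln (size F)%:R :> R by rewrite ln_ge0// ler1n.
  have lC0 : 0 <= ln C0 by rewrite ln_ge0// (gibbs_C_ge1 m0G).
  have lC1 : 0 <= ln C1 by rewrite ln_ge0// (gibbs_C_ge1 m1G).
  have tG0 : 0 <= `|t| * G by rewrite mulr_ge0.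
  have nG0 : 0 <= n.+1%:R * (4 * (t * G) ^+ 2).
    by rewrite mulr_ge0// mulr_ge0// sqr_ge0.
  by rewrite /y !addr_ge0.
have expy : \sum_(i | D i) p i * expR (t * (birkhoff f n.+1 (z i) - U)) <= expR y.
  have le1 i : D i -> p i * expR (t * (birkhoff f n.+1 (z i) - U)) <=
      C1 * expR (- (n.+1%:R * P) - t * U) *
      expR (birkhoff (fun x => phi x + t * f x) n.+1 (z i)).
    move=> Di; apply: le_trans (ler_wpM2r (expR_ge0 _) (mass_le m1G _ _)) _.
    rewrite -!mulrA ler_wpM2l ?(ltW C10)// -!expRD ler_expR.
    by rewrite birkhoffD birkhoffM; lra.
  apply: le_trans (ler_sum _ le1) _; rewrite -mulr_sumr.
  have fb1 := family_bound theta01 c_ge0 phic um N0 t x0 m0G nu0 fnu oscU oscfU sepz zE.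
  have CC0 : 0 <= C1 * expR (- (n.+1%:R * P) - t * U).
    by rewrite mulr_ge0 ?expR_ge0// ltW.
  apply: le_trans (ler_wpM2l CC0 fb1) _.
  have -> : expR y = expR (distortion theta (c + `|t| * nu)) * (size F)%:R *
      C0 * C1 * expR (`|t| * G + n.+1%:R * (4 * (t * G) ^+ 2)).
    by rewrite /y !expRD !lnK ?posrE// !mulrA.
  have <- : expR (- (n.+1%:R * P) - t * U) * expR (n.+1%:R * P + t * U +
      `|t| * G + n.+1%:R * (4 * (t * G) ^+ 2)) =
      expR (`|t| * G + n.+1%:R * (4 * (t * G) ^+ 2)).
    by rewrite -expRD; congr expR; ring.
  by rewrite le_eqVlt; apply/orP; left; apply/eqP; rewrite -/U; ring.
have p0 i : D i -> 0 <= p i by move=> _; exact: mass_ge0.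
have jensen := sum_expR_jensen p0 p_le1 y0 expy.
have bf : bounded_measurable f.
  split; last by exists nu.
  by apply: continuous_measurable; exact: (holder_continuous theta01 nu0 fnu).
have btf := bmZ t bf.
have [btfn etfn] := avg_birkhoff n.+1 (gibbs_inv m1G) btf.
have tnu0 : 0 <= `|t| * nu by rewrite mulr_ge0.
have tfb x : birkhoff (fun x => t * f x) n.+1 x <= n.+1%:R * (`|t| * nu).
  apply: le_trans (ler_norm _) _; apply: birkhoff_bound => z'.
  by rewrite normrM ler_wpM2l.
have part := avg_partition_le m1 (fun i _ => measurable_cyl n.+1 (z i)) disj btfn tfb
  (a := fun i => birkhoff (fun x => t * f x) n.+1 (z i) + distortion theta (`|t| * nu)).
have {part} := part _ => /(_ _)/wrap[i x Di zx|].
  have := birkhoff_distortion theta01 tnu0 (holderM t nu0 fnu) (agree_sym zx).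
  lra.
rewrite etfn (avgZ m1 t bf).
have -> : \sum_(i | D i) pr m1 (cyl n.+1 (z i)) *
    (birkhoff (fun x => t * f x) n.+1 (z i) + distortion theta (`|t| * nu)) =
    \sum_(i | D i) p i * (t * (birkhoff f n.+1 (z i) - U)) +
    (\sum_(i | D i) p i) * (t * U + distortion theta (`|t| * nu)).
  rewrite mulr_suml -big_split; apply: eq_bigr => i _ /=.
  by rewrite birkhoffM /p /mass; ring.
rewrite -/p; set sp := \sum_(i | D i) p i in p_le1 p_ge *.
set sX := \sum_(i | D i) p i * _ in jensen *.
have dist0 : 0 <= distortion theta (`|t| * nu) by exact: distortion_ge0.
have tU : `|t * U| <= n.+1%:R * (`|t| * nu).
  by rewrite normrM mulrCA ler_wpM2l//; exact: (drift_bound um N0).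
have n0 : 0 < n.+1%:R :> R by [].
(* Words with letters outside [E] have mass at most the inverse of [n.+1], which offsets the linear
   size of the Birkhoff sums and of the drift. *)
have sp1 : (1 - sp) * (n.+1%:R * (`|t| * nu)) <= `|t| * nu.
  have spn : (1 - sp) * n.+1%:R <= 1.
    rewrite -(ler_pM2r (x := n.+1%:R^-1)) ?invr_gt0//.
    by rewrite mulfK ?gt_eqF// mul1r lerBlDl -lerBlDr.
  by have := ler_wpM2r tnu0 spn; rewrite mul1r -mulrA.
have spU : (1 - sp) * - (t * U) <= `|t| * nu.
  apply: le_trans sp1; rewrite ler_wpM2l ?subr_ge0//.
  by apply: le_trans tU; rewrite -normrN ler_norm.
have spd : sp * distortion theta (`|t| * nu) <= distortion theta (`|t| * nu).
  by rewrite ler_piMl.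
move: jensen sp1 spU spd; rewrite !mulrDr !mulrN !mulrBl !mul1r -/y.
lra.
Qed.

End PressureBound.

Section MomentPressure.
Variables (R : realType) (S : countType) (A : transMatrix S) (theta : R).
Hypothesis theta01 : 0 < theta < 1.
Variables (c : R) (phi : mshift A -> R).
Hypotheses (c_ge0 : 0 <= c) (phic : holder theta c phi).
Local Notation T := (@left_shift S A).
Implicit Types (x y : mshift A) (f : mshift A -> R).

(** The order of quantifiers is the point: [g] depends on [m0] only, while [K] may depend on [m],
    [f], [t] and [gam], as it is lost in the growth rate. *)
Lemma separated_sum_bound (m0 : probability (mshift A) R) C0 P :
  topologically_mixing T -> gibbs_cst m0 phi C0 P ->
  exists2 g, 0 < g & forall (m : probability (mshift A) R) C1,
    gibbs_cst m phi C1 P -> forall f nu, 0 <= nu -> holder theta nu f ->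
    (forall x, `|f x| <= nu) -> forall t gam, 0 < gam ->
    exists K, forall n (I : finType) (D : pred I) z, separated n D z ->
    \sum_(i | D i) expR (birkhoff (fun x => phi x + t * f x) n (z i)) <=
    expR (n%:R * (P + t * \int[m]_x (f x) + 4 * (t * (g * nu)) ^+ 2 + gam) + K).
Proof.
move=> mixT m0G.
have [F [xr [N [kap [Q [E0 [N0 /andP[kap0 kap1] Q1 F0 umE]]]]]]] :=
  gibbs_uniformly_mixing theta01 c_ge0 phic m0G mixT.
have [G0 G00 oscG] := drift_osc theta01 c_ge0 phic xr N0 kap0 kap1 Q1 F0.
exists (2 * (1 + G0)); first by lra.
move=> m C1 mG f nu nu0 fnu fb t gam gam0.
(* [f] oscillates by [2 * nu] and its drift by [G0] times as much; [G] is the sum. *)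
pose G := 2 * (1 + G0) * nu.
pose s := gam / (4 * (t * G) ^+ 2 + 1).
have d0 : 0 < 4 * (t * G) ^+ 2 + 1.
  by rewrite ltr_wpDl// mulr_ge0// sqr_ge0.
have s0 : 0 < s by rewrite divr_gt0.
have sgam : 4 * (t * G) ^+ 2 * s <= gam.
  by rewrite /s mulrCA ler_piMr ?(ltW gam0)// ler_pdivrMr// mul1r lerDl.
(* Dividing the bound at [tau] by [s] gives [t * U] at most [t] times the expected sum, with
   quadratic error [4 * (t * G) ^+ 2 * s], at most [gam] per step. The sign turns the estimate into
   an upper bound on [t * U]. *)
pose tau := - t * s.
pose K1 := distortion theta (c + `|tau| * nu) + ln (size F)%:R + ln C0 + ln C1 +
  `|tau| * G + 2 * `|tau| * nu + distortion theta (`|tau| * nu) + 1.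
pose K2 := distortion theta (c + `|t| * nu) + ln (size F)%:R + ln C0 + `|t| * G +
  s^-1 * K1.
have C00 := gibbs_C_gt0 m0G; have C10 := gibbs_C_gt0 mG.
have F00 : 0 < (size F)%:R :> R by rewrite ltr0n.
exists (Num.max 0 K2) => n I D z sepz.
case: n sepz => [|n] sepz.
  have K0 : 0 <= Num.max 0 K2 by rewrite le_max lexx.
  rewrite mul0r add0r; apply: (@le_trans _ _ 1); last first.
    by rewrite -expR0 ler_expR.
  have [i Di|D0] := pickP D; last by rewrite big_pred0.
  rewrite (bigD1 i)//= birkhoff0 expR0 big_pred0 ?addr0// => j.
  apply/andP => -[Dj /eqP]; apply; exact: sepz.
have n0 : 0 < n.+1%:R^-1 :> R by rewrite invr_gt0.
have [Em EmP] := finite_alphabet m n.+1 n0.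
pose Ez := [fset z i k | i in I, k in iota 0 n.+1]%fset.
(* [E0] gives uniform mixing, [Em] carries almost all words of length [n.+1], and [Ez] contains the
   letters of the family. *)
pose E := (E0 `|` (Em `|` Ez))%fset.
have um : uniformly_mixing phi F xr N kap Q E.
  by apply: umE; exact: fsubsetUl.
have mE : 1 - n.+1%:R^-1 <= pr m (letters_in n.+1 E).
  by apply: EmP; rewrite /E fsetUCA fsubsetUl.
have zE i : D i -> letters_in n.+1 E (z i).
  move=> Di k kn; rewrite !in_fsetU; apply/orP; right; apply/orP; right.
  apply/imfset2P; exists i => //; exists k => //.
  by rewrite -[in_mem _ _]/(k \in iota 0 n.+1) mem_iota.
have osc2 : osc (2 * nu) f.
  by exists (- nu) => x; have := fb x; rewrite ler_norml; lra.
have nu2 : 0 <= 2 * nu by lra.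
have holder2 : holder theta (2 * nu) f.
  by apply: holder_le fnu => //; lra.
have oscU k : osc G (drift phi E 0 f (fun=> 0) k).
  apply: osc_le (oscG E um f (2 * nu) nu2 osc2 holder2 k).
  by rewrite /G; lra.
have oscfU k : osc G (fun x => f x + drift phi E 0 f (fun=> 0) k x).
  apply: osc_le (oscD osc2 (oscG E um f (2 * nu) nu2 osc2 holder2 k)).
  by rewrite /G; lra.
pose x0 : mshift A := point.
have fam := family_bound theta01 c_ge0 phic um N0 t x0 m0G nu0 fnu oscU oscfU sepz zE.
apply: le_trans fam _.
have da := drift_le_avg theta01 c_ge0 phic tau x0 um N0 F0 m0G mG nu0 fnu fb oscU oscfU mE.
set U := drift _ _ _ _ _ _ _ in da *.
set mf := \int[m]_x f x in da *.
have expD4 (d1 b1 : R) : expR d1 * (size F)%:R * C0 * expR b1 =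
    expR (d1 + ln (size F)%:R + ln C0 + b1).
  by rewrite 3!expRD !lnK ?posrE.
rewrite expD4 ler_expR.
rewrite -/G.
have K2max : K2 <= Num.max 0 K2 by rewrite le_max lexx orbT.
have {da} : s^-1 * (tau * (n.+1%:R * mf - U)) <=
    s^-1 * (K1 + n.+1%:R * (4 * (tau * G) ^+ 2)).
  by rewrite ler_pM2l ?invr_gt0//; apply: le_trans da _; rewrite /K1; lra.
have -> : s^-1 * (tau * (n.+1%:R * mf - U)) = t * U - n.+1%:R * (t * mf).
  by rewrite /tau; field; rewrite gt_eqF.
have -> : s^-1 * (K1 + n.+1%:R * (4 * (tau * G) ^+ 2)) =
    s^-1 * K1 + n.+1%:R * (4 * (t * G) ^+ 2 * s).
  by rewrite /tau; field; rewrite gt_eqF.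
have : n.+1%:R * (4 * (t * G) ^+ 2 * s) <= n.+1%:R * gam by rewrite ler_wpM2l.
move: K2max; rewrite {1}/K2 !mulrDr.
lra.
Qed.

End MomentPressure.

(** * The Gurevich-Sarig pressure *)

Section Esum.
Variables (R : realType) (X : choiceType) (Q : set X) (a : X -> R).

Lemma sum_le_esum (I : finType) (D : pred I) (v : I -> X) :
  (forall i j, D i -> D j -> v i = v j -> i = j) -> (forall i, D i -> Q (v i)) ->
  ((\sum_(i | D i) a (v i))%:E <= \esum_(x in Q) (a x)%:E)%E.
Proof.
move=> vinj vQ; pose r := [seq v i | i <- enum D].
have ur : uniq r.
  rewrite map_inj_in_uniq ?enum_uniq// => i j.
  by rewrite !mem_enum; exact: vinj.
apply: esum_ge; exists [set` r].
  split; first exact: finite_seq.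
  by move=> x /= /mapP[i]; rewrite mem_enum => Di ->; exact: vQ.
by rewrite -fsbig_seq// big_map big_enum sumEFin.
Qed.

Lemma esum_le_seq b :
  (forall r : seq X, uniq r -> (forall x, x \in r -> Q x) ->
     \sum_(x <- r) a x <= b) ->
  (\esum_(x in Q) (a x)%:E <= b%:E)%E.
Proof.
move=> rb; apply: ge_ereal_sup => _ [V [finV VQ] <-].
rewrite fsbig_finite//= sumEFin lee_fin; apply: rb => // x.
by rewrite in_fset_set// inE => /VQ.
Qed.

End Esum.

Section GibbsPressure.
Variables (R : realType) (S : countType) (A : transMatrix S) (theta : R).
Hypothesis theta01 : 0 < theta < 1.
Variables (c : R) (phi : mshift A -> R).
Hypotheses (c_ge0 : 0 <= c) (phic : holder theta c phi).
Local Notation T := (@left_shift S A).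
Implicit Types (x y : mshift A).
Variables (m : probability (mshift A) R) (C P : R).
Hypothesis mG : gibbs_cst m phi C P.
Hypothesis mixT : topologically_mixing T.

Let per n s := [set x : mshift A | iter n T x = x /\ x 0%N = s].

Lemma periodic_agree n x y : iter n.+1 T x = x -> iter n.+1 T y = y ->
  agree n.+1 x y -> x = y.
Proof.
move=> xx yy xy; apply: mshift_inj => i.
have red z : iter n.+1 T z = z -> z i = z (i %% n.+1)%N.
  move=> zz; rewrite {1}(divn_eq i n.+1); elim: (i %/ n.+1)%N => [|k IHk].
    by rewrite mul0n.
  by rewrite mulSn -addnA -iter_left_shiftE zz.
by rewrite (red x xx) (red y yy) xy// ltn_mod.
Qed.

(** A periodic point is determined by one period, so distinct ones have disjoint cylinders, whose
    masses bound the summands. *)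
Lemma periodic_sum_le n s :
  (\esum_(x in per n.+1 s) (expR (birkhoff phi n.+1 x))%:E <=
   (C * expR (n.+1%:R * P))%:E)%E.
Proof.
have C0 := gibbs_C_gt0 mG.
apply: esum_le_seq => r ur rper.
apply: (@le_trans _ _ (\sum_(x <- r) C * expR (n.+1%:R * P) * mass m n.+1 x)).
  apply: ler_sum => x _; have := mass_ge mG n.+1 x.
  by rewrite expRD expRN ler_pdivrMr ?expR_gt0// mulrAC.
rewrite -mulr_sumr -[leRHS]mulr1 ler_wpM2l//; first by rewrite mulr_ge0 ?expR_ge0 ?ltW.
rewrite big_seq -(pr_setT m); apply: sum_pr_le => //.
- by move=> x _; exact: measurable_cyl.
- move=> x y z /rper[xx _] /rper[yy _] xz yz; apply: periodic_agree xx yy _.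
  exact: agree_trans xz (agree_sym yz).
Qed.

(** Every word starting with [s] can be closed up by a linking word of length [N], at a bounded
    multiplicative cost; the masses of these words add up to a fixed fraction of the cylinder of
    [s]. *)
Lemma periodic_sum_ge s : (exists x : mshift A, x 0%N = s) ->
  exists (N : nat) (b : R), 0 < b /\ forall k,
  ((b * expR ((k.+1 + N)%:R * P))%:E <=
   \esum_(x in per (k.+1 + N) s) (expR (birkhoff phi (k.+1 + N) x))%:E)%E.
Proof.
move=> [xs xs0]; have C0 := gibbs_C_gt0 mG.
have [F [xr [N [kap [Q [E0 [N0 /andP[kap0 kap1] Q1 F0 umE]]]]]]] :=
  gibbs_uniformly_mixing theta01 c_ge0 phic mG mixT.
have um := umE E0 (fsubset_refl E0).
have ms0 : 0 < mass m 1 xs / 2 by rewrite divr_gt0// (mass_gt0 mG).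
pose B := distortion theta c.
exists N, (C^-1 * (kap * expR (- B)) * expR (- (N%:R * P)) * (mass m 1 xs / 2)).
split.
  by rewrite mulr_gt0// mulr_gt0 ?expR_gt0// mulr_gt0 ?invr_gt0// mulr_gt0 ?expR_gt0.
move=> k.
(* Omitting words of mass at most half that of the cylinder of [s] leaves at least half of this
   cylinder. *)
have [E EP] := finite_alphabet m k.+1 ms0.
have {EP} mE := EP E (fsubset_refl E).
have [I [D [z [sepz zE Ez]]]] := words_ex A k.+1 E.
pose D' i := D i && (z i 0%N == s).
have vex i : exists v, D' i -> [/\ per (k.+1 + N) s v, agree k.+1 v (z i) &
    kap * expR (- B) <= expR (birkhoff phi N (iter k.+1 T v))].
  have [/andP[Di /eqP zs]|nD] := boolP (D' i); last by exists point.
  have [b bF zb] := um_succ um (iter k T (z i)).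
  rewrite iter_left_shiftE addn0 in zb.
  have [y [y0 yz _ ky]] := um_link um (z i) bF.
  have zy : A (z i k) (y 0%N) by rewrite y0.
  have [u [uz uy]] := splice_ex zy.
  have ukN : iter (k.+1 + N) T u = z i by rewrite addnC iterD uy.
  (* [u] reads the word of [z i], then the linking word, then [z i] again: the letter after the link
     is the first one, so the period can be closed. *)
  have uu : A (u (k + N)%N) (u 0%N).
    have -> : u 0%N = u (k + N).+1.
      by rewrite uz// -ukN iter_left_shiftE addn0 addSn.
    exact: mshiftP.
  have [v [vu vv]] := periodic_ex uu.
  have vz : agree k.+1 v (z i).
    by apply: agree_trans uz; apply: agree_le vu; rewrite -addSn leq_addr.
  exists v => _; split=> //; first by split; [rewrite addSn|rewrite vz].
  have vy : agree N (iter k.+1 T v) y.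
    by rewrite -uy; apply: agree_iter_left_shift; rewrite addSn.
  apply: le_trans (ler_wpM2r (expR_ge0 _) ky) _; rewrite -expRD ler_expR.
  by have := birkhoff_distortion theta01 c_ge0 phic (agree_sym vy); rewrite -/B; lra.
have {vex} [v vP] := choice vex.
apply: (@le_trans _ _ (\sum_(i | D' i) expR (birkhoff phi (k.+1 + N) (v i)))%:E);
    last first.
  apply: sum_le_esum; last by move=> i /vP[].
  move=> i j D'i D'j vij; have [_ vi _] := vP i D'i; have [_ vj _] := vP j D'j.
  move: D'i D'j => /andP[Di _] /andP[Dj _]; apply: sepz => //.
  by apply: agree_trans (agree_sym vi) _; rewrite vij.
rewrite lee_fin.
have le1 i : D' i -> C^-1 * (kap * expR (- B)) * expR (k.+1%:R * P) * mass m k.+1 (z i) <=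
    expR (birkhoff phi (k.+1 + N) (v i)).
  move=> /vP[_ vz kv]; rewrite birkhoff_add.
  have := mass_le mG k.+1 (v i); have -> : mass m k.+1 (v i) = mass m k.+1 (z i).
    rewrite /mass; congr (pr m _); apply/seteqP; split=> x xv.
      exact: agree_trans (agree_sym vz) xv.
    exact: agree_trans vz xv.
  rewrite -ler_pdivrMl// => le1.
  have h0 : 0 <= expR (k.+1%:R * P) by exact: expR_ge0.
  have := ler_wpM2l h0 le1; rewrite -expRD subrKC expRD => le2.
  rewrite (_ : C^-1 * _ * _ * _ = (expR (k.+1%:R * P) * (C^-1 * mass m k.+1 (z i))) *
    (kap * expR (- B))); last by ring.
  apply: ler_pM => //; last by rewrite mulr_ge0 ?expR_ge0// ltW.
  by rewrite mulr_ge0// mulr_ge0 ?mass_ge0// invr_ge0 ltW.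
apply: le_trans (ler_sum _ le1); rewrite -mulr_sumr.
have -> : C^-1 * (kap * expR (- B)) * expR (- (N%:R * P)) * (mass m 1 xs / 2) *
    expR ((k.+1 + N)%:R * P) =
    C^-1 * (kap * expR (- B)) * expR (k.+1%:R * P) * (mass m 1 xs / 2).
  have -> : expR ((k.+1 + N)%:R * P) = expR (k.+1%:R * P) * expR (N%:R * P).
    by rewrite -expRD natrD mulrDl.
  by rewrite !expRN; field; rewrite !gt_eqF ?expR_gt0.
rewrite ler_wpM2l//.
  by rewrite !mulr_ge0 ?expR_ge0 ?invr_ge0 ?ltW.
have mI : measurable (cyl 1 xs `&` letters_in k.+1 E).
  by apply: measurableI; [exact: measurable_cyl|exact: measurable_letters_in].
apply: (@le_trans _ _ (pr m (cyl 1 xs `&` letters_in k.+1 E))).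
  have : mass m 1 xs <= pr m ((cyl 1 xs `&` letters_in k.+1 E) `|` ~` letters_in k.+1 E).
    apply: pr_le; first exact: measurable_cyl.
      by apply: measurableU => //; apply: measurableC; exact: measurable_letters_in.
    move=> x xsx; have [xE|nxE] := pselect (letters_in k.+1 E x); [by left|by right].
  have := prU_le m mI (measurableC (measurable_letters_in k.+1 E)).
  rewrite prC; last exact: measurable_letters_in.
  lra.
apply: sum_pr_ge => //.
- by move=> i _; exact: measurable_cyl.
- move=> i j x /andP[Di _] /andP[Dj _] zi zj; apply: sepz => //.
  exact: agree_trans zi (agree_sym zj).
- exact: index_enum_uniq.
- move=> x [xsx /Ez[i Di zx]]; exists i; rewrite mem_index_enum; split=> //.
  by rewrite /D' Di (zx 0%N isT) -(xsx 0%N isT) xs0 eqxx.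
Qed.

(** The periodic sums lie between constant multiples of [expR (n%:R * P)]. In particular all Gibbs
    measures of the same potential share [P]. *)
Lemma gibbs_pressure s : (exists x : mshift A, x 0%N = s) ->
  gurevich_sarig_pressure phi s = P%:E.
Proof.
move=> xs; have [N [b [b0 bN]]] := periodic_sum_ge xs.
have C0 := gibbs_C_gt0 mG.
pose seq_bound (q : R) (n : nat) := P + n%:R^-1 * ln q.
have cvg_bound q : (EFin \o seq_bound q) @ \oo --> P%:E.
  apply/fine_cvgP; split; first exact: nearW.
  rewrite -[X in _ --> X]addr0; apply: cvgD; first exact: cvg_cst.
  rewrite -(mul0r (ln q)); apply: cvgM; last exact: cvg_cst.
  by apply/gtr0_cvgV0; [exists 1%N => // n /=; rewrite ltr0n|exact: cvgr_idn].
apply/cvg_lim => //.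
apply: (squeeze_cvge _ (cvg_bound b) (cvg_bound C)).
exists N.+1 => // n /= Nn.
have nE : n = ((n - N.+1).+1 + N)%N by rewrite addSn -addnS subnK.
have := bN (n - N.+1)%N; rewrite -nE => lower.
have upper : (\esum_(x in per n s) (expR (birkhoff phi n x))%:E <=
   (C * expR (n%:R * P))%:E)%E.
  by case: (n) Nn => // n' _; exact: periodic_sum_le.
have n0 : 0 < n%:R :> R by rewrite ltr0n (leq_trans _ Nn).
move: lower upper; rewrite -/(per n s); case: (esum _ _) => [z| |] //.
rewrite !lee_fin => bz zC.
have z0 : 0 < z by apply: lt_le_trans bz; rewrite mulr_gt0 ?expR_gt0.
rewrite lne_EFin// -EFinM !lee_fin /seq_bound.
have lnE q : 0 < q -> P + n%:R^-1 * ln q = n%:R^-1 * ln (q * expR (n%:R * P)).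
  move=> q0; rewrite lnM ?posrE ?expR_gt0// expRK mulrDr mulrA mulVf ?gt_eqF//.
  by rewrite mul1r addrC.
rewrite !lnE// !ler_pM2l ?invr_gt0// !ler_ln ?posrE ?mulr_gt0 ?expR_gt0//.
by rewrite bz zC.
Qed.

End GibbsPressure.

(** * The variational inequality *)

Section Approximation.
Variables (R : realType) (S : countType) (A : transMatrix S).
Variable mu : probability (mshift A) R.
Implicit Types (x y : mshift A) (U V B : set (mshift A)).

Definition symd U V := (U `\` V) `|` (V `\` U).

Lemma measurable_symd U V : measurable U -> measurable V -> measurable (symd U V).
Proof. by move=> mU mV; apply: measurableU; exact: measurableD. Qed.

Definition approximable B := measurable B /\ forall e, 0 < e ->
  exists M U, determined M U /\ pr mu (symd B U) < e.

Lemma approximable_open U : open U -> approximable U.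
Proof.
move=> oU; have mU := measurable_open oU; split=> // e e0.
pose V n := [set x | forall y, agree n x y -> U y].
have dV n : determined n (V n).
  by move=> x y xy Vx z yz; apply: Vx; exact: agree_trans xy yz.
have mUV n : measurable (U `\` V n).
  by apply: measurableD => //; exact: measurable_determined (dV n).
have ndUV n : U `\` V n.+1 `<=` U `\` V n.
  move=> x [Ux nVx]; split=> // Vx; apply: nVx => y xy; apply: Vx.
  exact: agree_le xy.
have capUV x : exists n, ~ (U `\` V n) x.
  have [Ux|nUx] := pselect (U x); last by exists 0%N => -[].
  by have [n nU] := iffRL (open_mshift U) oU _ Ux; exists n => -[_]; apply.
have [n nV] := cvg_pr_nonincreasing mu mUV ndUV capUV e0.
exists n, (V n); split=> //; apply: le_lt_trans nV; apply: pr_le => //.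
  exact: measurable_symd mU (measurable_determined (dV n)).
by move=> x [//|[Vx nUx]]; exfalso; apply: nUx; exact: Vx.
Qed.

Lemma approximableC B : approximable B -> approximable (~` B).
Proof.
move=> [mB aB]; split; first exact: measurableC.
move=> e /aB[M [U [dU BU]]]; exists M, (~` U); split; first exact: determinedC.
rewrite (_ : symd _ _ = symd B U)//; apply/seteqP.
by split=> x [[h1 h2]|[h1 h2]]; [right|left|right|left]; split=> //; apply: contrapT.
Qed.

Lemma approximableU B B' : approximable B -> approximable B' ->
  approximable (B `|` B').
Proof.
move=> [mB aB] [mB' aB']; split; first exact: measurableU.
move=> e e0; have e2 : 0 < e / 2 by rewrite divr_gt0.
have [M [U [dU BU]]] := aB _ e2; have [M' [U' [dU' BU']]] := aB' _ e2.
exists (maxn M M'), (U `|` U'); split.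
  apply: determinedU; [apply: determined_le dU|apply: determined_le dU'].
    exact: leq_maxl.
  exact: leq_maxr.
have mU := measurable_determined dU; have mU' := measurable_determined dU'.
have m1 := measurable_symd mB mU; have m2 := measurable_symd mB' mU'.
apply: (@le_lt_trans _ _ (pr mu (symd B U `|` symd B' U'))).
  apply: pr_le; [|exact: measurableU|].
    by apply: measurable_symd; exact: measurableU.
  move=> x [[BBx nUx]|[UUx nBx]].
    case: BBx => Bx; [left|right]; left; split=> // Ux; apply: nUx; [by left|by right].
  case: UUx => Ux; [left|right]; right; split=> // Bx; apply: nBx; [by left|by right].
by have := prU_le mu m1 m2; lra.
Qed.

Lemma approximable_bigcup (B : (set (mshift A))^nat) :
  (forall i, approximable (B i)) -> approximable (\bigcup_i B i).
Proof.
move=> aB; pose V n := \big[setU/set0]_(i < n) B i.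
have aV n : approximable (V n).
  elim: n => [|n IHn]; last by rewrite /V big_ord_recr; exact: approximableU.
  rewrite /V big_ord0; split=> // e e0; exists 0%N, set0; split=> //.
  rewrite (_ : symd _ _ = set0) ?pr_set0//.
  by apply/seteqP; split=> // x [[]|[]].
have mB : measurable (\bigcup_i B i) by apply: bigcupT_measurable => i; exact: (aB i).1.
split=> // e e0; have e2 : 0 < e / 2 by rewrite divr_gt0.
have VP n x : V n x <-> exists2 i, (i < n)%N & B i x.
  rewrite /V -bigcup_mkord; split=> [[i /= ni Bi]|[i ni Bi]]; by exists i.
have mBV n : measurable (\bigcup_i B i `\` V n).
  by apply: measurableD => //; exact: (aV n).1.
have ndBV n : \bigcup_i B i `\` V n.+1 `<=` \bigcup_i B i `\` V n.
  move=> x [Bx nVx]; split=> // /VP[i ni Bi]; apply: nVx; apply/VP.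
  by exists i => //; exact: ltnW.
have capBV x : exists n, ~ (\bigcup_i B i `\` V n) x.
  have [[i _ Bi]|nBx] := pselect ((\bigcup_i B i) x); last by exists 0%N => -[].
  by exists i.+1 => -[_]; apply; apply/VP; exists i.
have [n nV] := cvg_pr_nonincreasing mu mBV ndBV capBV e2.
have [mV aVn] := aV n; have [M [U [dU VU]]] := aVn _ e2.
exists M, U; split=> //.
have mU := measurable_determined dU; have m1 := measurable_symd mV mU.
apply: (@le_lt_trans _ _ (pr mu ((\bigcup_i B i `\` V n) `|` symd (V n) U))).
  apply: pr_le; [exact: measurable_symd|exact: measurableU|].
  move=> x [[Bx nUx]|[Ux nBx]].
    have [Vx|nVx] := pselect (V n x); [by right; left|by left].
  right; right; split=> // /VP[i ni Bi]; apply: nBx; by exists i.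
by have := prU_le mu (mBV n) m1; lra.
Qed.

(** The approximable sets form a sigma-algebra containing the open sets. *)
Lemma measurable_approximable B : measurable B -> approximable B.
Proof.
have : <<s (@open (mshift A)) >> `<=` approximable.
  apply: smallest_sub; last by move=> U; exact: approximable_open.
  split.
  - by have := approximable_open open0.
  - by move=> U; rewrite setTD; exact: approximableC.
  - exact: approximable_bigcup.
exact.
Qed.

Lemma pr_bigU_le (I : Type) (r : seq I) (B : I -> set (mshift A)) :
  (forall i, measurable (B i)) ->
  pr mu (\big[setU/set0]_(i <- r) B i) <= \sum_(i <- r) pr mu (B i).
Proof.
move=> mB; elim: r => [|i r IHr]; first by rewrite !big_nil pr_set0.
have mr : measurable (\big[setU/set0]_(i <- r) B i).
  by elim: r {IHr} => [|j r IHr]; rewrite ?big_nil ?big_cons//; exact: measurableU.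
rewrite !big_cons; apply: le_trans (prU_le mu (mB i) mr) _.
by rewrite lerD2l.
Qed.

(** The map [cc] guesses the partition element from the first [M] letters. A wrong guess is possible
    only where some element differs from its approximation. *)
Lemma approximate_partition k (P : 'I_k -> set (mshift A)) e :
  finite_partition P -> 0 < e -> exists M (cc : mshift A -> 'I_k),
  [/\ forall x y, agree M x y -> cc x = cc y,
      measurable [set x | ~ P (cc x) x] & pr mu [set x | ~ P (cc x) x] <= e].
Proof.
move=> [mP tP PT] e0.
have [i0 _ _] : (\bigcup_i P i) point by rewrite PT.
have k0 : (0 < k)%N by apply: leq_ltn_trans (ltn_ord i0).
have ek : 0 < e / k%:R by rewrite divr_gt0// ltr0n.
have /choice[MU MUP] i : exists MU : nat * set (mshift A),
    determined MU.1 MU.2 /\ pr mu (symd (P i) MU.2) < e / k%:R.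
  have [_ /(_ _ ek)[M [U]]] := measurable_approximable (mP i).
  by exists (M, U).
pose M := (\max_i (MU i).1)%N; pose U i := (MU i).2.
have dU i : determined M (U i).
  by apply: determined_le (MUP i).1; exact: leq_bigmax.
(* The default applies when [x] lies in no [U i]. Such a point lies in some [P i] outside [U i], so
   it is already counted among the possible errors. *)
pose cc x := odflt i0 [pick i | `[< U i x >]].
have ccM x y : agree M x y -> cc x = cc y.
  move=> xy; rewrite /cc; congr odflt; apply: eq_pick => i.
  by apply/asboolP/asboolP; apply: dU => //; exact: agree_sym.
have mcc i : measurable [set x | cc x = i].
  by apply: (@measurable_determined _ _ M) => x y /ccM /= ->.
have mbad : measurable [set x | ~ P (cc x) x].
  rewrite (_ : [set _ | _] =
      \big[setU/set0]_(i <- enum 'I_k) ([set x | cc x = i] `\` P i)).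
    by apply: bigU_measurable => i _; exact: measurableD.
  apply/seteqP; split=> x /=.
    by move=> nPx; apply/bigUP; exists (cc x); rewrite mem_enum.
  by move=> /bigUP[i [_ _ [/= -> ]]].
exists M, cc; split=> //.
have msd i : measurable (symd (P i) (U i)).
  by apply: measurable_symd => //; exact: measurable_determined (dU i).
apply: (@le_trans _ _ (pr mu (\big[setU/set0]_(i <- enum 'I_k) symd (P i) (U i)))).
  apply: pr_le => //; first exact: bigU_measurable.
  move=> x /= nPx; apply: contrapT => noi.
  have PU i : U i x <-> P i x.
    split=> h; apply: contrapT => nh; apply: noi; apply/bigUP; exists i.
      by rewrite mem_enum; split=> //; right.
    by rewrite mem_enum; split=> //; left.
  apply: nPx; rewrite /cc; case: pickP => [i /asboolP/PU //|noU].
  have [i _ Pi] : (\bigcup_i P i) x by rewrite PT.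
  by have /asboolP := (PU i).2 Pi; rewrite noU.
apply: le_trans (pr_bigU_le _ msd) _.
rewrite big_enum/=; apply: (@le_trans _ _ (\sum_(i < k) e / k%:R)).
  by apply: ler_sum => i _; rewrite ltW// (MUP i).2.
by rewrite sumr_const card_ord -[leLHS]mulr_natr divfK// gt_eqF// ltr0n.
Qed.

End Approximation.

(* Concavity of the logarithm, with [r] normalized by [expR L]. The first sum
   is the entropy of a marginal of [pi]. *)
Lemma entropy_marginal_le (R : realType) (W J : finType) (D : pred J)
    (proj : J -> W) (pi r : J -> R) (p : W -> R) L :
  (forall j, D j -> 0 <= pi j) -> (forall j, D j -> 0 < r j) ->
  \sum_(j | D j) pi j = 1 -> \sum_(j | D j) r j <= expR L ->
  (forall w, p w = \sum_(j | D j && (proj j == w)) pi j) ->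
  \sum_w - (p w * ln (p w)) + \sum_(j | D j) pi j * ln (r j) <= L.
Proof.
move=> pi0 r0 pi1 rL pE.
have p_ge j : D j -> pi j <= p (proj j).
  move=> Dj; rewrite pE (bigD1 j) ?Dj ?eqxx//= lerDl sumr_ge0// => i.
  by move=> /andP[/andP[Di _] _]; exact: pi0.
have le1 j : D j -> pi j * (ln (r j) - ln (p (proj j)) - L) <= r j * expR (- L) - pi j.
  move=> Dj; have := pi0 j Dj; rewrite le_eqVlt => /predU1P[<-|pij].
    by rewrite mul0r subr0 mulr_ge0 ?expR_ge0// ltW// r0.
  have pj : 0 < p (proj j) by exact: lt_le_trans (p_ge j Dj).
  have rj := r0 j Dj.
  have x0 : 0 < r j / p (proj j) * expR (- L).
    by rewrite mulr_gt0 ?expR_gt0// divr_gt0.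
  have -> : ln (r j) - ln (p (proj j)) - L = ln (r j / p (proj j) * expR (- L)).
    by rewrite lnM ?posrE ?expR_gt0 ?divr_gt0// expRK ln_div.
  have lnx : ln (r j / p (proj j) * expR (- L)) <= r j / p (proj j) * expR (- L) - 1.
    have := @le_ln1Dx R (r j / p (proj j) * expR (- L) - 1).
    by rewrite subrKC ltrBrDl subrr; exact.
  apply: le_trans (ler_wpM2l (ltW pij) lnx) _; rewrite mulrBr mulr1 lerD2r.
  have -> : pi j * (r j / p (proj j) * expR (- L)) =
    pi j / p (proj j) * (r j * expR (- L)) by ring.
  by rewrite ler_piMl ?mulr_ge0 ?expR_ge0 ?(ltW rj)// ler_pdivrMr// mul1r p_ge.
have : \sum_(j | D j) pi j * (ln (r j) - ln (p (proj j)) - L) <= 0.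
  apply: le_trans (ler_sum _ le1) _; rewrite sumrB pi1 -mulr_suml subr_le0.
  by rewrite expRN ler_pdivrMr ?expR_gt0// mul1r.
have -> : \sum_(j | D j) pi j * (ln (r j) - ln (p (proj j)) - L) =
    \sum_(j | D j) pi j * ln (r j) + \sum_w - (p w * ln (p w)) - L.
  have -> : \sum_w - (p w * ln (p w)) = \sum_(j | D j) - (pi j * ln (p (proj j))).
    rewrite (partition_big proj predT)//=; apply: eq_bigr => w _.
    rewrite {1}pE mulr_suml -sumrN.
    by apply: eq_bigr => j /andP[_ /eqP <-].
  have -> : L = \sum_(j | D j) pi j * L by rewrite -mulr_suml pi1 mul1r.
  rewrite -big_split -sumrB; apply: eq_bigr => j _ /=.
  by rewrite -mulr_suml pi1 mul1r; ring.
lra.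
Qed.

Section Itineraries.
Variables (R : realType) (S : countType) (A : transMatrix S).
Local Notation T := (@left_shift S A).
Implicit Types (x y : mshift A).
Variable mu : probability (mshift A) R.

Lemma refined_atomP k (P : 'I_k -> set (mshift A)) n (w : {ffun 'I_n -> 'I_k}) x :
  refined_atom T P w x <-> forall i : 'I_n, P (w i) (iter i T x).
Proof. by split=> [h i|h i _]; exact: h. Qed.

Lemma measurable_refined_atom k (P : 'I_k -> set (mshift A)) n
    (w : {ffun 'I_n -> 'I_k}) :
  finite_partition P -> measurable (refined_atom T P w).
Proof.
move=> [mP _ _]; apply: fin_bigcap_measurable; first exact: finite_finset.
by move=> i _; apply: measurable_preimage_iter; exact: mP.
Qed.

Lemma itinerary_ex k (P : 'I_k -> set (mshift A)) n x :
  finite_partition P -> exists w : {ffun 'I_n -> 'I_k}, refined_atom T P w x.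
Proof.
move=> [_ _ PT].
have /choice[w wP] (i : 'I_n) : exists j, P j (iter i T x).
  have [j _ Pj] : (\bigcup_j P j) (iter i T x) by rewrite PT.
  by exists j.
by exists [ffun i => w i]; apply/refined_atomP => i; rewrite ffunE.
Qed.

Lemma itinerary_inj k (P : 'I_k -> set (mshift A)) n (w w' : {ffun 'I_n -> 'I_k}) x :
  finite_partition P -> refined_atom T P w x -> refined_atom T P w' x -> w = w'.
Proof.
move=> [_ tP _] /refined_atomP wx /refined_atomP w'x; apply/ffunP => i.
by apply: tP => //; exists (iter i T x).
Qed.

End Itineraries.

Lemma ln_prod (R : realType) (I : Type) (r : seq I) (f : I -> R) :
  (forall i, 0 < f i) -> ln (\prod_(i <- r) f i) = \sum_(i <- r) ln (f i).
Proof.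
move=> f0; elim: r => [|i r IHr]; first by rewrite !big_nil ln1.
by rewrite !big_cons lnM ?posrE ?prodr_gt0// IHr.
Qed.

(** * Entropy of a partition against separated sums *)

Section Variational.
Variables (R : realType) (S : countType) (A : transMatrix S) (theta : R).
Hypothesis theta01 : 0 < theta < 1.
Variables (c : R) (psi : mshift A -> R).
Hypotheses (c_ge0 : 0 <= c) (psic : holder theta c psi).
Local Notation T := (@left_shift S A).
Implicit Types (x y : mshift A).
Variables (mu : probability (mshift A) R) (F0 : {fset S}).
Local Notation Y := (subsystem A F0).
Hypotheses (inv : invariant_measure T mu) (muY : mu Y = 1%E).

Lemma measurable_subsystem : measurable Y.
Proof.
rewrite -[X in measurable X]setCK; apply: measurableC.
apply: measurable_open; apply/open_mshift => x nYx.
have [i xi] : exists i, x i \notin F0.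
  by apply: contrapT => noi; apply: nYx => i; apply: contrapT => /negP xi; apply: noi; exists i.
by exists i.+1 => y xy /(_ i); rewrite -xy//; apply/negP.
Qed.

(** The potential may be unbounded on the shift but is bounded on a subsystem with finite alphabet.
    The cutoff keeps every integrand bounded. *)
Let psiY x := psi x * \1_Y x.

Lemma subsystem_bm : bounded_measurable psiY.
Proof.
have mY := measurable_subsystem; split.
  apply: measurable_funM; last exact: measurable_indic.
  by apply: continuous_measurable; exact: (holder_continuous theta01 c_ge0 psic).
have /choice[xr xrP] s : exists y, forall x : mshift A, Y x -> x 0%N = s -> y 0%N = s.
  have [[x xs]|nox] := pselect (exists x : mshift A, x 0%N = s); first by exists x.
  by exists point => x _ xs; exfalso; apply: nox; exists x.
have s0 (r : seq S) : 0 <= \sum_(s <- r) `|psi (xr s)| by apply: sumr_ge0.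
have c0 : 0 <= c * theta by case/andP: theta01 => ? _; rewrite mulr_ge0// ltW.
suff bnd x : `|psiY x| <= \sum_(s <- F0) `|psi (xr s)| + c * theta.
  by exists (\sum_(s <- F0) `|psi (xr s)| + c * theta).
rewrite /psiY indicE.
have [Yx|nYx] := pselect (Y x); last first.
  by rewrite memNset// mulr0 normr0 addr_ge0.
rewrite mem_set// mulr1 (big_rem _ (Yx 0%N))/=.
have h0 := xrP (x 0%N) x Yx erefl.
have a1 : agree 1 x (xr (x 0%N)) by case=> // _; rewrite h0.
have := psic (ltn0Sn 0) a1; have := psic (ltn0Sn 0) (agree_sym a1).
rewrite expr1; have := s0 (rem (x 0%N) F0).
have := ler_norm (psi (xr (x 0%N))); have := ler_norm (- psi (xr (x 0%N))).
rewrite normrN ler_norml => *; apply/andP; split; lra.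
Qed.

Lemma subsystem_integral :
  (\int[mu]_(x in Y) (psi x)%:E)%E = (\int[mu]_x psiY x)%:E.
Proof.
rewrite -(avgE mu subsystem_bm) integral_mkcond; apply: eq_integral => x _.
rewrite /psiY patchE indicE; case: ifPn => xY; first by rewrite mulr1.
by rewrite mulr0.
Qed.

Lemma birkhoff_subsystem n x : Y x -> birkhoff psiY n x = birkhoff psi n x.
Proof.
move=> Yx; rewrite /birkhoff; apply: eq_bigr => i _.
rewrite /psiY indicE mem_set ?mulr1// => j.
by rewrite iter_left_shiftE; exact: Yx.
Qed.

Let prY : pr mu Y = 1. Proof. by rewrite /pr muY. Qed.

Lemma prIY U : measurable U -> pr mu (U `&` Y) = pr mu U.
Proof.
move=> mU; have mY := measurable_subsystem.
have mUY := measurableI _ _ mU mY; have mCY := measurableC mY.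
apply/eqP; rewrite eq_le pr_le//=.
have := prU_le mu mUY mCY; rewrite prC// prY subrr addr0; apply: le_trans.
apply: pr_le => //; first exact: measurableU.
by move=> x Ux; have [Yx|nYx] := pselect (Y x); [left|right].
Qed.

Section PartitionEntropy.
Variables (k : nat) (P : 'I_k -> set (mshift A)).
Hypothesis partP : finite_partition P.
Variables (M : nat) (cc : mshift A -> 'I_k).
Hypothesis ccM : forall x y, agree M x y -> cc x = cc y.
Local Notation Bad := [set x | ~ P (cc x) x].
Hypothesis mBad : measurable Bad.
Variable eps : R.
Hypothesis eps01 : 0 < eps <= 2^-1.

(** The probability assigned to index [j] when the guess is [i]. The total is at most 1, and no
    index has probability zero, so a wrong guess has finite logarithmic cost. *)
Let q (j i : 'I_k) : R := if j == i then 1 - eps else eps / k%:R.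

Let k_gt0 : 0 < k%:R :> R.
Proof. by rewrite ltr0n; exact: leq_ltn_trans (ltn_ord (cc point)). Qed.

Let epsk : 0 < eps / k%:R <= 1 - eps.
Proof.
have [e0 e1] := andP eps01; rewrite divr_gt0//= ler_pdivrMr//.
have k1 : 1 <= k%:R :> R by rewrite ler1n -(ltr0n R).
have : (1 - eps) * 1 <= (1 - eps) * k%:R by rewrite ler_wpM2l//; lra.
lra.
Qed.

Let q_gt0 j i : 0 < q j i.
Proof.
have [e0 e1] := andP epsk; rewrite /q; case: ifP => _ //.
exact: lt_le_trans e1.
Qed.

Let q_ge j i : eps / k%:R <= q j i.
Proof. by have [e0 e1] := andP epsk; rewrite /q; case: ifP. Qed.

Let sum_q i : \sum_j q j i <= 1.
Proof.
have [e0 e1] := andP eps01.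
rewrite (bigD1 i)//= {1}/q eqxx.
have -> : \sum_(j | j != i) q j i = \sum_(j < k | j != i) eps / k%:R.
  by apply: eq_bigr => j /negPf ji; rewrite /q ji.
apply: (@le_trans _ _ (1 - eps + \sum_(j < k) eps / k%:R)).
  rewrite lerD2l [leRHS](bigD1 i)//= lerDr.
  by case/andP: epsk => /ltW.
by rewrite sumr_const card_ord -[X in _ + X]mulr_natr divfK ?gt_eqF// subrK.
Qed.

(** The reference weight [r] of an itinerary and a word is the exponential weight of the word times
    the probability, under [q], of the itinerary given the guesses read off the word. Summing over
    itineraries gives at most 1 per word, so [r] has total at most [expR L]. Its logarithm returns
    the Birkhoff sum and the cost of the guesses. The [M] extra letters make all [n] guesses
    readable from the word. *)
Lemma partition_entropy_le n L :
  (forall (I : finType) (D : pred I) z, separated (n + M) D z ->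
    \sum_(i | D i) expR (birkhoff psi (n + M) (z i)) <= expR L) ->
  partition_entropy T mu P n <= L + distortion theta c -
    (n + M)%:R * (\int[mu]_x psiY x) +
    n%:R * (- ln (1 - eps) - pr mu Bad * ln (eps / k%:R)).
Proof.
move=> HL; have [e0 e1] := andP eps01; have [ek0 ek1] := andP epsk.
have mY := measurable_subsystem.
have [I [D0 [z [sepz _ zcov]]]] := words_ex A (n + M) F0.
pose J := ({ffun 'I_n -> 'I_k} * I)%type.
pose D (j : J) := D0 j.2.
pose B (j : J) := refined_atom T P j.1 `&` cyl (n + M) (z j.2) `&` Y.
pose r (j : J) := expR (birkhoff psi (n + M) (z j.2)) *
  \prod_(l < n) q (j.1 l) (cc (iter l T (z j.2))).
have mB j : D j -> measurable (B j).
  move=> _; apply: measurableI => //; apply: measurableI.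
    exact: measurable_refined_atom.
  exact: measurable_cyl.
have disjB i j x : D i -> D j -> B i x -> B j x -> i = j.
  move: i j => [w i] [w' j] Di Dj [[wx zx] _] [[w'x z'x] _].
  congr pair; first exact: itinerary_inj partP wx w'x.
  by apply: sepz => //; exact: agree_trans zx (agree_sym z'x).
have covB x : Y x -> exists2 j, D j & B j x.
  move=> Yx; have [w wx] := itinerary_ex n x partP.
  have [|i Di zx] := zcov x; first by move=> l _; exact: Yx.
  by exists (w, i).
have sumB (U : set (mshift A)) (Q : pred J) : measurable U ->
    (forall j, D j -> Q j -> B j `<=` U) ->
    (forall j x, D j -> B j x -> U x -> Q j) ->
    \sum_(j | D j && Q j) pr mu (B j) = pr mu U.
  move=> mU BU UB; apply/eqP; rewrite eq_le; apply/andP; split.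
    apply: sum_pr_le => //.
    - by move=> j /andP[Dj _]; exact: mB.
    - by move=> i j x /andP[Di _] /andP[Dj _]; exact: disjB.
    - exact: index_enum_uniq.
    - by move=> j _ /andP[Dj Qj]; exact: BU.
  rewrite -(prIY mU); apply: sum_pr_ge => //.
  - by move=> j /andP[Dj _]; exact: mB.
  - by move=> i j x /andP[Di _] /andP[Dj _]; exact: disjB.
  - exact: index_enum_uniq.
  - exact: measurableI.
  - move=> x [Ux /covB[j Dj Bj]]; exists j; rewrite mem_index_enum Dj.
    by split=> //; exact: UB Dj Bj Ux.
have sum1 : \sum_(j | D j) pr mu (B j) = 1.
  rewrite -[RHS](pr_setT mu) -(sumB setT predT)//.
  by apply: eq_bigl => j; rewrite andbT.
have r0 j : D j -> 0 < r j.
  by move=> _; rewrite mulr_gt0 ?expR_gt0// prodr_gt0.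
have sumr : \sum_(j | D j) r j <= expR L.
  apply: le_trans (HL I D0 z sepz).
  rewrite (eq_bigl (fun j : J => true && D0 j.2))//.
  rewrite -(pair_big predT D0 (fun w i => r (w, i)))/= exchange_big/=.
  apply: ler_sum => i _; rewrite /r /= -mulr_sumr ler_piMr ?expR_ge0//.
  rewrite -(bigA_distr_bigA (fun (l : 'I_n) j => q j (cc (iter l T (z i)))))/=.
  apply: (@le_trans _ _ (\prod_(l < n) (1 : R))); last by rewrite big1.
  apply: ler_prod => l _; rewrite sum_q andbT.
  by apply: sumr_ge0 => j _; exact: ltW.
have pE (w : {ffun 'I_n -> 'I_k}) : pr mu (refined_atom T P w) =
    \sum_(j | D j && (j.1 == w)) pr mu (B j).
  rewrite -(sumB (refined_atom T P w) (fun j => j.1 == w))//.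
  - exact: measurable_refined_atom.
  - by move=> j Dj /eqP <- x [[]].
  - by move=> j x Dj [[jx _] _] wx; apply/eqP; exact: itinerary_inj partP jx wx.
have := entropy_marginal_le (fun j _ => pr_ge0 mu (B j)) r0 sum1 sumr pE.
rewrite -[X in X + _ <= _ -> _]/(partition_entropy T mu P n) => entr.
(* The least logarithm of [q] compatible with whether the guess at [x] is right. As a function of
   [x] alone, its Birkhoff sums integrate by invariance. *)
pose b x := ln (1 - eps) + (ln (eps / k%:R) - ln (1 - eps)) * \1_Bad x.
have bb : bounded_measurable b.
  by apply: bmD; [exact: bm_cst|apply: bmZ; exact: bm_indic].
have [bN eN] := avg_birkhoff (n + M) inv subsystem_bm.
have [bn en] := avg_birkhoff n inv bb.
have ln_eps : ln (1 - eps) <= 0 by rewrite ln_le0//; lra.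
have avgb : ln (1 - eps) + pr mu Bad * ln (eps / k%:R) <= \int[mu]_x b x.
  rewrite /b avgD; [|exact: bm_cst|by apply: bmZ; exact: bm_indic].
  rewrite avg_cst avgZ; last exact: bm_indic.
  rewrite avg_indic// lerD2l mulrBl mulrC.
  by have : ln (1 - eps) * pr mu Bad <= 0; [rewrite mulr_le0_ge0 ?pr_ge0//|lra].
have bh := bmD bN bn; have [_ [H hH]] := bh.
have hH' x : birkhoff psiY (n + M) x + birkhoff b n x <= H.
  exact: le_trans (ler_norm _) (hH x).
have hB j x : D j -> B j x -> birkhoff psiY (n + M) x + birkhoff b n x <=
    ln (r j) + distortion theta c.
  move=> Dj [[jx zx] Yx].
  have prod0 : 0 < \prod_(l < n) q (j.1 l) (cc (iter l T (z j.2))).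
    by rewrite prodr_gt0.
  rewrite /r lnM ?posrE ?expR_gt0// expRK birkhoff_subsystem//.
  have := birkhoff_distortion theta01 c_ge0 psic (agree_sym zx).
  suff : birkhoff b n x <= ln (\prod_(l < n) q (j.1 l) (cc (iter l T (z j.2)))) by lra.
  rewrite ln_prod//; apply: ler_sum => l _.
  rewrite /b indicE; have [bad|good] := pselect (Bad (iter l T x)).
    rewrite mem_set// mulr1 subrKC ler_ln ?posrE//; exact: q_ge.
  rewrite memNset// mulr0 addr0.
  have -> : cc (iter l T (z j.2)) = j.1 l; last by rewrite /q eqxx.
  have <- : cc (iter l T x) = cc (iter l T (z j.2)).
    apply/esym/ccM/agree_iter_left_shift; apply: agree_le zx.
    by rewrite leq_add2r ltnW.
  have [_ tP _] := partP; apply: tP => //; exists (iter l T x); split.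
    by apply: contrapT.
  exact: (iffLR (refined_atomP _ _ _) jx).
have := avg_partition_le mu mB disjB bh hH' hB.
rewrite sum1 subrr mul0r addr0 avgD// eN en.
under eq_bigr do [rewrite mulrDr]; rewrite big_split/= -mulr_suml sum1 mul1r.
have : n%:R * (ln (1 - eps) + pr mu Bad * ln (eps / k%:R)) <= n%:R * \int[mu]_x b x.
  by rewrite ler_wpM2l.
move: entr; rewrite !mulrDr !mulrN.
lra.
Qed.

End PartitionEntropy.
End Variational.

Section FreeEnergy.
Variables (R : realType) (S : countType) (A : transMatrix S) (theta : R).
Hypothesis theta01 : 0 < theta < 1.
Variables (c : R) (psi : mshift A -> R).
Hypotheses (c_ge0 : 0 <= c) (psic : holder theta c psi).
Local Notation T := (@left_shift S A).
Implicit Types (x y : mshift A).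
Variables (mu : probability (mshift A) R) (F0 : {fset S}) (V : R).
Local Notation Y := (subsystem A F0).
Hypotheses (inv : invariant_measure T mu) (muY : mu Y = 1%E).
Hypothesis HV : forall gam, 0 < gam -> exists K, forall n (I : finType)
  (D : pred I) z, separated n D z ->
  \sum_(i | D i) expR (birkhoff psi n (z i)) <= expR (n%:R * (V + gam) + K).

Let psiY (x : mshift A) := psi x * \1_Y x.

(** The margin [d] is split into thirds: the slack in [HV], the cost of right guesses and the cost
    of wrong ones. *)
Lemma partition_entropy_growth k (P : 'I_k -> set (mshift A)) d :
  finite_partition P -> 0 < d ->
  exists K, forall n, partition_entropy T mu P n <=
    n%:R * (V - \int[mu]_x psiY x + d) + K.
Proof.
move=> partP d0.
have d30 : 0 < d / 3 by rewrite divr_gt0.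
have ln2 : 0 < ln 2 :> R by rewrite ln_gt0// ltr1n.
(* [eps] is fixed before the guessing map, since the cost of an error, hence the tolerated error
   probability, depends on it. The cap [ln 2] ensures [eps <= 2^-1]. *)
pose d' := Num.min (d / 3) (ln 2).
have d'0 : 0 < d' by rewrite lt_min d30 ln2.
pose eps := 1 - expR (- d').
have ed' : expR (- d') < 1 by rewrite -expR0 ltr_expR oppr_lt0.
have ed2 : 2^-1 <= expR (- d').
  rewrite -[leLHS](lnK (x := 2^-1)) ?posrE ?invr_gt0// ler_expR lnV ?posrE//.
  by rewrite lerN2 ge_min lexx orbT.
have eps01 : 0 < eps <= 2^-1.
  rewrite /eps subr_gt0 ed'/=; have : (2^-1 : R) + 2^-1 = 1 by field.
  lra.
have lneps : - ln (1 - eps) <= d / 3.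
  by rewrite /eps opprB subrKC expRK opprK ge_min lexx.
pose l := `|ln (eps / k%:R)| + 1.
have l0 : 0 < l by rewrite ltr_wpDl.
have e0 : 0 < d / 3 / l by rewrite divr_gt0.
have [M [cc [ccM mBad Bad_le]]] := approximate_partition mu partP e0.
have bad_cost : - (pr mu [set x | ~ P (cc x) x] * ln (eps / k%:R)) <= d / 3.
  rewrite -mulrN; apply: le_trans (ler_norm _) _; rewrite normrM normrN.
  rewrite (ger0_norm (pr_ge0 _ _)).
  apply: (@le_trans _ _ (d / 3 / l * l)); last by rewrite divfK ?gt_eqF.
  by apply: ler_pM => //; rewrite ?pr_ge0// lerDl.
have [K HK] := HV d30.
exists (M%:R * (V + d / 3) + K + distortion theta c - M%:R * (\int[mu]_x psiY x)) => n.
have := @partition_entropy_le R S A theta theta01 c psi c_ge0 psic mu F0 inv muY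
  k P partP M cc ccM mBad eps eps01 n ((n + M)%:R * (V + d / 3) + K).
move=> /(_ (fun I D z sepz => HK _ I D z sepz)) h; apply: le_trans h _.
have : n%:R * (- ln (1 - eps) - pr mu [set x | ~ P (cc x) x] * ln (eps / k%:R)) <=
    n%:R * (d / 3 + d / 3) by rewrite ler_wpM2l// lerD.
rewrite -/psiY natrD !mulrDl !mulrDr.
lra.
Qed.

(** The trivial partition has entropy zero for every [n], so the linear growth bound cannot have a
    negative rate. *)
Lemma entropy_bound_ge0 : 0 <= V - \int[mu]_x psiY x.
Proof.
rewrite leNgt; apply/negP => neg; set v := V - _ in neg.
pose P (i : 'I_1) : set (mshift A) := setT.
have partP : finite_partition P.
  split; [by move=> i; exact: measurableT|by move=> i j _ _ _; rewrite !ord1|].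
  by apply/seteqP; split=> // x _; exists ord0.
have d0 : 0 < - v / 2 by rewrite divr_gt0// oppr_gt0.
have [K HK] := partition_entropy_growth partP d0.
have H0 n : partition_entropy T mu P n = 0.
  rewrite /partition_entropy big1// => w _.
  have -> : refined_atom T P w = setT by apply/seteqP; split=> // x _ i.
  by rewrite -/(pr mu setT) pr_setT ln1 mulr0 oppr0.
have Kn n : n%:R * (- v / 2) <= K.
  by have := HK n; rewrite H0 -/v -subr_ge0 => h; rewrite -subr_ge0; move: h; lra.
have := archi_boundP (x := (`|K| + 1) / (- v / 2)).
rewrite divr_ge0 ?(ltW d0) ?addr_ge0// => /(_ isT).
set n := Num.bound _; rewrite ltr_pdivrMr// => /lt_le_trans/(_ (Kn n)).
by have := ler_norm K; lra.
Qed.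

Lemma entropy_wrt_le k (P : 'I_k -> set (mshift A)) :
  finite_partition P -> entropy_wrt T mu P <= V - \int[mu]_x psiY x.
Proof.
move=> partP; rewrite /entropy_wrt; set u := fun n => _.
(* If the sequence diverged, [limn] would return the default value 0, which the bound must then
   dominate. *)
have [cu|ncu] := pselect (cvgn u); last first.
  suff -> : limn u = 0 by exact: entropy_bound_ge0.
  by rewrite /lim /lim_in xgetPN// => x ux; apply: ncu; apply/cvg_ex; exists x.
apply/ler_addgt0Pr => d d0; have [K HK] := partition_entropy_growth partP d0.
have cvgK : (fun n => V - \int[mu]_x psiY x + d + n%:R^-1 * K) @ \oo -->
    V - \int[mu]_x psiY x + d.
  rewrite -[X in _ --> X]addr0; apply: cvgD; first exact: cvg_cst.
  rewrite -(mul0r K); apply: cvgM; last exact: cvg_cst.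
  by apply/gtr0_cvgV0; [exists 1%N => // n /=; rewrite ltr0n|exact: cvgr_idn].
rewrite -(cvg_lim _ cvgK)//; apply: ler_lim => //.
  by apply/cvg_ex; eexists; exact: cvgK.
exists 1%N => // n /= n1; have n0 : 0 < n%:R :> R by rewrite ltr0n.
rewrite /u ler_pdivrMr// (le_trans (HK n))//.
by rewrite mulrDl mulrAC mulVf ?gt_eqF// mul1r mulrC.
Qed.

Lemma free_energy_le : (free_energy psi Y mu <= V%:E)%E.
Proof.
rewrite /free_energy (subsystem_integral theta01 c_ge0 psic)// -/psiY.
have ks : (ks_entropy T mu <= (V - \int[mu]_x psiY x)%:E)%E.
  apply: ge_ereal_sup => _ [k [P [partP ->]]].
  by rewrite lee_fin; exact: entropy_wrt_le.
apply: le_trans (leeD2r _ ks) _.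
by rewrite -EFinD subrK.
Qed.

End FreeEnergy.

(** * The comparison inequality *)

Section Norms.
Variables (R : realType) (S : countType) (A : transMatrix S) (theta : R).
Hypothesis theta01 : 0 < theta < 1.
Implicit Types (x y : mshift A) (f : mshift A -> R).

Lemma locally_holder_holder phi : locally_holder theta phi ->
  exists2 c, 0 <= c & @holder R S A theta c phi.
Proof.
move=> [c c0 phic]; exists c; first exact: ltW.
move=> r x y r0 xy; rewrite -lee_fin; apply: le_trans (phic r r0).
by apply: ereal_sup_ubound; exists x, y.
Qed.

Lemma dist_agree r x y : agree r x y -> dist theta x y <= theta ^+ r.
Proof.
have [t0 t1] := andP theta01 => xy; rewrite /dist; case: pselect => [h|_].
  case: ex_minnP => i xyi _; rewrite ler_wiXn2l ?ltW//.
  by rewrite leqNgt; apply/negP => /xy; exact/eqP.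
by rewrite exprn_ge0// ltW.
Qed.

Lemma dist_gt0 x y : x <> y -> 0 < dist theta x y.
Proof.
have [t0 _] := andP theta01; move=> nxy; rewrite /dist.
case: pselect => [h|nh]; first by rewrite exprn_gt0.
exfalso; apply: nxy; apply: mshift_inj => i; apply/eqP/negP => /negP xyi.
by apply: nh; exists i.
Qed.

Lemma L_space_bounds f : L_space theta f -> exists nu,
  [/\ L_norm theta f = nu%:E, 0 <= nu, holder theta nu f & forall x, `|f x| <= nu].
Proof.
move=> [_ fL].
have sup_ge x : (`|f x|%:E <= sup_norm f)%E by apply: ereal_sup_ubound; exists x.
have semi_ge0 : (0 <= theta_seminorm theta f)%E.
  by apply: ereal_sup_ubound; left.
have sup_ge0 : (0 <= sup_norm f)%E by apply: le_trans (sup_ge point); rewrite lee_fin.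
have L0 : (0 <= L_norm theta f)%E by rewrite adde_ge0.
have LE : L_norm theta f = (fine (L_norm theta f))%:E.
  by rewrite fineK// ge0_fin_numE.
exists (fine (L_norm theta f)); split => //; first exact: fine_ge0.
- move=> r x y r0 xy; have [->|nxy] := pselect (x = y).
    rewrite subrr mulr_ge0 ?fine_ge0// exprn_ge0//.
    by case/andP: theta01 => /ltW.
  have d0 := dist_gt0 nxy.
  have : ((`|f x - f y| / dist theta x y)%:E <= L_norm theta f)%E.
    apply: (@le_trans _ _ (theta_seminorm theta f)).
      by apply: ereal_sup_ubound; right; exists x, y; rewrite (xy 0%N).
    by rewrite /L_norm leeDl.
  rewrite LE lee_fin ler_pdivrMr// => le1.
  apply: le_trans (ler_norm _) (le_trans le1 _).
  by rewrite ler_wpM2l ?fine_ge0// dist_agree.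
- move=> x; rewrite -lee_fin -LE; apply: le_trans (sup_ge x) _.
  by rewrite /L_norm leeDr.
Qed.

End Norms.

(** Irreducibility gives a closed walk at [s], and repeating it gives a periodic point. The walk [p]
    ends at [s'], so index [k] in [s' :: p] is identified with index 0. *)
Lemma exhaustive_letter (S : countType) (A : transMatrix S) (S_ : nat -> {fset S}) s :
  exhaustive A S_ -> exists x : mshift A, x 0%N = s.
Proof.
move=> [irr _ /(_ s)[n sn]].
have [k k0 [p [pk pp pl]]] := (irr n).1 [` sn]%fset [` sn]%fset.
set s' := [` sn]%fset in pp pl.
pose x i := val (nth s' (s' :: p) (i %% k)).
have Ax : admissible A x.
  move=> i; have ik : (i %% k < size p)%N by rewrite pk ltn_mod.
  have := (pathP s' pp) _ ik.
  rewrite /submatrix /x -[i.+1]addn1 -modnDml addn1.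
  case: (ltngtP (i %% k).+1 k) => [ik'|ik'|ik'].
  - by rewrite (modn_small ik').
  - by move: ik; rewrite pk ltnNge -ltnS ik'.
  - rewrite ik' modnn /=; have -> // : nth s' p (i %% k) = s'.
    have -> : (i %% k)%N = k.-1 by rewrite -[in RHS]ik'.
    by rewrite -pk nth_last.
exists (mkshift Ax).
by rewrite mkshiftE /x mod0n.
Qed.

(** The parameter [t = D / (8 * G ^+ 2)] maximizes [t * D - 4 * (t * G) ^+ 2], with value
    [D ^+ 2 / (16 * G ^+ 2)]. *)
Lemma sqrt_bound (R : realType) (a b D G : R) : 0 < G ->
  (forall t, b + t * D <= a + 4 * (t * G) ^+ 2) -> `|D| <= 4 * G * Num.sqrt (a - b).
Proof.
move=> G0 h.
have := h (D / (8 * G ^+ 2)).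
have -> : D / (8 * G ^+ 2) * D = 2 * (D / (4 * G)) ^+ 2 by field; rewrite gt_eqF.
have -> : 4 * (D / (8 * G ^+ 2) * G) ^+ 2 = (D / (4 * G)) ^+ 2 by field; rewrite gt_eqF.
move=> le1; have le2 : (D / (4 * G)) ^+ 2 <= a - b by lra.
have G4 : 0 < 4 * G by rewrite mulr_gt0.
rewrite mulrC -ler_pdivrMr// -[X in _ / X](gtr0_norm G4) -normf_div.
by rewrite -sqrtr_sqr ler_wsqrtr.
Qed.

Section Comparison.
Variables (R : realType) (S : countType) (A : transMatrix S) (theta : R).
Hypothesis theta01 : 0 < theta < 1.
Variables (c : R) (phi : mshift A -> R).
Hypotheses (c_ge0 : 0 <= c) (phic : holder theta c phi).
Local Notation T := (@left_shift S A).
Implicit Types (x y : mshift A) (f : mshift A -> R).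
Variables (mu : probability (mshift A) R) (F0 : {fset S}).
Local Notation Y := (subsystem A F0).
Hypotheses (inv : invariant_measure T mu) (muY : mu Y = 1%E).

Lemma avg_subsystem f nu : bounded_measurable f -> (forall x, `|f x| <= nu) ->
  \int[mu]_x (f x * \1_Y x) = \int[mu]_x (f x).
Proof.
move=> bf fnu; have mY : measurable Y by exact: measurable_subsystem.
have mCY := measurableC mY.
have prCY : pr mu (~` Y) = 0 by rewrite prC// /pr muY subrr.
have bfY : bounded_measurable (fun x => f x * \1_Y x).
  have [mf [H fH]] := bf; split; first by apply: measurable_funM => //; exact: measurable_indic.
  exists H => x; rewrite indicE; case: (x \in Y) => /=; rewrite ?mulr1// mulr0 normr0.
  exact: le_trans (fH x).
have bC a := bmZ a (bm_indic R mCY).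
have avgC a : \int[mu]_x (a * \1_(~` Y) x) = 0.
  by rewrite avgZ ?avg_indic ?prCY ?mulr0//; exact: bm_indic.
have pointwise x : - nu * \1_(~` Y) x <= f x - f x * \1_Y x <= nu * \1_(~` Y) x.
  rewrite !indicE in_setC; case: (x \in Y) => /=.
    by rewrite mulr1 !mulr0 subrr lexx.
  by rewrite mulr0 !mulr1 subr0 -ler_norml.
apply/eqP; rewrite eq_le; apply/andP; split.
  rewrite -[leLHS]addr0 -(avgC (- nu)) -avgD//; apply: avg_le => //; first exact: bmD.
  by move=> x; have := pointwise x; lra.
rewrite -[leRHS]addr0 -(avgC nu) -avgD//; apply: avg_le => //; first exact: bmD.
by move=> x; have := pointwise x; lra.
Qed.

(** The variational inequality for [phi + t f] is linear in the integral of [f] under [mu]. The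
    entropy must first be shown finite: the trivial partition bounds it from below, the case [t = 0]
    from above. *)
Lemma free_energy_gap (m : probability (mshift A) R) P g f nu :
  (forall t gam, 0 < gam -> exists K, forall n (I : finType) (D : pred I) z,
    separated n D z ->
    \sum_(i | D i) expR (birkhoff (fun x => phi x + t * f x) n (z i)) <=
    expR (n%:R * (P + t * \int[m]_x (f x) + 4 * (t * (g * nu)) ^+ 2 + gam) + K)) ->
  0 <= nu -> holder theta nu f -> (forall x, `|f x| <= nu) ->
  exists b : R, free_energy phi Y mu = b%:E /\ forall t,
    b + t * (\int[mu]_x (f x) - \int[m]_x (f x)) <= P + 4 * (t * (g * nu)) ^+ 2.
Proof.
move=> HK nu0 fnu fb.
have bf : bounded_measurable f.
  split; last by exists nu.
  by apply: continuous_measurable; exact: (holder_continuous theta01 nu0 fnu).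
have psic t := holderD phic (holderM t nu0 fnu).
have cpsi0 (t : R) : 0 <= c + `|t| * nu by rewrite addr_ge0// mulr_ge0.
have bphiY := subsystem_bm theta01 c_ge0 phic F0.
have FE_le t : (ks_entropy T mu + (\int[mu]_x (phi x * \1_Y x) +
    t * \int[mu]_x (f x))%:E <=
    (P + t * \int[m]_x (f x) + 4 * (t * (g * nu)) ^+ 2)%:E)%E.
  have := free_energy_le theta01 (cpsi0 t) (psic t) inv muY (HK t).
  rewrite /free_energy (subsystem_integral theta01 (cpsi0 t) (psic t) mu F0).
  have bfY := subsystem_bm theta01 nu0 fnu F0.
  rewrite (_ : \int[mu]_x _ = \int[mu]_x (phi x * \1_Y x) + t * \int[mu]_x (f x))//.
  rewrite -(avg_subsystem bf fb) -avgZ// -avgD//; last exact: bmZ.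
  by apply: eq_Rintegral => x _; rewrite mulrDl mulrA.
have [h hE] : exists h : R, ks_entropy T mu = h%:E.
  have partP : finite_partition (fun i : 'I_1 => [set: mshift A]).
    split; [by move=> i; exact: measurableT|by move=> i j _ _ _; rewrite !ord1|].
    by apply/seteqP; split=> // x _; exists ord0.
  have : ((entropy_wrt T mu (fun i : 'I_1 => [set: mshift A]))%:E <= ks_entropy T mu)%E.
    by apply: ereal_sup_ubound; exists 1%N, (fun i : 'I_1 => [set: mshift A]).
  have := FE_le 0; case: (ks_entropy T mu) => [h| |] //.
  by exists h.
exists (h + \int[mu]_x (phi x * \1_Y x)); split.
  by rewrite /free_energy hE (subsystem_integral theta01 c_ge0 phic mu F0).
by move=> t; have := FE_le t; rewrite hE -EFinD lee_fin mulrBr; lra.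
Qed.

End Comparison.

Theorem corollary4p1 (R : realType) (S : countType) (A : transMatrix S)
    (theta : R) (phi : mshift A -> R) :
  topologically_mixing (@left_shift S A) ->
  0 < theta < 1 ->
  locally_holder theta phi ->
  exists a : R, 0 < a /\
    forall m : probability (mshift A) R, gibbs phi m ->
    forall S_ : nat -> {fset S}, exhaustive A S_ ->
    forall m_ : nat -> probability (mshift A) R,
    (forall n, equilibrium_on phi (subsystem A (S_ n)) (m_ n)) ->
    forall (n : nat) (f : mshift A -> R) (s : S), L_space theta f ->
    (`|\int[m]_x (f x)%:E - \int[m_ n]_x (f x)%:E|
       <= a%:E * L_norm theta f *
          sqrte (gurevich_sarig_pressure phi s
                 - free_energy phi (subsystem A (S_ n)) (m_ n)))%E.
Proof.
move=> mixT theta01 /locally_holder_holder[c c0 phic].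
(* The constant is chosen before [m], so it is extracted from some Gibbs measure [m0]; if there is
   none, the claim is empty. *)
have [[m0 /gibbsP[C0 [P m0G]]]|nogibbs] :=
  pselect (exists m : probability (mshift A) R, gibbs phi m); last first.
  by exists 1; split=> // m mG; exfalso; apply: nogibbs; exists m.
have [g g0 HK] := separated_sum_bound theta01 c0 phic mixT m0G.
exists (4 * g); split; first by rewrite mulr_gt0.
move=> m /gibbsP[C1 [P1 mG]] S_ exS m_ eqm n f s fL.
have xs := exhaustive_letter s exS.
have PE := gibbs_pressure theta01 c0 phic m0G mixT xs.
have P1E : P1 = P.
  by apply: EFin_inj; rewrite -PE -(gibbs_pressure theta01 c0 phic mG mixT xs).
rewrite P1E in mG.
have [[inv muY] _] := eqm n.
have [nu [LE nu0 fnu fb]] := L_space_bounds theta01 fL.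
have bf : bounded_measurable f.
  by split; [apply: continuous_measurable; case: fL|exists nu].
have [b [bE hb]] := free_energy_gap theta01 c0 phic inv muY (HK m C1 mG f nu nu0 fnu fb) nu0 fnu fb.
rewrite PE bE LE !avgE// -EFinB -EFinM /= lee_fin distrC.
(* [sqrt_bound] divides by [g * nu], so the case [nu = 0], where [f] vanishes, is treated apart. *)
move: nu0; rewrite le_eqVlt => /predU1P[nu0|nu0].
  have f0 : f = fun=> 0.
    by apply/funext => x; apply/eqP; rewrite -normr_le0 nu0.
  by rewrite f0 !avg_cst subrr normr0 -nu0 mulr0 mul0r.
have := sqrt_bound (mulr_gt0 g0 nu0) hb.
by rewrite mulrA.
Qed.
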